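(* Let $1<r\le p<\infty$ and let $X$ be a real Banach space. Then the following are equivalent: (1) $X$ admits a uniformly $H^r$-smooth bump function; (2) $L_p(X)$ admits a uniformly $H^r$-smooth bump function; (3) $L_p(X)$ admits an $H^r$-smooth bump function.
   Context: $(\Omega,\mu)$ is a measure space with $L_p(\Omega,\mu)$ infinite-dimensional, and $L_p(X)$ is the Lebesgue–Bochner space of measurable $u:\Omega\to X$ with $(\int_\Omega\|u(s)\|^p d\mu)^{1/p}<\infty$. A bump function is a real-valued function with bounded nonempty support. For real $s>1$, with $n$ the largest integer strictly less than $s$: $g$ is $H^s$-smooth if it is $C^n$ and $g^{(n)}$ is locally uniformly $(s-n)$-Hölder (for every $x$ there are $\delta,M>0$ with $\|g^{(n)}(y)-g^{(n)}(z)\|\le M\|y-z\|^{s-n}$ for $y,z\in B(x,\delta)$); $g$ is uniformly $H^s$-smooth if this inequality holds for all $y,z$ in the whole space with one constant $M$. *)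

(* Defs.v *)
From HB Require Import structures.
From mathcomp Require Import all_boot all_order all_algebra.
From mathcomp Require Import all_classical all_reals all_analysis.
Set Implicit Arguments. Unset Strict Implicit. Unset Printing Implicit Defensive.
Import Order.TTheory GRing.Theory Num.Theory.
Import numFieldNormedType.Exports.
Local Open Scope classical_set_scope.
Local Open Scope ring_scope.

Section Smooth.
Variables (R : realType) (V : lmodType R).
(* S : the (linear) subspace of V on which everything lives, N : a seminorm on it *)
Variables (S : set V) (N : V -> R).

Definition in_S (k : nat) (h : 'I_k -> V) := forall i, S (h i).

Definition prodN (k : nat) (h : 'I_k -> V) : R := \prod_(i < k) N (h i).

Definition bounded_multilinear (k : nat) (A : ('I_k -> V) -> R) :=
  (forall (h : 'I_k -> V) (i : 'I_k) (a : R) (v w : V),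
      in_S h -> S v -> S w ->
      A (fun j => if j == i then a *: v + w else h j) =
      a * A (fun j => if j == i then v else h j) + A (fun j => if j == i then w else h j))
  /\ exists M : R, forall h : 'I_k -> V, in_S h -> `|A h| <= M * prodN h.

Definition consI (k : nat) (v : V) (h : 'I_k -> V) : 'I_k.+1 -> V :=
  fun j => match unlift ord0 j with None => v | Some j' => h j' end.

Definition Cn_derivs (n : nat) (g : V -> R) (D : forall k : nat, V -> ('I_k -> V) -> R) :=
  [/\ (forall x (h : 'I_0 -> V), S x -> D 0 x h = g x),
      (forall k x, (k <= n)%N -> S x -> bounded_multilinear (D k x)),
      (forall k x, (k < n)%N -> S x -> forall e : R, 0 < e -> exists2 del : R, 0 < del &
          forall y, S y -> N (y - x) < del -> forall h : 'I_k -> V, in_S h ->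
            `|D k y h - D k x h - D k.+1 x (consI (y - x) h)| <= e * N (y - x) * prodN h) &
      (forall x, S x -> forall e : R, 0 < e -> exists2 del : R, 0 < del &
          forall y, S y -> N (y - x) < del -> forall h : 'I_n -> V, in_S h ->
            `|D n y h - D n x h| <= e * prodN h)].

Definition Hs_smooth (s : R) (g : V -> R) :=
  exists n : nat, [/\ n%:R < s, s <= n.+1%:R &
    exists D, Cn_derivs n g D /\
      forall x, S x -> exists del : R, exists M : R, 0 < del /\
        forall y z, S y -> S z -> N (y - x) < del -> N (z - x) < del ->
          forall h : 'I_n -> V, in_S h ->
            `|D n y h - D n z h| <= M * powR (N (y - z)) (s - n%:R) * prodN h].

Definition uniformly_Hs_smooth (s : R) (g : V -> R) :=
  exists n : nat, [/\ n%:R < s, s <= n.+1%:R &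
    exists D, Cn_derivs n g D /\
      exists M : R, forall y z, S y -> S z ->
          forall h : 'I_n -> V, in_S h ->
            `|D n y h - D n z h| <= M * powR (N (y - z)) (s - n%:R) * prodN h].

Definition is_bump (g : V -> R) :=
  (exists x, S x /\ g x != 0) /\
  exists B : R, forall x, S x -> g x != 0 -> N x <= B.

End Smooth.

Section Bochner.
Variables (R : realType) (d : measure_display) (T : measurableType d).
Variable (mu : {measure set T -> \bar R}).
Variable (X : normedModType R).

Definition simple_fun (f : T -> X) :=
  finite_set (range f) /\ forall x : X, measurable (f @^-1` [set x]).

Definition strongly_measurable (u : T -> X) :=
  exists f : nat -> T -> X, (forall n, simple_fun (f n)) /\
    {ae mu, forall t, (fun n => f n t) @ \oo --> u t}.

Definition Lp_integral (p : R) (u : T -> X) : \bar R :=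
  (\int[mu]_t (powR `|u t| p)%:E)%E.

(* the set of (representatives of) elements of the Lebesgue-Bochner space L_p(X) *)
Definition Lp_set (p : R) : set (T -> X) :=
  [set u | strongly_measurable u /\ (Lp_integral p u < +oo)%E].

(* the L_p seminorm (a norm on classes modulo a.e. equality) *)
Definition Lp_norm (p : R) (u : T -> X) : R := powR (fine (Lp_integral p u)) p^-1.

End Bochner.

Definition Lp_infinite_dim (R : realType) (d : measure_display) (T : measurableType d)
  (mu : {measure set T -> \bar R}) (p : R) :=
  forall n : nat, exists f : 'I_n -> (T -> R), (forall i, Lp_set mu p (f i)) /\
    forall c : 'I_n -> R,
      Lp_norm mu p (fun t => \sum_(i < n) c i * f i t) = 0 -> forall i, c i = 0.

(* Main.v *)
Require Import Defs.
From HB Require Import structures.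
From mathcomp Require Import all_boot all_order all_algebra.
From mathcomp Require Import all_classical all_reals all_analysis.
From mathcomp Require Import measurable_realfun simple_functions ring lra zify.
Set Implicit Arguments.
Unset Strict Implicit.
Unset Printing Implicit Defensive.
Import Order.TTheory GRing.Theory Num.Theory.
Import numFieldNormedType.Exports HBNNSimple.
Local Open Scope classical_set_scope.
Local Open Scope ring_scope.

(* From a uniformly smooth bump on [X] one builds an annular bump [f] and the function [Phi x = \sum_(k in Z) 2 ^ (k p) f (2 ^ - k x)], which lies between two multiples of [|x| ^ p] and whose derivatives satisfy estimates homogeneous of degree [p]. Since [r <= p], Hoelder's inequality turns these into estimates on bounded sets for [F u = \int Phi (u t)] on [L_p(X)], and a power of the positive part of [1 - F] is a uniformly smooth bump.

Conversely, let [g] be a locally smooth bump on [L_p(X)] with [g v > 0], and suppose that [X] has no uniformly smooth bump. As [L_p] is infinite-dimensional, there are infinitely many disjoint sets of positive finite measure, hence a copy of [l_p(X)]. From [u_k] one can then always move in a fresh coordinate, by a step comparable to the radius of the largest ball around [u_k] on which [g] is uniformly smooth, while losing arbitrarily little of the value of [g]. The points [u_k] stay in the support of [g], so the [p]-th powers of the steps are summable and [u_k] converges to some [u]; the ball of smoothness around [u] then prevents the steps from tending to [0]. *)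

(** * Real inequalities and Hoelder-smooth families of multilinear forms *)

(** Smoothness is carried by estimates on Taylor remainders ([Hol]): at each order below the top one
    the remainder is at most a constant times [t * t ^ al], where [t] is the length of the increment
    and [al = r - n]. Such estimates survive sums, products, composition and, being pointwise
    inequalities, integration, so that nothing has to be differentiated under an integral sign.
    Hoelder's inequality wants total degree exactly [p] in base point, increment and directions;
    this is why [Phi] has to behave like a [p]-homogeneous function, and [r <= p] leaves a
    nonnegative power for the base point. In the converse, fresh coordinates make the norms of the
    steps add up in [p]-th powers. Tying each step to the nearly largest radius of smoothness at
    [u_k] is what makes small steps contradictory; with freely chosen steps the sequence could
    converge without any conflict. Elements of [L_p(X)] are functions, not classes, and radii are
    compared through a quasi-triangle inequality with factor 4, hence the slack in the radii. *)

Section RealFacts.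
Variable R : realType.
Implicit Types t a x y : R.

Lemma le_self_powR t a : 0 <= t <= 1 -> 0 <= a <= 1 -> t <= t `^ a.
Proof.
move=> /andP[t0 t1] /andP[a0 a1]; case: (ltgtP t 0) => [|tp|->].
- by rewrite ltNge t0.
- by apply: ger1_powR; rewrite ?tp.
- exact: powR_ge0.
Qed.

Lemma powR_le_mono t x a : 0 <= a -> 0 <= t -> t <= x -> t `^ a <= x `^ a.
Proof.
by move=> a0 t0 tx; apply: ge0_ler_powR; rewrite ?nnegrE// (le_trans t0).
Qed.

(** Estimates that divide by a norm are first proved with a strict upper bound [c] of it; this
    removes [c], also when the norm is 0. For positive [K] and [b], if the conclusion failed, the
    midpoint of [t] and the root of [K * c ^ b = a] would violate the hypothesis. *)
Lemma le_powR_limit (a b K t : R) : 0 <= K -> 0 <= b -> 0 <= t ->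
  (forall c, t < c -> a <= K * c `^ b) -> a <= K * t `^ b.
Proof.
move=> K0 b0 t0 H; rewrite leNgt; apply/negP => lta.
have [b00|b00] := eqVneq b 0.
  by move: (H (t + 1)); rewrite b00 !powRr0 ltrDl ltr01 => /(_ isT); rewrite b00 powRr0 in lta; lra.
have bp : 0 < b by rewrite lt_neqAle eq_sym b00.
have [K00|K00] := eqVneq K 0.
  by move: (H (t + 1)); rewrite K00 !mul0r ltrDl ltr01 => /(_ isT); rewrite K00 mul0r in lta; lra.
have Kp : 0 < K by rewrite lt_neqAle eq_sym K00.
have q0 : 0 <= a / K.
  by rewrite divr_ge0// (le_trans _ (ltW lta))// mulr_ge0// powR_ge0.
have ts : t < (a / K) `^ b^-1.
  rewrite ltNge; apply/negP => h.
  have : ((a / K) `^ b^-1) `^ b <= t `^ b by apply: powR_le_mono => //; rewrite powR_ge0.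
  rewrite -powRrM mulVf// powRr1// ler_pdivrMr// mulrC; lra.
set c := (t + (a / K) `^ b^-1) / 2.
have tc : t < c by rewrite /c; lra.
have cs : c < (a / K) `^ b^-1 by rewrite /c; lra.
have : c `^ b < ((a / K) `^ b^-1) `^ b.
  by apply: gt0_ltr_powR => //; rewrite nnegrE ?powR_ge0//; apply: le_trans t0 (ltW tc).
rewrite -powRrM mulVf// powRr1// ltr_pdivlMr// mulrC.
by move: (H c tc); lra.
Qed.

(** Merges the constants found separately for each order of differentiation. *)
Lemma nat_bound (P : nat -> R -> Prop) (n : nat) :
  (forall i K K', P i K -> K <= K' -> P i K') ->
  (forall i, (i <= n)%N -> exists K, P i K) ->
  exists K, forall i, (i <= n)%N -> P i K.
Proof.
move=> mono; elim: n => [|n IH] ex.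
  by have [K HK] := ex 0%N (leqnn _); exists K => i; rewrite leqn0 => /eqP ->.
have [|K HK] := IH; first by move=> i ?; apply: ex; rewrite leqW.
have [K' HK'] := ex n.+1 (leqnn _).
exists (Num.max K K') => i; rewrite leq_eqVlt => /orP[/eqP ->|].
  by apply: mono HK' _; rewrite le_max lexx orbT.
by rewrite ltnS => /HK h; apply: mono h _; rewrite le_max lexx.
Qed.

End RealFacts.

Section Hol.
Variables (R : realType) (V : lmodType R) (S : set V) (N : V -> R).
Variables (n : nat) (al : R).

Definition PN (s : seq V) : R := \prod_(v <- s) N v.

Definition inS (s : seq V) := forall v, v \in s -> S v.

(** The strict inequality leaves room for the inserted vector: lists of length up to [n] are
    covered. *)
Definition mlin (A : seq V -> R) := forall s1 s2 a v w,
  inS s1 -> inS s2 -> S v -> S w -> (size s1 + size s2 < n)%N ->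
  A (s1 ++ (a *: v + w) :: s2) = a * A (s1 ++ v :: s2) + A (s1 ++ w :: s2).

(* [D x s] is the value of the [size s]-th derivative at [x] on the vectors [s]; the head of [s] is the last direction of differentiation. *)
Record Hol (U : set V) (K : R) (D : V -> seq V -> R) : Prop := MkHol {
  Hol_ge0 : 0 <= K;
  Hol_lin : forall x, U x -> mlin (D x);
  Hol_bound : forall x s, U x -> inS s -> (size s <= n)%N -> `|D x s| <= K * PN s;
  Hol_rem : forall x y s, U x -> U y -> inS s -> (size s < n)%N ->
    `|D y s - D x s - D x (y - x :: s)| <= K * (N (y - x) * N (y - x) `^ al) * PN s;
  Hol_hol : forall x y s, U x -> U y -> inS s -> size s = n ->
    `|D y s - D x s| <= K * N (y - x) `^ al * PN s }.

Hypothesis N0 : forall x, 0 <= N x.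
Hypothesis SB : forall x y, S x -> S y -> S (x - y).
Hypothesis al01 : 0 < al <= 1.

Lemma PN_ge0 s : 0 <= PN s.
Proof. by apply: prodr_ge0 => v _; exact: N0. Qed.

Lemma PN_cons v s : PN (v :: s) = N v * PN s.
Proof. by rewrite /PN big_cons. Qed.

Lemma PN_cat s1 s2 : PN (s1 ++ s2) = PN s1 * PN s2.
Proof. by rewrite /PN big_cat. Qed.

Lemma inS_cons v s : inS (v :: s) <-> S v /\ inS s.
Proof.
split=> [H|[Sv Ss] w]; last by rewrite inE => /orP[/eqP ->//|/Ss].
by split=> [|w ws]; apply: H; rewrite inE ?eqxx// ws orbT.
Qed.

Lemma inS_cat s1 s2 : inS (s1 ++ s2) <-> inS s1 /\ inS s2.
Proof.
split=> [H|[Sv Ss] w]; last by rewrite mem_cat => /orP[/Sv|/Ss].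
by split=> w ws; apply: H; rewrite mem_cat ws ?orbT.
Qed.

Lemma inS_nil : inS [::].
Proof. by []. Qed.

Lemma Hol_le U U' K K' D : U' `<=` U -> K <= K' -> Hol U K D -> Hol U' K' D.
Proof.
move=> UU KK [K0 l b re h]; split.
- exact: le_trans KK.
- by move=> x /UU; exact: l.
- move=> x s /UU Ux Ss ns; apply: le_trans (b _ _ Ux Ss ns) _.
  by rewrite ler_wpM2r// PN_ge0.
- move=> x y s /UU Ux /UU Uy Ss ns; apply: le_trans (re _ _ _ Ux Uy Ss ns) _.
  by rewrite ler_wpM2r ?PN_ge0// ler_wpM2r// mulr_ge0// powR_ge0.
- move=> x y s /UU Ux /UU Uy Ss ns; apply: le_trans (h _ _ _ Ux Uy Ss ns) _.
  by rewrite ler_wpM2r ?PN_ge0// ler_wpM2r// powR_ge0.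
Qed.

(** For pairs at distance at least [eta] the crude bounds on [D] suffice, because there the distance
    is bounded below. *)
Lemma Hol_local U K eta D : U `<=` S -> 0 <= K -> 0 < eta ->
  (forall x, U x -> mlin (D x)) ->
  (forall x s, U x -> inS s -> (size s <= n)%N -> `|D x s| <= K * PN s) ->
  (forall x y s, U x -> U y -> N (y - x) < eta -> inS s -> (size s < n)%N ->
    `|D y s - D x s - D x (y - x :: s)| <= K * (N (y - x) * N (y - x) `^ al) * PN s) ->
  (forall x y s, U x -> U y -> N (y - x) < eta -> inS s -> size s = n ->
    `|D y s - D x s| <= K * N (y - x) `^ al * PN s) ->
  exists K', Hol U K' D.
Proof.
move=> US K0 eta0 Hl Hb Hr Hh.
have [al0 al1] := andP al01.
pose c := eta `^ al; have c0 : 0 < c by apply: powR_gt0.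
(* For [t >= eta] one has [1 <= t * t ^ al / (eta * c)], [t <= t * t ^ al / c] and
   [1 <= t ^ al / c]; the three summands absorb the crude bounds [K * (2 + t)] and [2 * K]. *)
pose K' := K + K * (2 / (eta * c) + c^-1 + 2 / c).
have i1 : 0 < (eta * c)^-1 by rewrite invr_gt0 mulr_gt0.
have i2 : 0 < c^-1 by rewrite invr_gt0.
have KK' : K <= K'.
  by rewrite /K' lerDl mulr_ge0// !addr_ge0// ?mulr_ge0//; apply: ltW.
exists K'; split => //.
- exact: le_trans KK'.
- move=> x s Ux Ss ns; apply: le_trans (Hb _ _ Ux Ss ns) _.
  by rewrite ler_wpM2r// PN_ge0.
- move=> x y s Ux Uy Ss ns.
  set t := N (y - x); set T := t `^ al.
  have t0 : 0 <= t by exact: N0.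
  have T0 : 0 <= T by exact: powR_ge0.
  have P0 := PN_ge0 s.
  have [te|te] := ltP t eta.
    apply: le_trans (Hr _ _ _ Ux Uy te Ss ns) _.
    by rewrite -/t -/T ler_wpM2r// ler_wpM2r// mulr_ge0.
  have cT : c <= T by apply: powR_le_mono => //; apply: ltW.
  have b1 := Hb _ _ Uy Ss (ltnW ns).
  have b2 := Hb _ _ Ux Ss (ltnW ns).
  have b3 : `|D x (y - x :: s)| <= K * (t * PN s).
    rewrite -PN_cons; apply: Hb => //; apply/inS_cons; split=> //.
    by apply: SB; apply: US.
  apply: (@le_trans _ _ (K * (2 + t) * PN s)).
    apply: le_trans (ler_normB _ _) _; move: (ler_normB (D y s) (D x s)).
    move: b1 b2 b3; lra.
  rewrite ler_wpM2r// /K'.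
  have e1 : 1 <= (eta * c)^-1 * (t * T).
    by rewrite mulrC ler_pdivlMr ?mulr_gt0// mul1r ler_pM// ltW.
  have e2 : t <= c^-1 * (t * T).
    by rewrite mulrC ler_pdivlMr// ler_wpM2l.
  apply: (@le_trans _ _ (K * (2 * ((eta * c)^-1 * (t * T)) + c^-1 * (t * T)))).
    by rewrite ler_wpM2l//; lra.
  rewrite -subr_ge0.
  rewrite (_ : _ - _ = K * (t * T) * (1 + 2 * c^-1)); last by ring.
  by rewrite !mulr_ge0// addr_ge0// mulr_ge0// ltW.
- move=> x y s Ux Uy Ss ns.
  set t := N (y - x); set T := t `^ al.
  have t0 : 0 <= t by exact: N0.
  have T0 : 0 <= T by exact: powR_ge0.
  have P0 := PN_ge0 s.
  have [te|te] := ltP t eta.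
    apply: le_trans (Hh _ _ _ Ux Uy te Ss ns) _.
    by rewrite -/t -/T ler_wpM2r// ler_wpM2r.
  have cT : c <= T by apply: powR_le_mono => //; apply: ltW.
  have b1 := Hb _ _ Uy Ss (eq_leq ns).
  have b2 := Hb _ _ Ux Ss (eq_leq ns).
  apply: (@le_trans _ _ (K * 2 * PN s)).
    by apply: le_trans (ler_normB _ _) _; move: b1 b2; lra.
  rewrite ler_wpM2r// /K'.
  have e1 : 1 <= c^-1 * T by rewrite mulrC ler_pdivlMr// mul1r.
  apply: (@le_trans _ _ (K * 2 * (c^-1 * T))).
    by rewrite -[X in X <= _]mulr1 ler_wpM2l// mulr_ge0.
  rewrite -subr_ge0.
  rewrite (_ : _ - _ = K * T * (1 + 2 * (eta * c)^-1 + c^-1)); last by ring.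
  rewrite !mulr_ge0// !addr_ge0// ?mulr_ge0// ltW//.
Qed.

(** Below the top order the remainder estimate contains a Lipschitz estimate, since the first-order
    term is itself bounded by [K * N (y - x) * PN N s]. *)
Lemma Hol_cont U K D x y s : U `<=` S -> Hol U K D -> U x -> U y -> inS s ->
  (size s < n)%N -> N (y - x) <= 1 ->
  `|D y s - D x s| <= 2 * K * N (y - x) * PN s.
Proof.
move=> US [K0 _ b re _] Ux Uy Ss ns t1.
have [al0 al1] := andP al01.
have b3 : `|D x (y - x :: s)| <= K * (N (y - x) * PN s).
  rewrite -PN_cons; apply: b => //; apply/inS_cons; split=> //.
  by apply: SB; apply: US.
have r := re _ _ _ Ux Uy Ss ns.
have T1 : N (y - x) `^ al <= 1.
  have <- : (1 : R) `^ al = 1 by rewrite powR1.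
  by apply: powR_le_mono => //; apply: ltW.
have : K * (N (y - x) * N (y - x) `^ al) * PN s <= K * (N (y - x) * 1) * PN s.
  by rewrite ler_wpM2r ?PN_ge0// ler_wpM2l// ler_wpM2l.
have := ler_normD (D y s - D x s - D x (y - x :: s)) (D x (y - x :: s)).
by rewrite subrK; lra.
Qed.

Lemma Hol_comb U K1 K2 D1 D2 a b : Hol U K1 D1 -> Hol U K2 D2 ->
  Hol U (`|a| * K1 + `|b| * K2) (fun x s => a * D1 x s + b * D2 x s).
Proof.
move=> [K10 l1 b1 r1 h1] [K20 l2 b2 r2 h2]; split.
- by rewrite addr_ge0// mulr_ge0.
- move=> x Ux s1 s2 c v w S1 S2 Sv Sw ns.
  by rewrite l1// l2//; ring.
- move=> x s Ux Ss ns; apply: le_trans (ler_normD _ _) _; rewrite !normrM !mulrDl.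
  by rewrite -!mulrA lerD// ler_wpM2l//; [exact: b1|exact: b2].
- move=> x y s Ux Uy Ss ns; set t := N (y - x).
  rewrite (_ : _ - _ = a * (D1 y s - D1 x s - D1 x (y - x :: s)) +
      b * (D2 y s - D2 x s - D2 x (y - x :: s))); last by ring.
  apply: le_trans (ler_normD _ _) _; rewrite !normrM !mulrDl.
  by rewrite -!(mulrA `|_|) lerD// ler_wpM2l//; [exact: r1|exact: r2].
- move=> x y s Ux Uy Ss ns; set t := N (y - x).
  rewrite (_ : _ - _ = a * (D1 y s - D1 x s) + b * (D2 y s - D2 x s)); last by ring.
  apply: le_trans (ler_normD _ _) _; rewrite !normrM !mulrDl.
  by rewrite -!(mulrA `|_|) lerD// ler_wpM2l//; [exact: h1|exact: h2].
Qed.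

Lemma Hol_const U c : Hol U `|c| (fun _ s => if s is [::] then c else 0).
Proof.
split => //.
- by move=> x _ [|? s1] s2 a v w *; rewrite /= mulr0 addr0.
- move=> x [|v s] _ _ _; first by rewrite /PN big_nil mulr1.
  by rewrite normr0 mulr_ge0// PN_ge0.
- move=> x y s *; rewrite (_ : (if s is [::] then c else 0) - _ - 0 = 0).
    by rewrite normr0 !mulr_ge0 ?PN_ge0 ?powR_ge0.
  by rewrite subrr subr0.
- by move=> x y s *; rewrite subrr normr0 !mulr_ge0 ?PN_ge0 ?powR_ge0.
Qed.

Lemma Hol_translate U K D c : Hol U K D ->
  Hol [set x | U (x + c)] K (fun x s => D (x + c) s).
Proof.
move=> [K0 l b r h]; split=> //.
- by move=> x Ux; exact: l.
- by move=> x s Ux; exact: b.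
- move=> x y s Ux Uy Ss ns.
  by have := r _ _ _ Ux Uy Ss ns; rewrite opprD addrACA subrr addr0.
- move=> x y s Ux Uy Ss ns.
  by have := h _ _ _ Ux Uy Ss ns; rewrite opprD addrACA subrr addr0.
Qed.

(** Extension by zero. The third premise, which also fits a quasi-norm, puts a close pair either
    within radius [R2], where [D] is smooth, or outside radius [R1], where the extension is 0. *)
Lemma Hol_glue K D (R1 R2 eta : R) : 0 < eta -> R1 <= R2 ->
  (forall x y, S x -> S y -> N (y - x) < eta -> R2 <= N y -> R1 <= N x) ->
  (forall x, N (- x) = N x) ->
  Hol [set x | S x /\ N x < R2] K D ->
  (forall x s, S x -> R1 <= N x < R2 -> D x s = 0) ->
  exists K', Hol S K' (fun x s => if N x < R1 then D x s else 0).
Proof.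
move=> eta0 R12 far NN H van; have [K0 l b r h] := H.
pose D' x s := if N x < R1 then D x s else 0.
have E x s : S x -> N x < R2 -> D' x s = D x s.
  by move=> Sx xR; rewrite /D'; case: ltP => // xR1; rewrite van// xR1.
have Z x s : R1 <= N x -> D' x s = 0 by rewrite /D' ltNge => ->.
have cases x y : S x -> S y -> N (y - x) < eta ->
    (N x < R2 /\ N y < R2) \/ (R1 <= N x /\ R1 <= N y).
  move=> Sx Sy xy; have [x2|x2] := ltP (N x) R2; have [y2|y2] := ltP (N y) R2; auto.
  - by right; split; [apply: far xy y2|apply: le_trans y2].
  - right; split; first exact: le_trans x2.
    by apply: (far y x) => //; rewrite -opprB NN.
  - by right; split; apply: le_trans R12 _.
apply: (@Hol_local _ K eta D') => //.
- move=> x Sx; have [x2|x2] := ltP (N x) R2; last first.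
    have zz := le_trans R12 x2.
    by move=> s1 s2 a v w *; rewrite !Z// mulr0 addr0.
  by move=> s1 s2 a v w *; rewrite !E//; apply: l.
- move=> x s Sx Ss ns; have [x2|x2] := ltP (N x) R2; first by rewrite E//; apply: b.
  by rewrite Z ?(le_trans R12)// normr0 mulr_ge0// PN_ge0.
- move=> x y s Sx Sy xy Ss ns; have [[? ?]|[? ?]] := cases _ _ Sx Sy xy.
    by rewrite !E//; apply: r.
  by rewrite !Z// !subr0 normr0 !mulr_ge0 ?PN_ge0 ?powR_ge0.
- move=> x y s Sx Sy xy Ss ns; have [[? ?]|[? ?]] := cases _ _ Sx Sy xy.
    by rewrite !E//; apply: h.
  by rewrite !Z// !subr0 normr0 !mulr_ge0 ?PN_ge0 ?powR_ge0.
Qed.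

End Hol.

(** * Composition with a function of one real variable *)

Section Jets.
Variable R : realType.
Implicit Types K t T w f g : R.

(** Value, derivative and Taylor remainder between two points: [t] stands for their distance, [T]
    for [t * t ^ al], [w] for the product of the norms of the directions. *)
Definition jet (K t T fx fy f' w : R) :=
  [/\ `|fx| <= K * w, `|f'| <= K * t * w & `|fy - fx - f'| <= K * T * w].

(** The counterpart for Hoelder continuity; here [T] stands for [t ^ al]. *)
Definition hjet (K T fx fy w : R) :=
  [/\ `|fx| <= K * w, `|fy| <= K * w & `|fy - fx| <= K * T * w].

Lemma norm_mul_le (a b A B : R) : `|a| <= A -> `|b| <= B -> `|a * b| <= A * B.
Proof. by move=> ? ?; rewrite normrM ler_pM. Qed.

(** The product rule. The remainder of a product consists of two terms with one remainder each and
    the product of the increments; the latter are at most [2 * K * t * w], and [t * t <= T] absorbs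
    their product: [6 = 1 + 1 + 4]. *)
Lemma jet_mul K1 K2 t T fx fy f' w1 gx gy g' w2 :
  0 <= K1 -> 0 <= K2 -> 0 <= w1 -> 0 <= w2 -> 0 <= t -> t * t <= T -> T <= t ->
  jet K1 t T fx fy f' w1 -> jet K2 t T gx gy g' w2 ->
  jet (6 * K1 * K2) t T (fx * gx) (fy * gy) (f' * gx + fx * g') (w1 * w2).
Proof.
move=> K10 K20 w10 w20 t0 ttT Tt [a1 b1 c1] [a2 b2 c2].
have W0 : 0 <= K1 * K2 * (w1 * w2) by rewrite !mulr_ge0.
have d1 : `|fy - fx| <= 2 * K1 * t * w1.
  have := ler_normD (fy - fx - f') f'; rewrite subrK.
  have : K1 * T * w1 <= K1 * t * w1 by rewrite ler_wpM2r// ler_wpM2l.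
  lra.
have d2 : `|gy - gx| <= 2 * K2 * t * w2.
  have := ler_normD (gy - gx - g') g'; rewrite subrK.
  have : K2 * T * w2 <= K2 * t * w2 by rewrite ler_wpM2r// ler_wpM2l.
  lra.
split.
- have := norm_mul_le a1 a2; lra.
- have := norm_mul_le b1 a2; have := norm_mul_le a1 b2.
  have := ler_normD (f' * gx) (fx * g').
  have : 0 <= K1 * K2 * (w1 * w2) * t by rewrite mulr_ge0.
  lra.
- rewrite (_ : _ - _ = (fy - fx - f') * gx + fx * (gy - gx - g') +
      (fy - fx) * (gy - gx)); last by ring.
  have := norm_mul_le c1 a2; have := norm_mul_le a1 c2; have := norm_mul_le d1 d2.
  have := ler_normD ((fy - fx - f') * gx) (fx * (gy - gx - g')).
  have := ler_normD ((fy - fx - f') * gx + fx * (gy - gx - g')) ((fy - fx) * (gy - gx)).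
  have : K1 * K2 * (w1 * w2) * (t * t) <= K1 * K2 * (w1 * w2) * T by rewrite ler_wpM2l.
  lra.
Qed.

Lemma hjet_mul K1 K2 T fx fy w1 gx gy w2 :
  0 <= K1 -> 0 <= K2 -> 0 <= w1 -> 0 <= w2 ->
  hjet K1 T fx fy w1 -> hjet K2 T gx gy w2 ->
  hjet (2 * K1 * K2) T (fx * gx) (fy * gy) (w1 * w2).
Proof.
move=> K10 K20 w10 w20 [a1 b1 c1] [a2 b2 c2].
have W0 : 0 <= K1 * K2 * (w1 * w2) by rewrite !mulr_ge0.
split.
- have := norm_mul_le a1 a2; lra.
- have := norm_mul_le b1 b2; lra.
- rewrite (_ : _ - _ = (fy - fx) * gy + fx * (gy - gx)); last by ring.
  have := norm_mul_le c1 b2; have := norm_mul_le a1 c2.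
  have := ler_normD ((fy - fx) * gy) (fx * (gy - gx)).
  lra.
Qed.

Lemma sum_seq_bound (I : eqType) (Z : Type) (P : Z -> Prop) (L : seq I)
    (F : I -> Z -> R) (w : Z -> R) :
  (forall z, P z -> 0 <= w z) ->
  (forall u, u \in L -> exists K : R, 0 <= K /\ forall z, P z -> `|F u z| <= K * w z) ->
  exists K : R, 0 <= K /\ forall z, P z -> `|\sum_(u <- L) F u z| <= K * w z.
Proof.
move=> w0; elim: L => [|u L IH] H.
  by exists 0; split=> // z _; rewrite big_nil normr0 mul0r.
have [|K [K0 HK]] := IH; first by move=> v vL; apply: H; rewrite inE vL orbT.
have [|K' [K'0 HK']] := H u; first by rewrite inE eqxx.
exists (K' + K); split=> [|z Pz]; first by rewrite addr_ge0.
rewrite big_cons mulrDl; apply: le_trans (ler_normD _ _) _.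
by rewrite lerD ?HK ?HK'.
Qed.

End Jets.

(* The derivatives of [tau \o g] are sums of terms [tau^(a) (g x) * \prod_b D^|b| g x (h_i)_(i in b)] over blocks [b] of indices; differentiating once more in the direction [h_i] turns a term into those listed by [dterm i]. *)
Section Terms.

Fixpoint dblocks (i : nat) (bs : seq (seq nat)) : seq (seq (seq nat)) :=
  if bs is b :: bs' then
    ((i :: b) :: bs') :: [seq b :: c | c <- dblocks i bs']
  else [::].

Definition dterm (i : nat) (t : nat * seq (seq nat)) : seq (nat * seq (seq nat)) :=
  (t.1.+1, [:: i] :: t.2) :: [seq (t.1, c) | c <- dblocks i t.2].

Fixpoint terms (k : nat) : seq (nat * seq (seq nat)) :=
  if k is k'.+1 then flatten [seq dterm k' t | t <- terms k'] else [:: (0%N, [::])].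

Lemma dblocks_perm i bs c : c \in dblocks i bs -> perm_eq (flatten c) (i :: flatten bs).
Proof.
elim: bs c => [//|b bs IH] c /=; rewrite inE => /orP[/eqP ->//|].
move=> /mapP[c' /IH cc ->] /=.
rewrite -[i :: b ++ flatten bs]cat1s perm_sym perm_catCA perm_cat2l perm_sym.
by rewrite cat1s.
Qed.

(** Each index lies in exactly one block; hence the weights of a term multiply to the product of the
    norms of all directions, and a term is linear in each direction. *)
Lemma terms_perm k t : t \in terms k -> perm_eq (flatten t.2) (iota 0 k).
Proof.
elim: k t => [|k IH] t /=; first by rewrite inE => /eqP ->.
move=> /flatten_mapP[u /IH uk]; rewrite -[0%N :: iota 1 k]/(iota 0 k.+1).
rewrite -[k.+1]addn1 iotaD /= add0n.
rewrite inE => /orP[/eqP ->|/mapP[c /dblocks_perm cu ->]] /=.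
  by rewrite perm_sym perm_catC /= perm_cons perm_sym.
by apply: perm_trans cu _; rewrite perm_sym perm_catC /= perm_cons perm_sym.
Qed.

Lemma terms_order k t : t \in terms k -> (t.1 <= k)%N.
Proof.
elim: k t => [|k IH] t /=; first by rewrite inE => /eqP ->.
move=> /flatten_mapP[u /IH uk].
by rewrite inE => /orP[/eqP ->//|/mapP[c _ ->]] /=; rewrite leqW.
Qed.

Lemma terms_block k t b : t \in terms k -> b \in t.2 -> (size b <= k)%N.
Proof.
move=> /terms_perm /perm_size; rewrite size_iota => <-.
elim: t.2 => //= c bs IH; rewrite inE size_cat => /orP[/eqP ->|/IH h].
  exact: leq_addr.
by rewrite (leq_trans h)// leq_addl.
Qed.

End Terms.

Section Composition.
Variables (R : realType) (V : lmodType R) (S : set V) (N : V -> R).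
Variables (n : nat) (al : R).
Hypothesis N0 : forall x, 0 <= N x.
Hypothesis N00 : N 0 = 0.
Hypothesis S0 : S 0.
Hypothesis SB : forall x y, S x -> S y -> S (x - y).
Hypothesis al01 : 0 < al <= 1.
Hypothesis n0 : (0 < n)%N.
Variable tau : nat -> R -> R.
Hypothesis Htau : forall B : R, exists K : R, [/\ 0 <= K,
  (forall a x, (a <= n.+1)%N -> `|x| <= B -> `|tau a x| <= K) &
  (forall a x y, (a <= n)%N -> `|x| <= B -> `|y| <= B ->
     `|tau a y - tau a x - tau a.+1 x * (y - x)| <= K * (y - x) ^+ 2)].
Variables (U : set V) (K : R) (D : V -> seq V -> R).
Hypothesis US : U `<=` S.
Hypothesis HD : Hol S N n al U K D.

Definition blockval x (h : nat -> V) (bs : seq (seq nat)) : R :=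
  \prod_(b <- bs) D x (map h b).

Definition termval x (h : nat -> V) (t : nat * seq (seq nat)) : R :=
  tau t.1 (D x [::]) * blockval x h t.2.

(** Faa di Bruno's formula. Directions are numbered from the end of the list, so that consing a new
    one gives it the fresh index [size s] and leaves the other indices alone. *)
Definition Dcomp x (s : seq V) : R :=
  \sum_(t <- terms (size s)) termval x (nth 0 (rev s)) t.

Local Notation wt h bs := (\prod_(j <- flatten bs) N (h j)).

Let PNmap (h : nat -> V) (b : seq nat) : PN N (map h b) = \prod_(j <- b) N (h j).
Proof. by rewrite /PN big_map. Qed.

Let inSmap (h : nat -> V) (b : seq nat) : (forall j, S (h j)) -> inS S (map h b).
Proof. by move=> Sh v /mapP[j _ ->]. Qed.

Let wt0 (h : nat -> V) (r : seq nat) : 0 <= \prod_(j <- r) N (h j).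
Proof. by apply: prodr_ge0 => j _; exact: N0. Qed.

Let tT (x y : V) : N (y - x) < 1 -> N (y - x) * N (y - x) <= N (y - x) * N (y - x) `^ al
  /\ N (y - x) * N (y - x) `^ al <= N (y - x).
Proof.
move=> t1; have [a0 a1] := andP al01; have ta : N (y - x) <= N (y - x) `^ al.
  by apply: le_self_powR; rewrite ?N0 ltW.
split; first by rewrite ler_wpM2l.
rewrite -[leRHS]mulr1 ler_wpM2l//.
have <- : (1 : R) `^ al = 1 by rewrite powR1.
by apply: powR_le_mono; rewrite // ltW.
Qed.

(** The index [i] carries the increment [y - x], so consing it to a block differentiates the
    corresponding factor; [size b < n] leaves room for this. *)
Lemma blocks_jet bs : all (fun b => size b < n)%N bs ->
  exists K' : R, 0 <= K' /\ forall x y h i, U x -> U y -> N (y - x) < 1 ->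
    (forall j, S (h j)) -> h i = y - x ->
    jet K' (N (y - x)) (N (y - x) * N (y - x) `^ al) (blockval x h bs) (blockval y h bs)
      (\sum_(c <- dblocks i bs) blockval x h c) (wt h bs).
Proof.
elim: bs => [_|b bs IH /= /andP[bn /IH[K' [K'0 HK']]]].
  exists 1; split=> // x y h i *; rewrite /blockval /= !big_nil; split.
  - by rewrite normr1 mulr1.
  - by rewrite normr0 !mulr_ge0.
  - by rewrite subrr subr0 normr0 !mulr_ge0 ?powR_ge0.
exists (6 * K * K'); have K0 := Hol_ge0 HD; split; first by rewrite !mulr_ge0.
move=> x y h i Ux Uy t1 Sh hi; have [ttT Tt] := tT t1.
have := HK' x y h i Ux Uy t1 Sh hi.
have j1 : jet K (N (y - x)) (N (y - x) * N (y - x) `^ al) (D x (map h b))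
    (D y (map h b)) (D x (map h (i :: b))) (\prod_(j <- b) N (h j)).
  rewrite -PNmap /= hi; split.
  - by apply: (Hol_bound HD) => //; [apply: inSmap|rewrite size_map ltnW].
  - rewrite -mulrA -PN_cons; apply: (Hol_bound HD); rewrite //= ?size_map//.
    by apply/inS_cons; rewrite -hi; split=> //; apply: inSmap.
  - by apply: (Hol_rem HD) => //; rewrite ?size_map//; apply: inSmap.
move/(jet_mul K0 K'0 (wt0 _ _) (wt0 _ _) (N0 _) ttT Tt j1).
have E : \sum_(c <- dblocks i (b :: bs)) blockval x h c =
    D x (map h (i :: b)) * blockval x h bs + D x (map h b) * \sum_(c <- dblocks i bs) blockval x h c.
  rewrite /= big_cons big_map {1}/blockval big_cons mulr_sumr; congr (_ + _).
  by apply: eq_bigr => c _; rewrite /blockval big_cons.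
have Eb z : blockval z h (b :: bs) = D z (map h b) * blockval z h bs by rewrite /blockval big_cons.
by rewrite E !Eb -big_cat.
Qed.

Lemma blocks_hjet bs : all (fun b => size b <= n)%N bs ->
  exists K' : R, 0 <= K' /\ forall x y h, U x -> U y -> N (y - x) < 1 ->
    (forall j, S (h j)) ->
    hjet K' (N (y - x) `^ al) (blockval x h bs) (blockval y h bs) (wt h bs).
Proof.
elim: bs => [_|b bs IH /= /andP[bn /IH[K' [K'0 HK']]]].
  exists 1; split=> // x y h *; rewrite /blockval /= !big_nil; split.
  - by rewrite normr1 mulr1.
  - by rewrite normr1 mulr1.
  - by rewrite subrr normr0 !mulr_ge0 ?powR_ge0.
have K0 := Hol_ge0 HD.
exists (2 * (2 * K) * K'); split; first by rewrite !mulr_ge0.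
move=> x y h Ux Uy t1 Sh; have [a0 a1] := andP al01.
have := HK' x y h Ux Uy t1 Sh.
have j1 : hjet (2 * K) (N (y - x) `^ al) (D x (map h b))
    (D y (map h b)) (\prod_(j <- b) N (h j)).
  have P0 := wt0 h b.
  have Sb : inS S (map h b) := inSmap Sh.
  have sb : (size (map h b) <= n)%N by rewrite size_map.
  have b1 := Hol_bound HD Ux Sb sb; have b2 := Hol_bound HD Uy Sb sb.
  rewrite PNmap in b1 b2.
  have KP : 0 <= K * \prod_(j <- b) N (h j) by rewrite mulr_ge0.
  split; [lra|lra|].
  (* Only a block of full size [n] uses the Hoelder estimate; smaller ones are Lipschitz, and
     [t <= t ^ al] for [t <= 1]. *)
  move: sb; rewrite leq_eqVlt => /orP[/eqP sb|sb].
    have := Hol_hol HD Ux Uy Sb sb; rewrite PNmap => h1.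
    have : 0 <= K * N (y - x) `^ al * \prod_(j <- b) N (h j).
      by rewrite !mulr_ge0// powR_ge0.
    lra.
  have := Hol_cont N0 SB al01 US HD Ux Uy Sb sb (ltW t1); rewrite PNmap => h1.
  apply: le_trans h1 _; rewrite ler_wpM2r// ler_wpM2l ?mulr_ge0//.
  by apply: le_self_powR; rewrite ?N0 ?(ltW t1) ?(ltW a0) ?a1.
move/(hjet_mul _ K'0 (wt0 _ _) (wt0 _ _) j1).
rewrite -big_cat /= /blockval !big_cons; apply; exact: mulr_ge0.
Qed.

Lemma tau_jet a : (a <= n)%N -> exists K' : R, 0 <= K' /\ forall x y, U x -> U y ->
  N (y - x) < 1 ->
  jet K' (N (y - x)) (N (y - x) * N (y - x) `^ al) (tau a (D x [::])) (tau a (D y [::]))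
    (tau a.+1 (D x [::]) * D x [:: y - x]) 1.
Proof.
move=> an; have K0 := Hol_ge0 HD; have [K1 [K10 tb tr]] := Htau K.
have B x : U x -> `|D x [::]| <= K.
  by move=> Ux; have := Hol_bound HD Ux (@inS_nil _ _ S) (leq0n _); rewrite /PN big_nil mulr1.
exists (K1 * (1 + 4 * K * K + K)); split.
  by rewrite mulr_ge0// !addr_ge0// !mulr_ge0.
move=> x y Ux Uy t1; have [ttT Tt] := tT t1.
set t := N (y - x) in t1 ttT Tt *; set T := t * t `^ al in ttT Tt *.
have t0 : 0 <= t := N0 _.
have T0 : 0 <= T by rewrite mulr_ge0// powR_ge0.
have Sxy : inS S [:: y - x].
  by apply/inS_cons; split; [apply: SB; apply: US|exact: inS_nil].
have b1 : `|D x [:: y - x]| <= K * t.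
  by have := Hol_bound HD Ux Sxy n0; rewrite PN_cons /PN big_nil mulr1.
have a1 : `|tau a.+1 (D x [::])| <= K1 by apply: tb; rewrite ?B.
have KK : 0 <= K * K by rewrite mulr_ge0.
split.
- rewrite mulr1; apply: le_trans (tb _ _ _ (B _ Ux)) _; first exact: leqW.
  by rewrite -[leLHS]mulr1 ler_wpM2l//; move: KK; lra.
- apply: le_trans (norm_mul_le a1 b1) _.
  rewrite mulr1 mulrA ler_wpM2r// ler_wpM2l//; move: KK; lra.
- have d : `|D y [::] - D x [::]| <= 2 * K * t.
    have := Hol_cont N0 SB al01 US HD Ux Uy (@inS_nil _ _ S) n0 (ltW t1).
    by rewrite /PN big_nil mulr1.
  have r : `|D y [::] - D x [::] - D x [:: y - x]| <= K * T.
    have h := Hol_rem HD Ux Uy (@inS_nil _ _ S) n0; rewrite /PN big_nil mulr1 in h.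
    exact: h.
  (* The remainder of [tau] is quadratic in an increment of size at most [2 * K * t], hence absorbed
     by [t * t <= T]; what is left is the remainder of [D] times the derivative of [tau]. *)
  rewrite (_ : _ - _ = (tau a (D y [::]) - tau a (D x [::]) -
      tau a.+1 (D x [::]) * (D y [::] - D x [::])) +
      tau a.+1 (D x [::]) * (D y [::] - D x [::] - D x [:: y - x])); last by ring.
  apply: le_trans (ler_normD _ _) _; rewrite mulr1.
  have := norm_mul_le a1 r.
  have := tr a _ _ an (B _ Ux) (B _ Uy).
  have : K1 * (D y [::] - D x [::]) ^+ 2 <= K1 * (4 * K * K * T).
    rewrite ler_wpM2l// -real_normK ?num_real//.
    apply: (@le_trans _ _ ((2 * K * t) ^+ 2)); first by rewrite lerXn2r// nnegrE ?mulr_ge0.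
    by move: (ler_wpM2l KK ttT); lra.
  have : 0 <= K1 * T by rewrite mulr_ge0.
  lra.
Qed.

Lemma term_jet t : all (fun b => size b < n)%N t.2 -> (t.1 <= n)%N ->
  exists K' : R, 0 <= K' /\ forall x y h i, U x -> U y -> N (y - x) < 1 ->
    (forall j, S (h j)) -> h i = y - x ->
    jet K' (N (y - x)) (N (y - x) * N (y - x) `^ al) (termval x h t) (termval y h t)
      (\sum_(c <- dterm i t) termval x h c) (wt h t.2).
Proof.
move=> /blocks_jet[K1 [K10 H1]] /tau_jet[K2 [K20 H2]].
exists (6 * K2 * K1); split; first by rewrite !mulr_ge0.
move=> x y h i Ux Uy t1 Sh hi; have [ttT Tt] := tT t1.
have := jet_mul K20 K10 ler01 (wt0 _ _) (N0 _) ttT Tt (H2 _ _ Ux Uy t1) (H1 _ _ _ _ Ux Uy t1 Sh hi).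
rewrite mul1r /dterm big_cons big_map /termval /= [blockval x h ([:: i] :: _)]/blockval big_cons /= hi.
by rewrite -/(blockval _ _ _) mulr_sumr mulrA.
Qed.

Lemma term_hjet t : all (fun b => size b <= n)%N t.2 -> (t.1 <= n)%N ->
  exists K' : R, 0 <= K' /\ forall x y h, U x -> U y -> N (y - x) < 1 ->
    (forall j, S (h j)) ->
    hjet K' (N (y - x) `^ al) (termval x h t) (termval y h t) (wt h t.2).
Proof.
move=> /blocks_hjet[K1 [K10 H1]] /tau_jet[K2 [K20 H2]].
have [a0 a1] := andP al01.
exists (2 * (3 * K2) * K1); split; first by rewrite !mulr_ge0.
move=> x y h Ux Uy t1 Sh; have [ttT Tt] := tT t1.
have T1 : N (y - x) <= N (y - x) `^ al by apply: le_self_powR; rewrite ?N0 ?(ltW t1) ?(ltW a0) ?a1.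
have T0 := powR_ge0 (N (y - x)) al.
have t0 := N0 (y - x).
have TT1 : N (y - x) * N (y - x) `^ al <= 1 by apply: le_trans Tt (ltW t1).
have j1 : hjet (3 * K2) (N (y - x) `^ al) (tau t.1 (D x [::])) (tau t.1 (D y [::])) 1.
  have [e1 e2 e3] := H2 _ _ Ux Uy t1; rewrite !mulr1 in e1 e2 e3.
  have d1 := ler_normD (tau t.1 (D y [::]) - tau t.1 (D x [::]) -
    tau t.1.+1 (D x [::]) * D x [:: y - x]) (tau t.1.+1 (D x [::]) * D x [:: y - x]).
  rewrite subrK in d1.
  have d2 := ler_normD (tau t.1 (D y [::]) - tau t.1 (D x [::])) (tau t.1 (D x [::])).
  rewrite subrK in d2.
  have f1 := ler_wpM2l K20 TT1; have f2 := ler_wpM2l K20 (ltW t1).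
  have f3 := ler_wpM2l K20 Tt; have f4 := ler_wpM2l K20 T1.
  split; rewrite mulr1; [lra|lra|].
  have := mulr_ge0 K20 T0; lra.
have := hjet_mul _ K10 ler01 (wt0 _ _) j1 (H1 _ _ _ Ux Uy t1 Sh).
by rewrite mul1r; apply; rewrite mulr_ge0.
Qed.

Let map_off (h h' : nat -> V) (j : nat) b : (forall i, i != j -> h i = h' i) ->
  j \notin b -> map h b = map h' b.
Proof.
move=> E jb; apply/eq_in_map => i ib; apply: E.
by apply: contraNneq jb => <-.
Qed.

Let blockval_off x (h h' : nat -> V) (j : nat) bs : (forall i, i != j -> h i = h' i) ->
  j \notin flatten bs -> blockval x h bs = blockval x h' bs.
Proof.
move=> E; elim: bs => [|b bs IH] /=; first by rewrite /blockval !big_nil.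
rewrite mem_cat negb_or => /andP[jb jbs].
by rewrite /blockval !big_cons (map_off E jb); congr (_ * _); exact: IH.
Qed.

(** Since [j] occurs exactly once, a single factor of the product depends on [h j], and that factor
    is multilinear. *)
Lemma blockval_lin x bs j h hv hw a : U x -> all (fun b => size b <= n)%N bs ->
  count_mem j (flatten bs) = 1%N -> (forall i, S (hv i)) -> (forall i, S (hw i)) ->
  (forall i, i != j -> h i = hv i) -> (forall i, i != j -> h i = hw i) ->
  h j = a *: hv j + hw j ->
  blockval x h bs = a * blockval x hv bs + blockval x hw bs.
Proof.
move=> Ux bn cj Shv Shw Ev Ew hj; elim: bs bn cj => [//|b bs IH] /= /andP[bn bsn].
rewrite count_cat => cj.
have [jb|jb] := boolP (j \in b); last first.
  rewrite (count_memPn jb) add0n in cj.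
  rewrite /blockval !big_cons -!/(blockval _ _ _) (IH bsn cj) (map_off Ev jb).
  by rewrite -(map_off Ew jb) (map_off Ev jb); ring.
have cb : (0 < count_mem j b)%N by rewrite -has_count has_pred1.
move: cj cb; set A := count_mem j b; set B := count_mem j (flatten bs) => cj cb.
have c1 : A = 1%N by lia.
have jbs : j \notin flatten bs by apply/count_memPn; rewrite -/B; lia.
rewrite /A in c1.
case/splitPr: jb bn c1 {A B cj cb} => b1 b2; rewrite size_cat /= count_cat /= eqxx => bn c1.
have jb1 : j \notin b1.
  apply/count_memPn; move: c1; set A1 := count _ b1; set A2 := count _ b2 => c1.
  by change (A1 = 0%N); lia.
have jb2 : j \notin b2.
  apply/count_memPn; move: c1; set A1 := count _ b1; set A2 := count _ b2 => c1.
  by change (A2 = 0%N); lia.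
rewrite /blockval !big_cons -!/(blockval _ _ _) !map_cat /= hj.
rewrite (blockval_off _ Ev jbs) -(blockval_off _ Ew jbs) (blockval_off _ Ev jbs).
rewrite -(map_off Ew jb1) -(map_off Ew jb2) (map_off Ev jb1) (map_off Ev jb2).
rewrite (Hol_lin HD)//; first by ring.
- exact: inSmap.
- exact: inSmap.
- by rewrite !size_map; lia.
Qed.

Let nthrev_S s : inS S s -> forall j, S (nth 0 (rev s) j).
Proof.
move=> Ss j; have [js|js] := ltnP j (size s); last by rewrite nth_default// size_rev.
by apply: Ss; rewrite -mem_rev mem_nth// size_rev.
Qed.

Let wt_terms k t (s : seq V) : t \in terms k -> size s = k ->
  wt (fun j => nth 0 (rev s) j) t.2 = PN N s.
Proof.
move=> tk sk; rewrite (perm_big _ (terms_perm tk)) /=.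
have -> : PN N s = \prod_(v <- rev s) N v.
  by rewrite /PN; apply: perm_big; rewrite perm_sym perm_rev.
by rewrite [RHS](big_nth 0) size_rev sk /index_iota subn0.
Qed.

Lemma Dcomp_lin x : U x -> mlin S n (Dcomp x).
Proof.
move=> Ux s1 s2 a v w Ss1 Ss2 Sv Sw ns.
(* Counted from the end, the inserted vector has index [size s2], whatever it is, and the others
   keep their indices. *)
pose hh u := nth 0 (rev (s1 ++ u :: s2)).
have hE u i : hh u i = if (i < size s2)%N then nth 0 (rev s2) i
    else if i == size s2 then u else nth 0 (rev s1) (i - (size s2).+1).
  rewrite /hh rev_cat rev_cons nth_cat size_rcons size_rev nth_rcons size_rev ltnS.
  by case: ltngtP.
have [k kE] : exists k, k = (size s1 + size s2).+1 by eexists.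
have sz u : size (s1 ++ u :: s2) = k by rewrite size_cat kE /= addnS.
rewrite /Dcomp !sz mulr_sumr -big_split /=.
apply: eq_big_seq => t tk.
have Sh u : S u -> forall i, S (hh u i).
  move=> Su; apply: nthrev_S; apply/inS_cat; split=> //; apply/inS_cons; split=> //.
rewrite /termval -/(hh (a *: v + w)) -/(hh v) -/(hh w).
rewrite (@blockval_lin x _ (size s2) (hh (a *: v + w)) (hh v) (hh w) a) //; first by ring.
- by apply/allP => b /(terms_block tk) h; rewrite (leq_trans h)// kE.
- rewrite (permP (terms_perm tk)) count_uniq_mem ?iota_uniq// mem_iota.
  by have -> : (0 <= size s2 < 0 + k)%N by lia.
- exact: Sh.
- exact: Sh.
- by move=> i isz; rewrite !hE (negbTE isz).
- by move=> i isz; rewrite !hE (negbTE isz).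
- by rewrite !hE ltnn eqxx.
Qed.

Let Dcomp_bounds k : (k <= n)%N -> exists K' : R, 0 <= K' /\
  forall x y s, U x -> U y -> N (y - x) < 1 -> inS S s -> size s = k ->
    `|Dcomp x s| <= K' * PN N s /\
    `|Dcomp y s - Dcomp x s| <= K' * (N (y - x) `^ al * PN N s).
Proof.
move=> kn.
pose P (z : V * V * seq V) := [/\ U z.1.1, U z.1.2, N (z.1.2 - z.1.1) < 1, inS S z.2 & size z.2 = k].
have X t : t \in terms k -> exists K' : R, 0 <= K' /\ forall z, P z ->
    `|termval z.1.1 (nth 0 (rev z.2)) t| <= K' * PN N z.2 /\
    `|termval z.1.2 (nth 0 (rev z.2)) t - termval z.1.1 (nth 0 (rev z.2)) t| <=
      K' * (N (z.1.2 - z.1.1) `^ al * PN N z.2).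
  move=> tk; have [||K' [K'0 HK']] := @term_hjet t.
  - by apply/allP => b /(terms_block tk) h; exact: leq_trans kn.
  - exact: leq_trans (terms_order tk) kn.
  exists K'; split=> // -[[x y] s] [/= Ux Uy t1 Ss sk].
  have [e1 _ e2] := HK' x y (nth 0 (rev s)) Ux Uy t1 (nthrev_S Ss).
  by rewrite (wt_terms tk sk) in e1 e2; rewrite mulrA.
have [||K1 [K10 H1]] := @sum_seq_bound _ _ _ P (terms k)
    (fun t z => termval z.1.1 (nth 0 (rev z.2)) t) (fun z => PN N z.2).
- by move=> z _; exact: PN_ge0.
- by move=> t /X[K' [? H]]; exists K'; split=> // z /H[].
have [||K2 [K20 H2]] := @sum_seq_bound _ _ _ P (terms k)
    (fun t z => termval z.1.2 (nth 0 (rev z.2)) t - termval z.1.1 (nth 0 (rev z.2)) t)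
    (fun z => N (z.1.2 - z.1.1) `^ al * PN N z.2).
- by move=> z _; rewrite mulr_ge0 ?powR_ge0// PN_ge0.
- by move=> t /X[K' [? H]]; exists K'; split=> // z /H[].
exists (K1 + K2); split; first exact: addr_ge0.
move=> x y s Ux Uy t1 Ss sk; rewrite /Dcomp sk -sumrB.
have Pz : P (x, y, s) by [].
have := H1 _ Pz; have := H2 _ Pz; rewrite /= => h2 h1; split.
- by apply: le_trans h1 _; rewrite ler_wpM2r ?PN_ge0// lerDl.
- by apply: le_trans h2 _; rewrite ler_wpM2r ?lerDr// mulr_ge0 ?powR_ge0// PN_ge0.
Qed.

Let Dcomp_rem k : (k < n)%N -> exists K' : R, 0 <= K' /\
  forall x y s, U x -> U y -> N (y - x) < 1 -> inS S s -> size s = k ->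
    `|Dcomp y s - Dcomp x s - Dcomp x (y - x :: s)| <=
      K' * (N (y - x) * N (y - x) `^ al * PN N s).
Proof.
move=> kn.
pose P (z : V * V * seq V) := [/\ U z.1.1, U z.1.2, N (z.1.2 - z.1.1) < 1, inS S z.2 & size z.2 = k].
(* The numbering of the longer list also serves for [s]: it gives [y - x] the index [k], and terms
   of order [k] contain only indices below [k]. *)
pose hh (z : V * V * seq V) := nth 0 (rev (z.1.2 - z.1.1 :: z.2)).
have hhE z i : P z -> (i < k)%N -> hh z i = nth 0 (rev z.2) i.
  move=> [_ _ _ _ sk] ik; rewrite /hh rev_cons nth_rcons size_rev sk.
  by rewrite ik.
have hhk z : P z -> hh z k = z.1.2 - z.1.1.
  by move=> [_ _ _ _ sk]; rewrite /hh rev_cons nth_rcons size_rev sk ltnn eqxx.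
have blk t b j : t \in terms k -> b \in t.2 -> j \in b -> (j < k)%N.
  move=> tk bt jb; have := perm_mem (terms_perm tk) j; rewrite mem_iota /= add0n => <-.
  by apply/flattenP; exists b.
have termvalE t z w : t \in terms k -> P z -> termval w (hh z) t = termval w (nth 0 (rev z.2)) t.
  move=> tk Pz; rewrite /termval /blockval; congr (_ * _); apply: eq_big_seq => b bt.
  congr (D _ _); apply/eq_in_map => j jb; apply: hhE => //; exact: blk bt jb.
have [||K1 [K10 H1]] := @sum_seq_bound _ _ _ P (terms k)
    (fun t z => termval z.1.2 (hh z) t - termval z.1.1 (hh z) t -
       \sum_(c <- dterm k t) termval z.1.1 (hh z) c)
    (fun z => N (z.1.2 - z.1.1) * N (z.1.2 - z.1.1) `^ al * PN N z.2).
- by move=> z _; rewrite !mulr_ge0 ?powR_ge0// PN_ge0.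
- move=> t tk; have [||K' [K'0 HK']] := @term_jet t.
  + by apply/allP => b /(terms_block tk) h; exact: leq_ltn_trans kn.
  + exact: leq_trans (terms_order tk) (ltnW kn).
  exists K'; split=> // z Pz; case: (Pz) => Ux Uy t1 Ss sk.
  have [|_ _] := HK' _ _ (hh z) k Ux Uy t1 _ (hhk _ Pz).
    by apply: nthrev_S; apply/inS_cons; split=> //; apply: SB; apply: US.
  rewrite [X in _ <= _ * _ * X -> _](_ : _ = PN N z.2) ?mulrA//.
  rewrite -(wt_terms tk sk); apply: eq_big_seq => j /flattenP[b bt jb].
  by rewrite hhE// (blk _ _ _ tk bt jb).
exists K1; split=> // x y s Ux Uy t1 Ss sk.
have Pz : P (x, y, s) by [].
have := H1 _ Pz; rewrite 2!sumrB /Dcomp /= sk big_flatten big_map /=.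
by rewrite -/(hh (x, y, s)); congr (`|_ - _ - _| <= _); apply: eq_big_seq => t tk;
  rewrite termvalE.
Qed.

Lemma Hol_comp : exists K', Hol S N n al U K' Dcomp.
Proof.
have [||K1 H1] := @nat_bound R (fun k K' => 0 <= K' /\
  forall x y s, U x -> U y -> N (y - x) < 1 -> inS S s -> size s = k ->
    `|Dcomp y s - Dcomp x s| <= K' * (N (y - x) `^ al * PN N s)) n.
- move=> i k1 k2 [k10 Hk] k12; split; first exact: le_trans k12.
  move=> x y s Ux Uy t1 Ss sk; apply: le_trans (Hk _ _ _ Ux Uy t1 Ss sk) _.
  by rewrite ler_wpM2r// mulr_ge0 ?powR_ge0// PN_ge0.
- by move=> k /Dcomp_bounds[K' [K'0 HK']]; exists K'; split=> // x y s *; apply: (HK' x y s _ _ _ _ _).2.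
have [||K2 H2] := @nat_bound R (fun k K' => 0 <= K' /\
  forall x s, U x -> inS S s -> size s = k -> `|Dcomp x s| <= K' * PN N s) n.
- move=> i k1 k2 [k10 Hk] k12; split; first exact: le_trans k12.
  move=> x s Ux Ss sk; apply: le_trans (Hk _ _ Ux Ss sk) _.
  by rewrite ler_wpM2r// PN_ge0.
- move=> k /Dcomp_bounds[K' [K'0 HK']]; exists K'; split=> // x s Ux Ss sk.
  by apply: (HK' x x s _ _ _ _ _).1 => //; rewrite subrr N00 ltr01.
have [||K3 H3] := @nat_bound R (fun k K' => 0 <= K' /\ ((k < n)%N ->
  forall x y s, U x -> U y -> N (y - x) < 1 -> inS S s -> size s = k ->
    `|Dcomp y s - Dcomp x s - Dcomp x (y - x :: s)| <=
      K' * (N (y - x) * N (y - x) `^ al * PN N s))) n.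
- move=> i k1 k2 [k10 Hk] k12; split; first exact: le_trans k12.
  move=> kn x y s Ux Uy t1 Ss sk; apply: le_trans (Hk kn _ _ _ Ux Uy t1 Ss sk) _.
  by rewrite ler_wpM2r// !mulr_ge0 ?powR_ge0// PN_ge0.
- move=> k _; have [/Dcomp_rem[K' [K'0 HK']]|nk] := ltnP k n.
    by exists K'; split=> // _ x y s *; apply: HK'.
  by exists 0; split=> //; rewrite ltnNge nk.
have K10 := (H1 _ (leqnn _)).1; have K20 := (H2 _ (leqnn _)).1; have K30 := (H3 _ (leqnn _)).1.
(* The estimates above assume increments of norm less than 1, hence the radius 1. *)
apply: (@Hol_local _ _ _ _ _ _ N0 SB al01 _ (K1 + K2 + K3) 1 Dcomp) => //.
- by rewrite !addr_ge0.
- exact: Dcomp_lin.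
- move=> x s Ux Ss sn; apply: le_trans ((H2 _ sn).2 _ _ Ux Ss erefl) _.
  by rewrite ler_wpM2r ?PN_ge0//; lra.
- move=> x y s Ux Uy t1 Ss sn; rewrite -!mulrA.
  apply: le_trans ((H3 _ (ltnW sn)).2 sn _ _ _ Ux Uy t1 Ss erefl) _.
  by rewrite -!mulrA ler_wpM2r ?mulr_ge0 ?PN_ge0 ?powR_ge0//; lra.
- move=> x y s Ux Uy t1 Ss sn; rewrite -!mulrA.
  apply: le_trans ((H1 _ (eq_leq sn)).2 _ _ _ Ux Uy t1 Ss erefl) _.
  by rewrite ler_wpM2r ?mulr_ge0 ?PN_ge0 ?powR_ge0//; lra.
Qed.

End Composition.

(** * Cutoffs and comparison with the definitions of smoothness *)

Section PositivePart.
Variable R : realType.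
Implicit Types x y B : R.

Definition ppow (j : nat) x : R := if 0 < x then x ^+ j else 0.

(* The [a]-th derivative of [max(0, x) ^ m] (up to order [m - 1]); this power is the only cutoff used, so that no flat smooth function is needed. *)
Definition ptau (m a : nat) x : R := (m ^_ a)%:R * ppow (m - a) x.

Lemma ppowS j x : ppow j.+1 x = x * ppow j x.
Proof. by rewrite /ppow; case: ifP; rewrite ?mulr0// exprS. Qed.

Lemma ppow_bound j B x : `|x| <= B -> `|ppow j x| <= B ^+ j.
Proof.
move=> xB; have B0 : 0 <= B by apply: le_trans xB.
rewrite /ppow; case: ifP => _; last by rewrite normr0 exprn_ge0.
by rewrite normrX lerXn2r.
Qed.

Lemma ppow_lip j B : 0 <= B -> exists K : R, 0 <= K /\ forall x y, `|x| <= B -> `|y| <= B ->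
  `|ppow j.+1 y - ppow j.+1 x| <= K * `|y - x|.
Proof.
move=> B0; elim: j => [|j [K [K0 HK]]].
  exists 1; split=> // x y _ _; rewrite mul1r /ppow !expr1.
  case: (ltP 0 y) => y0; case: (ltP 0 x) => x0 //.
  - by rewrite subr0 ger0_norm ?(ltW y0)// ger0_norm; lra.
  - by rewrite sub0r normrN ger0_norm ?(ltW x0)// ler0_norm; lra.
  - by rewrite subrr normr0.
exists (B * K + B ^+ j.+1); split; first by rewrite addr_ge0 ?mulr_ge0 ?exprn_ge0.
move=> x y xB yB; rewrite ppowS (ppowS _ x).
rewrite (_ : _ - _ = y * (ppow j.+1 y - ppow j.+1 x) + (y - x) * ppow j.+1 x); last by ring.
apply: le_trans (ler_normD _ _) _; rewrite !normrM mulrDl lerD//.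
  by rewrite -mulrA ler_pM// HK.
by rewrite mulrC ler_wpM2r// ppow_bound.
Qed.

Lemma ppow_taylor j B : 0 <= B -> exists K : R, 0 <= K /\ forall x y, `|x| <= B -> `|y| <= B ->
  `|ppow j.+2 y - ppow j.+2 x - j.+2%:R * ppow j.+1 x * (y - x)| <= K * (y - x) ^+ 2.
Proof.
move=> B0; elim: j => [|j [K [K0 HK]]].
  exists 1; split=> // x y _ _; rewrite mul1r /ppow !expr1 !expr2.
  case: (ltP 0 y) => y0; case: (ltP 0 x) => x0 //; rewrite ler_norml.
  - have := mulr_ge0 (sqr_ge0 (y - x)) (ler0n R 2); rewrite expr2.
    by move=> ?; apply/andP; split; lra.
  - have h1 : 0 <= y * - x by rewrite mulr_ge0 ?oppr_ge0// ltW.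
    have h2 := sqr_ge0 x; have h3 := sqr_ge0 y; rewrite !expr2 in h2 h3.
    by apply/andP; split; lra.
  - have h1 : 0 <= x * - y by rewrite mulr_ge0 ?oppr_ge0// ltW.
    have h2 := sqr_ge0 x; have h3 := sqr_ge0 y; rewrite !expr2 in h2 h3.
    by apply/andP; split; lra.
  - have := sqr_ge0 (y - x); rewrite expr2 => h1.
    by apply/andP; split; lra.
have [L [L0 HL]] := ppow_lip j.+1 B0.
exists (B * K + L); split; first by rewrite addr_ge0 ?mulr_ge0.
move=> x y xB yB; rewrite ppowS (ppowS j.+2 x).
(* The product rule for [x * ppow j.+2 x]: the lower remainder times [x], and [y - x] times an
   increment that is Lipschitz, hence quadratic together. *)
rewrite (_ : _ - _ = x * (ppow j.+2 y - ppow j.+2 x - j.+2%:R * ppow j.+1 x * (y - x)) +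
    (y - x) * (ppow j.+2 y - ppow j.+2 x)); last first.
  by rewrite -[in LHS]natr1 (ppowS j.+1 x); ring.
apply: le_trans (ler_normD _ _) _; rewrite !normrM [leRHS]mulrDl lerD//.
  by rewrite -[leRHS]mulrA ler_pM// HK.
rewrite -real_normK ?num_real// expr2 mulrA mulrC ler_wpM2r//.
exact: HL.
Qed.

(** The exponent [n + 2] leaves at every order [a <= n] a power of degree at least 2, whose Taylor
    remainder is quadratic; this is the hypothesis on [tau] under which compositions are smooth. *)
Lemma ptau_smooth (n : nat) B : exists K : R, [/\ 0 <= K,
  (forall a x, (a <= n.+1)%N -> `|x| <= B -> `|ptau n.+2 a x| <= K) &
  (forall a x y, (a <= n)%N -> `|x| <= B -> `|y| <= B ->
     `|ptau n.+2 a y - ptau n.+2 a x - ptau n.+2 a.+1 x * (y - x)| <= K * (y - x) ^+ 2)].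
Proof.
have [K1 H1] : exists K, forall a, (a <= n.+1)%N -> 0 <= K /\ forall x, `|x| <= B ->
    `|ptau n.+2 a x| <= K.
  apply: nat_bound => [a K K' [K0 h] KK|a _].
    by split=> [|x xB]; [exact: le_trans KK|apply: le_trans (h _ xB) KK].
  exists ((n.+2 ^_ a)%:R * `|B| ^+ (n.+2 - a)); split.
    by rewrite mulr_ge0// exprn_ge0.
  move=> x xB; rewrite /ptau normrM ger0_norm// ler_wpM2l//.
  by apply: ppow_bound; apply: le_trans xB (ler_norm _).
have [K2 H2] : exists K, forall a, (a <= n)%N -> 0 <= K /\ forall x y, `|x| <= B -> `|y| <= B ->
    `|ptau n.+2 a y - ptau n.+2 a x - ptau n.+2 a.+1 x * (y - x)| <= K * (y - x) ^+ 2.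
  apply: nat_bound => [a K K' [K0 h] KK|a an].
    split=> [|x y xB yB]; first exact: le_trans KK.
    by apply: le_trans (h _ _ xB yB) _; rewrite ler_wpM2r// sqr_ge0.
  have [K [K0 HK]] := ppow_taylor (n - a) (normr_ge0 B).
  exists ((n.+2 ^_ a)%:R * K); split; first by rewrite mulr_ge0.
  move=> x y xB yB.
  have -> : ptau n.+2 a y - ptau n.+2 a x - ptau n.+2 a.+1 x * (y - x) = (n.+2 ^_ a)%:R *
      (ppow (n - a).+2 y - ppow (n - a).+2 x - (n - a).+2%:R * ppow (n - a).+1 x * (y - x)).
    rewrite /ptau ffactnSr natrM.
    have -> : (n.+2 - a = (n - a).+2)%N by lia.
    have -> : (n.+2 - a.+1 = (n - a).+1)%N by lia.
    by ring.
  rewrite normrM ger0_norm// -[leRHS]mulrA ler_wpM2l//.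
  by apply: HK; [apply: le_trans xB (ler_norm _)|apply: le_trans yB (ler_norm _)].
have K10 := (H1 _ (leqnn _)).1; have K20 := (H2 _ (leqnn _)).1.
exists (K1 + K2); split; first exact: addr_ge0.
- by move=> a x an xB; apply: le_trans ((H1 _ an).2 _ xB) _; rewrite lerDl.
- move=> a x y an xB yB; apply: le_trans ((H2 _ an).2 _ _ xB yB) _.
  by rewrite ler_wpM2r ?sqr_ge0// lerDr.
Qed.

Lemma ptau_le0 m a x : x <= 0 -> ptau m a x = 0.
Proof. by move=> x0; rewrite /ptau /ppow ltNge x0 mulr0. Qed.

Lemma ptau0 m x : ptau m 0 x = ppow m x.
Proof. by rewrite /ptau subn0 mul1r. Qed.

End PositivePart.

Lemma Dcomp_ptau_nil (R : realType) (V : lmodType R) m (D : V -> seq V -> R) x :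
  Dcomp (@ptau R m) D x [::] = ppow m (D x [::]).
Proof. by rewrite /Dcomp /= big_seq1 /termval /blockval /= big_nil mulr1 ptau0. Qed.

Lemma Dcomp_ptau_le0 (R : realType) (V : lmodType R) m (D : V -> seq V -> R) x s :
  D x [::] <= 0 -> Dcomp (@ptau R m) D x s = 0.
Proof. by move=> D0; rewrite /Dcomp big1// => t _; rewrite /termval ptau_le0// mul0r. Qed.

Section ToDefs.
Variables (R : realType) (V : lmodType R) (S : set V) (N : V -> R).
Hypothesis N0 : forall x, 0 <= N x.
Variables (n : nat) (r : R).
Hypothesis nr : n%:R < r.
Hypothesis rn : r <= n.+1%:R.

Lemma map_consI k (v : V) (h : 'I_k -> V) :
  map (consI v h) (enum 'I_k.+1) = v :: map h (enum 'I_k).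
Proof.
rewrite enum_ordSl /= -map_comp /consI unlift_none; congr (_ :: _).
by apply: eq_map => i /=; rewrite liftK.
Qed.

Lemma PN_enum k (h : 'I_k -> V) : PN N (map h (enum 'I_k)) = prodN N h.
Proof. by rewrite /PN /prodN big_map big_enum. Qed.

Lemma inS_enum k (h : 'I_k -> V) : in_S S h -> inS S (map h (enum 'I_k)).
Proof. by move=> Sh v /mapP[i _ ->]. Qed.

Lemma small_powR (K e a : R) : 0 <= K -> 0 < a -> 0 < e -> exists2 del : R, 0 < del &
  forall t, 0 <= t -> t < del -> K * t `^ a <= e.
Proof.
move=> K0 a0 e0; have K1 : 0 < K + 1 by rewrite ltr_wpDl.
exists ((e / (K + 1)) `^ a^-1); first by rewrite powR_gt0// divr_gt0.
move=> t t0 td.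
have : t `^ a <= e / (K + 1).
  have <- : ((e / (K + 1)) `^ a^-1) `^ a = e / (K + 1).
    by rewrite -powRrM mulVf ?gt_eqF// powRr1// ltW// divr_gt0.
  by apply: powR_le_mono => //; apply: ltW.
rewrite ler_pdivlMr// => h; apply: le_trans h.
by rewrite mulrC ler_wpM2l ?powR_ge0// lerDl.
Qed.

Lemma Hol_uniformly_smooth K D : Hol S N n (r - n%:R) S K D ->
  uniformly_Hs_smooth S N r (fun x => D x [::]).
Proof.
move=> [K0 l b re h]; exists n; split=> //.
have al0 : 0 < r - n%:R by rewrite subr_gt0.
(* The enumeration of ['I_k] starts with [ord0], so [consI v h] becomes a list with head [v], and
   both conventions for the last direction agree. *)
exists (fun k x (h : 'I_k -> V) => D x (map h (enum 'I_k))).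
have sz k (w : 'I_k -> V) : size (map w (enum 'I_k)) = k by rewrite size_map size_enum_ord.
split; last first.
  exists K => y z Sy Sz w Sw; rewrite -PN_enum.
  have := h z y _ Sz Sy (inS_enum Sw) (sz _ _).
  by [].
split.
- by move=> x w Sx; congr (D _ _); apply: size0nil; rewrite sz.
- move=> k x kn Sx; split; last first.
    by exists K => w Sw; rewrite -PN_enum; apply: b; rewrite ?sz//; apply: inS_enum.
  move=> w i a v u Sw Sv Su.
  have ie : i \in enum 'I_k by rewrite mem_enum.
  have := enum_uniq 'I_k; have := sz k w; rewrite size_map.
  case/splitPr: ie => e1 e2 se; rewrite cat_uniq /= negb_or => /and4P[_ /andP[ie1 _] ie2 _].
  have E f : map (fun j => if j == i then f else w j) (e1 ++ i :: e2) =
      map w e1 ++ f :: map w e2.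
    rewrite map_cat /= eqxx; congr (_ ++ _ :: _); apply/eq_in_map => j je.
      by case: eqP => // ji; rewrite ji (negbTE ie1) in je.
    by case: eqP => // ji; rewrite ji (negbTE ie2) in je.
  rewrite !E l//.
  + by move=> z /mapP[j _ ->].
  + by move=> z /mapP[j _ ->].
  + by move: se; rewrite !size_map size_cat /=; lia.
- move=> k x kn Sx e e0; have [del d0 Hd] := small_powR K0 al0 e0.
  exists del => // y Sy yd w Sw; rewrite map_consI -PN_enum.
  apply: le_trans (re _ _ _ Sx Sy (inS_enum Sw) _) _; first by rewrite sz.
  rewrite ler_wpM2r ?PN_ge0// mulrCA mulrC ler_wpM2r//.
  exact: Hd.
- move=> x Sx e e0; have [del d0 Hd] := small_powR K0 al0 e0.
  exists del => // y Sy yd w Sw; rewrite -PN_enum.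
  apply: le_trans (h _ _ _ Sx Sy (inS_enum Sw) (sz _ _)) _.
  rewrite ler_wpM2r ?PN_ge0//; exact: Hd.
Qed.

End ToDefs.

(** * Quantitative estimates from the definition of C^n *)

Section FromDefs.
Variables (R : realType) (X : normedModType R).
Local Notation nrm := (fun x : X => `|x|).

Lemma is_derive_eps (f : R -> R) (x d : R) :
  (forall e, 0 < e -> exists2 del, 0 < del &
     forall y, `|y - x| < del -> `|f y - f x - d * (y - x)| <= e * `|y - x|) ->
  is_derive x 1 f d.
Proof.
move=> H.
have C : (fun h => h^-1 *: ((f \o shift x) (h *: (1 : R)) - f x)) @ (0 : R)^' --> d.
  apply/cvgrPdist_le => e e0; have [del d0 Hd] := H e e0.
  near=> h.
  have h0 : h != 0 by near: h; exact: nbhs_dnbhs_neq.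
  have hd : `|h| < del by near: h; exact: dnbhs0_lt.
  have := Hd (h + x); rewrite addrK => /(_ hd) E.
  rewrite /= /GRing.scale /= mulr1.
  rewrite (_ : _ - _ = - (h^-1 * (f (h + x) - f x - d * h))); last by field.
  by rewrite normrN normrM normfV ler_pdivrMl ?normr_gt0// [leRHS]mulrC.
by apply: DeriveDef; [apply/cvg_ex; exists d|apply: cvg_lim].
Unshelve. all: by end_near. Qed.

Definition lD (D : forall k : nat, X -> ('I_k -> X) -> R) (x : X) (s : seq X) : R :=
  D (size s) x (fun i => nth 0 s i).

Lemma lDE D x s k : size s = k -> lD D x s = D k x (fun i => nth 0 s i).
Proof. by move=> <-. Qed.

Lemma consI_nth (v : X) s k : size s = k ->
  consI v (fun i : 'I_k => nth 0 s i) = (fun i : 'I_k.+1 => nth 0 (v :: s) i).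
Proof.
move=> sk; apply/funext => i; rewrite /consI; case: unliftP => [j ->|->] //.
Qed.

Lemma prodN_nth s k : size s = k -> prodN nrm (fun i : 'I_k => nth 0 s i) = PN nrm s.
Proof. by move=> <-; rewrite /PN /prodN (big_nth 0) big_mkord. Qed.

Variables (n : nat) (g : X -> R) (D : forall k : nat, X -> ('I_k -> X) -> R).
Hypothesis HD : Cn_derivs setT nrm n g D.

Lemma lD_lin x : mlin setT n (lD D x).
Proof.
move=> s1 s2 a v w _ _ _ _ sn; have [_ ml _ _] := HD.
set k := (size s1 + size s2).+1.
have sz u : size (s1 ++ u :: s2) = k by rewrite size_cat /= addnS.
have kn : (k <= n)%N by [].
have i1 : (size s1 < k)%N by rewrite /k ltnS leq_addr.
have [L _] := ml k x kn I.
rewrite !(lDE _ _ (sz _)).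
have E u : (fun i : 'I_k => nth 0 (s1 ++ u :: s2) i) =
   (fun j => if j == Ordinal i1 then u else nth 0 (s1 ++ v :: s2) j).
  apply/funext => j; rewrite -val_eqE /= !nth_cat.
  case: ltngtP => //= [h|->]; last by rewrite subnn.
  by rewrite -[(j - size s1)%N]prednK ?subn_gt0.
rewrite (E (a *: v + w)) (E w) (E v); exact: L.
Qed.

Lemma lD_bound_at (x0 : X) : exists K, forall s, (size s <= n)%N -> `|lD D x0 s| <= K * PN nrm s.
Proof.
have [_ ml _ _] := HD.
have [K HK] : exists K, forall k, (k <= n)%N -> forall s, size s = k -> `|lD D x0 s| <= K * PN nrm s.
  apply: nat_bound => [k K K' h KK s sk|k kn].
    apply: le_trans (h _ sk) _; rewrite ler_wpM2r// PN_ge0//.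
  have [_ [M HM]] := ml k x0 kn I; exists M => s sk.
  by rewrite (lDE _ _ sk) -(prodN_nth sk); apply: HM.
by exists K => s sn; apply: HK sn _ _.
Qed.

(** The mean value theorem along the segment from [x] to [y]. It turns the merely pointwise
    differentiability in [Cn_derivs] into uniform estimates. *)
Lemma lD_mvt x y s : (size s < n)%N -> exists2 c : R, 0 <= c <= 1 &
  lD D y s - lD D x s = lD D (x + c *: (y - x)) (y - x :: s).
Proof.
move=> sn; have [_ ml df _] := HD.
set v := y - x; pose f c := lD D (x + c *: v) s.
have df1 (c : R) : is_derive c 1 f (lD D (x + c *: v) (v :: s)).
  apply: is_derive_eps => e e0.
  (* The summand 1 keeps [w] positive when the increment or a direction has norm 0. *)
  pose w := `|v| * PN nrm s + 1.
  have P0 : 0 <= `|v| * PN nrm s by rewrite mulr_ge0// PN_ge0.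
  have w0 : 0 < w by rewrite ltr_wpDl.
  have [del d0 Hd] := df _ (x + c *: v) sn I (e / w) (divr_gt0 e0 w0).
  exists (del / (`|v| + 1)); first by rewrite divr_gt0// ltr_wpDl.
  move=> c' cc'.
  have E : x + c' *: v - (x + c *: v) = (c' - c) *: v.
    by rewrite opprD addrACA subrr add0r scalerBl.
  have := Hd (x + c' *: v) I; rewrite E normrZ.
  have -> : `|c' - c| * `|v| < del.
    move: cc'; rewrite ltr_pdivlMr ?ltr_wpDl//; apply: le_lt_trans.
    by rewrite ler_wpM2l// lerDl.
  move=> /(_ isT (fun i => nth 0 s i) (fun=> I)).
  rewrite (consI_nth _ erefl) (prodN_nth erefl) -/(lD D _ ((c' - c) *: v :: s)) -!/(lD D _ s).
  have lin := lD_lin (x + c *: v).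
  have z0 : lD D (x + c *: v) (0 :: s) = 0.
    have := lin [::] s 1 0 0; rewrite /= scaler0 addr0 mul1r => /(_ _ _ _ _ sn) H.
    by have : lD D (x + c *: v) (0 :: s) + lD D (x + c *: v) (0 :: s) = lD D (x + c *: v) (0 :: s) + 0;
      [rewrite addr0 -H|move/addrI].
  have -> : lD D (x + c *: v) ((c' - c) *: v :: s) = lD D (x + c *: v) (v :: s) * (c' - c).
    have := lin [::] s (c' - c) v 0; rewrite /= addr0 => -> //.
    by rewrite z0 addr0 mulrC.
  move=> h; apply: le_trans h _; rewrite /=.
  rewrite (_ : _ * _ * _ = e * `|c' - c| * ((`|v| * PN nrm s) / w)); last by field; lra.
  rewrite -[leRHS]mulr1 ler_wpM2l ?mulr_ge0// ?ltW//.
  by rewrite ltr_pdivrMr// mul1r /w ltrDl.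
have [|c] := @MVT_segment R f (fun c => lD D (x + c *: v) (v :: s)) 0 1 ler01 (fun c _ => df1 c).
  apply: derivable_within_continuous => c _; exact: ex_derive.
rewrite in_itv /= => cI E; exists c => //.
by move: E; rewrite /f scale1r scale0r addr0 subr0 mulr1 /v addrCA subrr addr0.
Qed.

(** A Hoelder condition on the top derivative controls only its variation, so bounds must start
    somewhere: the last hypothesis gives each point a reference point within distance [L]. For a
    bump this lies off the support, for a ball it is the centre. *)
Lemma Cn_derivs_Hol (U : set X) (al M L C0 : R) : 0 < al <= 1 ->
  (forall x y (c : R), U x -> U y -> 0 <= c <= 1 -> U (x + c *: (y - x))) ->
  (forall x y s, U x -> U y -> size s = n ->
     `|lD D y s - lD D x s| <= M * `|y - x| `^ al * PN nrm s) ->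
  (forall x, U x -> exists2 x0, U x0 & `|x - x0| <= L /\
     forall s, (size s <= n)%N -> `|lD D x0 s| <= C0 * PN nrm s) ->
  exists K, Hol setT nrm n al U K (lD D).
Proof.
move=> al01 cvx HM Hx0; have [al0 al1] := andP al01.
pose M' := `|M|; pose L' := `|L|; pose C' := `|C0|.
have M'0 : 0 <= M' := normr_ge0 _.
have L'0 : 0 <= L' := normr_ge0 _.
have C'0 : 0 <= C' := normr_ge0 _.
have HM' x y s : U x -> U y -> size s = n ->
    `|lD D y s - lD D x s| <= M' * `|y - x| `^ al * PN nrm s.
  move=> Ux Uy sn; apply: le_trans (HM _ _ _ Ux Uy sn) _.
  by rewrite ler_wpM2r ?PN_ge0// ler_wpM2r ?powR_ge0// ler_norm.
have b0 : forall x, U x -> exists2 x0, U x0 & `|x - x0| <= L' /\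
     forall s, (size s <= n)%N -> `|lD D x0 s| <= C' * PN nrm s.
  move=> x /Hx0[x0 Ux0 [xL b]]; exists x0 => //; split.
    exact: le_trans xL (ler_norm _).
  by move=> s /b h; apply: le_trans h _; rewrite ler_wpM2r ?PN_ge0// ler_norm.
have P0 s : 0 <= PN nrm s by apply: PN_ge0.
have [K [K0 HK]] : exists K : R, 0 <= K /\ forall x s, U x -> (0 <= size s <= n)%N ->
    `|lD D x s| <= K * PN nrm s.
  (* Downward induction on the order: order [n] varies little from its value at [x0], and each lower
     order is controlled by the mean value theorem and the bound one order higher. *)
  have : forall j, (j <= n)%N -> exists K : R, 0 <= K /\ forall x s, U x ->
      (n - j <= size s <= n)%N -> `|lD D x s| <= K * PN nrm s.
    elim=> [_|j IH jn].
      exists (C' + M' * L' `^ al); split.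
        by rewrite addr_ge0 ?mulr_ge0 ?powR_ge0.
      move=> x s Ux; rewrite subn0 -eqn_leq => /eqP sn.
      have [x0 Ux0 [xL b]] := b0 _ Ux.
      have h1 := HM' _ _ _ Ux0 Ux (esym sn); have h2 := b s (eq_leq (esym sn)).
      have := ler_normD (lD D x s - lD D x0 s) (lD D x0 s); rewrite subrK => h3.
      have h4 : M' * `|x - x0| `^ al * PN nrm s <= M' * L' `^ al * PN nrm s.
        by rewrite ler_wpM2r// ler_wpM2l// powR_le_mono// ltW.
      lra.
    have [K [K0 HK]] := IH (ltnW jn).
    exists (C' + K * L' + K); split; first by rewrite !addr_ge0 ?mulr_ge0.
    move=> x s Ux sn.
    have [sj|sj] := leqP (n - j) (size s).
      apply: le_trans (HK _ _ Ux _) _; first by lia.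
      by rewrite ler_wpM2r// lerDr addr_ge0 ?mulr_ge0.
    have [x0 Ux0 [xL b]] := b0 _ Ux.
    have sn' : (size s < n)%N by lia.
    have [c cI E] := lD_mvt x0 x sn'.
    have h1 : `|lD D x s - lD D x0 s| <= K * (`|x - x0| * PN nrm s).
      by rewrite E -PN_cons; apply: HK; [exact: cvx|rewrite /=; lia].
    have h2 := b s (ltnW sn').
    have := ler_normD (lD D x s - lD D x0 s) (lD D x0 s); rewrite subrK => h3.
    have h4 : K * (`|x - x0| * PN nrm s) <= K * (L' * PN nrm s).
      by rewrite ler_wpM2l// ler_wpM2r.
    have := mulr_ge0 K0 (P0 s); lra.
  by move=> /(_ n (leqnn _)); rewrite subnn.
apply: (@Hol_local _ _ setT nrm n al _ _ al01 U (K + M') 1) => //.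
- by rewrite addr_ge0.
- by move=> x _; exact: lD_lin.
- move=> x s Ux _ sn; apply: le_trans (HK _ _ Ux _) _ => //.
  by rewrite ler_wpM2r// lerDl.
- move=> x y s Ux Uy t1 _ sn; have [c cI E] := lD_mvt x y sn.
  rewrite E; set z := x + _; have Uz : U z by apply: cvx.
  have zx : `|z - x| <= `|y - x|.
    rewrite /z addrC addKr normrZ; case/andP: cI => c0 c1.
    by rewrite ger0_norm// -[leRHS]mul1r ler_wpM2r.
  have ta : `|y - x| <= `|y - x| `^ al.
    by apply: le_self_powR; rewrite ?normr_ge0 ?(ltW t1) ?(ltW al0) ?al1.
  (* The remainder is the change of the next derivative between [x] and the intermediate point [z]:
     a Hoelder difference if that derivative has order [n], otherwise a second mean value
     applies. *)
  have [sn1|sn1] := eqVneq (size s).+1 n.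
    apply: le_trans (HM' x z (y - x :: s) Ux Uz _) _; first exact: sn1.
    rewrite PN_cons -!mulrA.
    apply: (@le_trans _ _ (M' * (`|y - x| `^ al * (`|y - x| * PN nrm s)))).
      by rewrite ler_wpM2l// ler_wpM2r ?mulr_ge0// powR_le_mono// ltW.
    rewrite mulrDl [_ `^ _ * (_ * _)]mulrCA lerDr !mulr_ge0// powR_ge0//.
  have sn2 : (size ((y - x)%R :: s) < n)%N by rewrite /= ltn_neqAle sn1.
  have [c' cI' E'] := lD_mvt x z sn2; rewrite E'.
  apply: le_trans (HK _ _ _ _) _; [exact: cvx|by []|].
  rewrite !PN_cons -!mulrA mulrDl.
  apply: (@le_trans _ _ (K * (`|y - x| `^ al * (`|y - x| * PN nrm s)))).
    by rewrite ler_wpM2l// ler_wpM2r ?mulr_ge0// (le_trans zx).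
  rewrite [_ `^ _ * (_ * _)]mulrCA lerDl !mulr_ge0// powR_ge0//.
- move=> x y s Ux Uy _ _ sn; apply: le_trans (HM' _ _ _ Ux Uy sn) _.
  by rewrite ler_wpM2r// ler_wpM2r ?powR_ge0// lerDr.
Qed.

(** Supplies the reference points off the support of a bump. By induction on the list: the lower
    derivative is 0 near [y], so testing the next one on a small multiple of [v] bounds it by an
    arbitrary multiple of [e]. *)
Lemma lD_vanish (x0 : X) (eta : R) : 0 < eta -> (forall y, `|y - x0| < eta -> g y = 0) ->
  forall y s, `|y - x0| < eta -> (size s <= n)%N -> lD D y s = 0.
Proof.
move=> eta0 g0; have [Dg ml df _] := HD.
move=> y s; elim: s y => [|v s IH] y yx sn.
  by rewrite /lD /= Dg// g0.
have E c w : lD D y (c *: w :: s) = c * lD D y (w :: s).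
  have z0 : lD D y (0 :: s) = 0.
    have lin : mlin setT n (lD D y) := @lD_lin y.
  have := lin [::] s 1 0 0.
    rewrite /= scaler0 addr0 mul1r => /(_ _ _ _ _ sn) H.
    by have : lD D y (0 :: s) + lD D y (0 :: s) = lD D y (0 :: s) + 0;
      [rewrite addr0 -H|move/addrI].
  have lin : mlin setT n (lD D y) := @lD_lin y.
  have := lin [::] s c w 0.
  by rewrite /= addr0 => -> //; rewrite z0 addr0.
apply/eqP; rewrite -normr_eq0 eq_le normr_ge0 andbT.
have -> : 0 = (`|v| * PN nrm s) * 0 `^ 1 :> R by rewrite powRr1// mulr0.
apply: le_powR_limit => // [|e e0]; first by rewrite mulr_ge0 ?PN_ge0.
rewrite powRr1 ?(ltW e0)//.
have [del d0 Hd] := df (size s) y sn I e e0.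
have b0 : 0 < eta - `|y - x0| by rewrite subr_gt0.
pose m := Num.min del (eta - `|y - x0|).
have m0 : 0 < m by rewrite /m lt_min d0.
pose c := m / (`|v| + 1) / 2.
have v1 : 0 < `|v| + 1 by rewrite ltr_wpDl.
have c0 : 0 < c by rewrite !divr_gt0.
have cv : c * `|v| < m.
  rewrite /c (_ : _ * _ = m * (`|v| / (`|v| + 1) / 2)); last by field; lra.
  rewrite -[ltRHS]mulr1 ltr_pM2l// ltr_pdivrMr// ltr_pdivrMr//; lra.
have n1 : `|c *: v| = c * `|v| by rewrite normrZ gtr0_norm.
have := Hd (y + c *: v) I; rewrite [y + _ - y]addrC addKr n1.
have -> : c * `|v| < del by apply: lt_le_trans cv _; rewrite /m ge_min lexx.
move=> /(_ isT (fun i => nth 0 s i) (fun=> I)).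
rewrite (consI_nth _ erefl) (prodN_nth erefl) -/(lD D _ (c *: v :: s)) -!/(lD D _ s).
have sn' := ltnW sn; rewrite E !IH//; last first.
  rewrite addrAC; apply: le_lt_trans (ler_normD _ _) _; rewrite n1.
  have : m <= eta - `|y - x0| by rewrite /m ge_min lexx orbT.
  by move: cv; lra.
rewrite subrr sub0r normrN normrM gtr0_norm// => h.
rewrite -(ler_pM2l c0); apply: le_trans h _; rewrite le_eqVlt; apply/orP; left; apply/eqP.
by ring.
Qed.

End FromDefs.

(** * A smooth function on X comparable to the p-th power of the norm *)

Section Annular.
Variables (R : realType) (X : normedModType R).
Local Notation nrm := (fun x : X => `|x|).
Local Notation PNn := (PN nrm).

Lemma PN_scale (c : R) (s : seq X) : 0 <= c ->
  PNn (map ( *:%R c) s) = c ^+ size s * PNn s.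
Proof.
move=> c0; elim: s => [|v s IH]; first by rewrite /PN !big_nil mulr1.
by rewrite /= !PN_cons IH normrZ ger0_norm// exprS; ring.
Qed.

Lemma map_scale_cat (c : R) (s1 s2 : seq X) a v w :
  map ( *:%R c) (s1 ++ (a *: v + w) :: s2) =
  map ( *:%R c) s1 ++ (a *: (c *: v) + c *: w) :: map ( *:%R c) s2.
Proof. by rewrite map_cat /= scalerDr !scalerA mulrC. Qed.

Lemma mlin_scale n (D : X -> seq X -> R) c x : mlin setT n (D (c *: x)) ->
  mlin setT n (fun s => D (c *: x) (map ( *:%R c) s)).
Proof.
move=> l s1 s2 a v w _ _ _ _ sn; rewrite map_scale_cat l ?size_map//.
by rewrite !map_cat.
Qed.

Lemma Hol_scale n al K D (c : R) : 0 < c -> 0 < al ->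
  Hol setT nrm n al setT K D ->
  exists K', Hol setT nrm n al setT K' (fun x s => D (c *: x) (map ( *:%R c) s)).
Proof.
move=> c0 al0 [K0 l b re h]; pose c1 := c `^ al.
have c10 : 0 < c1 by apply: powR_gt0.
exists (K * (1 + c * c1 + c1) * (1 + c) ^+ n).
have c1n : 1 <= (1 + c) ^+ n by rewrite exprn_ege1// lerDl ltW.
have cn k : (k <= n)%N -> c ^+ k <= (1 + c) ^+ n.
  move=> kn; apply: (@le_trans _ _ ((1 + c) ^+ k)).
    by rewrite lerXn2r ?nnegrE ?addr_ge0 ?(ltW c0)// lerDr.
  by rewrite ler_weXn2l// lerDl ltW.
have ck k : 0 <= c ^+ k by rewrite exprn_ge0// ltW.
have i1 : 0 <= c * c1 by rewrite mulr_ge0// ltW.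
have P0 s : 0 <= PNn s by apply: PN_ge0.
split.
- rewrite !mulr_ge0 ?exprn_ge0 ?addr_ge0// ltW//.
- by move=> x _; apply: mlin_scale; apply: l.
- move=> x s _ _ sn; apply: le_trans (b _ _ I _ _) _; [by []|by rewrite size_map|].
  rewrite (PN_scale _ (ltW c0)) mulrA ler_wpM2r// ler_pM ?cn//.
  by rewrite -[leLHS]mulr1 ler_wpM2l//; lra.
- move=> x y s _ _ _ sn; have E : c *: y - c *: x = c *: (y - x) by rewrite scalerBr.
  have := re (c *: x) (c *: y) (map ( *:%R c) s) I I; rewrite size_map E => /(_ _ sn) /=.
  move=> /(_ (fun _ _ => I)) h1; apply: le_trans h1 _.
  rewrite (PN_scale _ (ltW c0)) normrZ gtr0_norm// powRM ?(ltW c0) ?normr_ge0// -/c1.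
  have t0 : 0 <= `|y - x| * `|y - x| `^ al by rewrite mulr_ge0// powR_ge0.
  rewrite (_ : _ * _ = K * (c * c1) * c ^+ size s * ((`|y - x| * `|y - x| `^ al) * PNn s)); last by ring.
  rewrite -[leRHS]mulrA ler_wpM2r ?mulr_ge0// ler_pM ?(mulr_ge0 K0 i1) ?(cn _ (ltnW sn))//.
  by rewrite ler_wpM2l//; lra.
- move=> x y s _ _ _ sn; have E : c *: y - c *: x = c *: (y - x) by rewrite scalerBr.
  have := h (c *: x) (c *: y) (map ( *:%R c) s) I I; rewrite size_map E => /(_ _ sn) /=.
  move=> /(_ (fun _ _ => I)) h1; apply: le_trans h1 _.
  rewrite (PN_scale _ (ltW c0)) normrZ gtr0_norm// powRM ?(ltW c0) ?normr_ge0// -/c1.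
  rewrite (_ : _ * _ = K * c1 * c ^+ size s * (`|y - x| `^ al * PNn s)); last by ring.
  rewrite -[leRHS]mulrA ler_wpM2r ?mulr_ge0 ?powR_ge0// ler_pM ?mulr_ge0 ?cn ?sn//.
    exact: ltW.
  by rewrite ler_wpM2l//; lra.
Qed.

Variables (r : R).
Hypothesis r1 : 1 < r.

Lemma uniform_bump_Hol : (exists g : X -> R, is_bump setT nrm g /\ uniformly_Hs_smooth setT nrm r g) ->
  exists (n : nat) (K : R) (D : X -> seq X -> R) (rho : R), [/\
    n%:R < r, r <= n.+1%:R,
    Hol setT nrm n (r - n%:R) setT K D,
    D 0 [::] = 1 & 1 <= rho /\ forall x, rho <= `|x| -> D x [::] = 0].
Proof.
move=> [g [[[x1 [_ gx1]] [B gB]] [n [nr rn [D [HD [M HM]]]]]]].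
have al01 : 0 < r - n%:R <= 1.
  by rewrite subr_gt0 nr lerBlDl (le_trans rn)// -natr1.
have [D0 _ _ _] := HD.
have far : exists C0 L, forall x : X, setT x -> exists2 x0, setT x0 & `|x - x0| <= L /\
     forall s, (size s <= n)%N -> `|lD D x0 s| <= C0 * PNn s.
  (* A trivial [X] has no point off the support; there the origin is its own reference point. *)
  have [[e e0]|triv] := pselect (exists e : X, e != 0).
    (* The margin 2 keeps the unit ball around any point of norm at least [B'] off the support. *)
    pose B' := `|B| + 2; have B'0 : 0 < B' by rewrite ltr_wpDl.
    have van x0 s : B' <= `|x0| -> (size s <= n)%N -> lD D x0 s = 0.
      move=> x0B sn; apply: (@lD_vanish _ _ n g D HD x0 1 ltr01) => //; last first.
        by rewrite subrr normr0.
      move=> y yx; apply/eqP; apply/negP => /negP /(gB y I) yB.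
      have := ler_normD (x0 - y) y; rewrite subrK distrC.
      move: x0B yx yB (ler_norm B); rewrite /B'; lra.
    exists 0, (2 * B') => x _; have [xB|xB] := leP B' `|x|.
      exists x => //; rewrite subrr normr0; split=> [|s sn]; first by rewrite mulr_ge0 ?ltW.
      by rewrite van// normr0 mul0r.
    have ne : `|(B' / `|e|) *: e| = B'.
      rewrite normrZ ger0_norm; last by rewrite divr_ge0// ltW.
      by rewrite divfK// normr_eq0.
    exists ((B' / `|e|) *: e) => //; split.
      by apply: le_trans (ler_normB _ _) _; rewrite ne; lra.
    by move=> s sn; rewrite van ?ne// normr0 mul0r.
  have [K HK] := lD_bound_at HD 0; exists K, 0 => x _; exists 0 => //; split=> //.
  have -> : x = 0 by apply: contrapT => /eqP x0; apply: triv; exists x.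
  by rewrite subrr normr0.
have [C0 [L H0]] := far.
have [|K HK] := @Cn_derivs_Hol R X n g D HD setT (r - n%:R) M L C0 al01 (fun _ _ _ _ _ _ => I) _ H0.
  move=> x y s _ _ sn; rewrite !(lDE _ _ sn) -(prodN_nth sn).
  exact: HM.
(* Translation by [x1] and multiplication by [1 / g x1], written as a combination with second
   coefficient 0, normalise the bump to value 1 at the origin. *)
have H1 := Hol_translate x1 HK.
have H2 := Hol_comb (g x1)^-1 0 H1 H1.
exists n, (`|(g x1)^-1| * K + `|0 : R| * K), (fun (x : X) s => (g x1)^-1 * lD D (x + x1) s + 0 * lD D (x + x1) s),
  (`|B| + `|x1| + 1); split=> //.
- by rewrite mul0r addr0 add0r /lD D0// mulVf.
- split; first by rewrite lerDr addr_ge0.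
  move=> x xB; rewrite mul0r addr0 /lD D0//.
  have -> : g (x + x1) = 0; last by rewrite mulr0.
  apply/eqP; apply/negP => /negP /(gB _ I) yB.
  have := ler_normD (x + x1) (- x1); rewrite addrK normrN.
  move: xB yB (ler_norm B); lra.
Qed.

(* With [beta] normalised by [beta 0 = 1], the positive part of [beta (x / lam) - beta x - 1 / 2] vanishes near [0] (where both values are close to [1]) and far away (where both vanish), and is at least [1 / 4] in between. *)
Lemma annular_bump : (exists g : X -> R, is_bump setT nrm g /\ uniformly_Hs_smooth setT nrm r g) ->
  exists (n : nat) (K : R) (D : X -> seq X -> R) (rho dl R0 c0 : R), [/\
    n%:R < r, r <= n.+1%:R,
    Hol setT nrm n (r - n%:R) setT K D &
    [/\ [/\ 0 < rho, 0 < dl, 0 < R0 & 0 < c0],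
    forall x s, D x s != 0 -> dl <= `|x| <= R0,
    forall x, 0 <= D x [::] &
    forall x, rho <= `|x| <= 2 * rho -> c0 <= D x [::] ]].
Proof.
move=> /uniform_bump_Hol[n [K [D [rho [nr rn HD D01 [rho1 Dfar]]]]]].
have al01 : 0 < r - n%:R <= 1.
  by rewrite subr_gt0 nr lerBlDl (le_trans rn)// -natr1.
have [al0 al1] := andP al01.
have n0 : (0 < n)%N by rewrite lt0n; apply: contraTneq rn => ->; rewrite -ltNge.
have K0 := Hol_ge0 HD.
(* Chosen so that [2 * K * dl <= 1 / 4], where [2 * K] is a Lipschitz constant at 0 within the unit
   ball. *)
pose dl := (8 * K + 1)^-1.
have k8 : 0 < 8 * K + 1 by rewrite ltr_wpDl ?mulr_ge0.
have dl0 : 0 < dl by rewrite invr_gt0.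
have dl1 : dl <= 1 by rewrite invf_le1// lerDr mulr_ge0.
have Dnear x : `|x| <= dl -> `|D x [::] - 1| <= 1 / 4.
  move=> xd; have := @Hol_cont _ _ _ _ _ _ (fun x => normr_ge0 x) (fun _ _ _ _ => I) al01
    _ _ _ 0 x [::] (fun _ _ => I) HD I I (fun _ _ => I) n0.
  rewrite D01 subr0 /PN big_nil mulr1 => /(_ (le_trans xd dl1)) h; apply: le_trans h _.
  apply: (@le_trans _ _ (2 * K * dl)); first by rewrite ler_wpM2l// mulr_ge0.
  by rewrite /dl ler_pdivrMr//; lra.
(* Scaling by [1 / lam] takes the ball of radius [2 * rho] onto that of radius [dl]: the dilated
   copy is still close to 1 where [D] has already vanished. *)
pose lam := 2 * rho / dl.
have rho0 : 0 < rho by apply: lt_le_trans rho1.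
have lam1 : 1 <= lam by rewrite /lam ler_pdivlMr// mul1r; lra.
have lam0 : 0 < lam by apply: lt_le_trans lam1.
have li0 : 0 < lam^-1 by rewrite invr_gt0.
have [K1 H1] := Hol_scale li0 al0 HD.
have H2 := Hol_comb 1 1 (Hol_comb 1 (-1) H1 HD) (@Hol_const _ _ setT nrm n (r - n%:R) (fun x => normr_ge0 x) setT (- (1 / 2))).
set D1 := (X in Hol _ _ _ _ _ _ X) in H2; set K2 := (X in Hol _ _ _ _ _ X _) in H2.
have E x : D1 x [::] = D (lam^-1 *: x) [::] - D x [::] - 1 / 2.
  by rewrite /D1 /= !mul1r mulN1r.
have [K3 H3] := @Hol_comp _ _ setT nrm n (r - n%:R) (fun x => normr_ge0 x) (normr0 _) I
  (fun _ _ _ _ => I) al01 n0 (@ptau R n.+2) (@ptau_smooth R n) setT K2 D1 (fun _ _ => I) H2.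
have nl x : `|lam^-1 *: x| = lam^-1 * `|x| by rewrite normrZ gtr0_norm.
exists n, K3, (Dcomp (@ptau R n.+2) D1), rho, dl, (lam * rho), ((1 / 4) ^+ n.+2); split=> //; split.
- by split; [| |rewrite mulr_gt0|rewrite exprn_gt0// divr_gt0].
- move=> x s; apply: contraNT; rewrite negb_and -!ltNge => H.
  rewrite Dcomp_ptau_le0// E.
  case/orP: H => xd.
    have h1 := Dnear x (ltW xd).
    have h2 : `|D (lam^-1 *: x) [::] - 1| <= 1 / 4.
      apply: Dnear; rewrite nl; apply: le_trans (ltW xd).
      by rewrite ler_piMl// invf_le1.
    move: h1 h2; rewrite !ler_norml; lra.
  rewrite !Dfar; first by lra.
    by apply: le_trans (ltW xd); rewrite ler_peMl// ltW.
  by rewrite nl ler_pdivlMl// ltW.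
- move=> x; rewrite Dcomp_ptau_nil /ppow; case: ifP => // h.
  by rewrite exprn_ge0// ltW.
- move=> x /andP[x1 x2]; rewrite Dcomp_ptau_nil E (Dfar x)// subr0.
  have h2 : `|D (lam^-1 *: x) [::] - 1| <= 1 / 4.
    apply: Dnear; rewrite nl ler_pdivrMl//; apply: le_trans x2 _.
    by rewrite /lam divfK// gt_eqF.
  have h3 : 1 / 4 <= D (lam^-1 *: x) [::] - 1 / 2 by move: h2; rewrite ler_norml; lra.
  rewrite /ppow ifT; last by apply: lt_le_trans h3.
  by apply: lerXn2r => //; rewrite nnegrE//; apply: le_trans h3.
Qed.

End Annular.

(** Makes a sum over all integers with finite support independent of the finite window that computes
    it. *)
Lemma big_seq_support (R : nmodType) (I : eqType) (r1 r2 : seq I) (F : I -> R) :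
  uniq r1 -> uniq r2 -> (forall i, F i != 0 -> i \in r1) -> (forall i, F i != 0 -> i \in r2) ->
  \sum_(i <- r1) F i = \sum_(i <- r2) F i.
Proof.
have aux r : \sum_(i <- r) F i = \sum_(i <- [seq j <- r | F j != 0]) F i.
  rewrite big_filter [LHS](bigID (fun j => F j != 0)) /= [X in _ + X]big1 ?addr0//.
  by move=> i; rewrite negbK => /eqP.
move=> u1 u2 h1 h2; rewrite aux [RHS]aux; apply: perm_big; apply: uniq_perm.
- exact: filter_uniq.
- exact: filter_uniq.
move=> i; rewrite !mem_filter; case: (boolP (F i != 0)) => //= Fi.
by rewrite (h1 _ Fi) (h2 _ Fi).
Qed.

Lemma dyadic_scale (R : realType) (a : R) : 0 < a -> exists k : int, 2 ^ k <= a < 2 ^ (k + 1).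
Proof.
move=> a0; have l2 : 0 < ln (2 : R) by rewrite ln_gt0// ltr1n.
have q (k : int) : (2 : R) ^ k = expR (k%:~R * ln 2).
  by rewrite -powR_intmul// /powR ifF// pnatr_eq0.
exists (Num.floor (ln a / ln 2)).
have := Num.Theory.floor_itv (ln a / ln 2) => /andP[h1 h2].
rewrite !q -{2 3}(lnK (x := a)) ?posrE// ler_expR ltr_expR.
by rewrite -ler_pdivlMr// h1 -ltr_pdivrMr.
Qed.

(** * Dyadic superposition of an annular bump *)

Section Growth.
Variables (R : realType) (X : normedModType R).
Local Notation nrm := (fun x : X => `|x|).
Local Notation PNn := (PN nrm).

(* Satisfied by a function which behaves like a smooth [p]-homogeneous one: the constants of [Hol] are replaced by powers of the norm making both sides homogeneous of degree [p]. *)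
Record growth (n : nat) (al p C c : R) (D : X -> seq X -> R) : Prop := MkGrowth {
  gr_lin : forall x, mlin setT n (D x);
  gr_bound : forall x s, (size s <= n)%N ->
    `|D x s| <= C * `|x| `^ (p - (size s)%:R) * PNn s;
  gr_rem : forall x y s, (size s < n)%N ->
    `|D y s - D x s - D x (y - x :: s)| <=
      C * (`|x| + `|y|) `^ (p - (size s).+1%:R - al) * (`|y - x| * `|y - x| `^ al) * PNn s;
  gr_hol : forall x y s, size s = n ->
    `|D y s - D x s| <= C * (`|x| + `|y|) `^ (p - n%:R - al) * `|y - x| `^ al * PNn s;
  gr_low : forall x, c * `|x| `^ p <= D x [::] }.

Variables (n : nat) (al p K rho dl R0 c0 : R) (D0 : X -> seq X -> R).
Hypothesis al01 : 0 < al <= 1.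
Hypothesis np : n%:R + al <= p.
Hypothesis HD0 : Hol setT nrm n al setT K D0.
Hypotheses (rho0 : 0 < rho) (dl0 : 0 < dl) (R00 : 0 < R0) (c00 : 0 < c0).
Hypothesis supp : forall x s, D0 x s != 0 -> dl <= `|x| <= R0.
Hypothesis nonneg : forall x, 0 <= D0 x [::].
Hypothesis low : forall x, rho <= `|x| <= 2 * rho -> c0 <= D0 x [::].

Let q (k : int) : R := 2 ^ k.

Let q0 k : 0 < q k. Proof. by rewrite exprz_gt0. Qed.

Definition piece (k : int) (x : X) (s : seq X) : R :=
  q k `^ p * D0 ((q k)^-1 *: x) (map ( *:%R (q k)^-1) s).

Let qi0 k : 0 <= (q k)^-1. Proof. by rewrite invr_ge0 ltW. Qed.

Let nq k (x : X) : `|(q k)^-1 *: x| = (q k)^-1 * `|x|.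
Proof. by rewrite normrZ ger0_norm. Qed.

Let powq k (a b : R) : q k `^ (a - b) = q k `^ a * q k `^ (- b).
Proof. by rewrite powRD// (gt_eqF (q0 k)) implybT. Qed.

Let powqn k j : (q k)^-1 ^+ j = q k `^ (- j%:R).
Proof. by rewrite powR_invn ?ltW// exprVn. Qed.

Let powqa k : (q k)^-1 `^ al = q k `^ (- al).
Proof. by rewrite -powR_inv1 ?ltW// -powRrM mulN1r. Qed.

Let powq1 k : (q k)^-1 = q k `^ (- 1).
Proof. by rewrite powR_inv1 ?ltW. Qed.

Let piece_lin k x : mlin setT n (piece k x).
Proof.
move=> s1 s2 a v w S1 S2 Sv Sw sn; rewrite /piece.
have := @mlin_scale _ _ n D0 (q k)^-1 x (Hol_lin HD0 I) s1 s2 a v w S1 S2 Sv Sw sn.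
by move=> /= ->; ring.
Qed.

Let piece_bound k x s : (size s <= n)%N ->
  `|piece k x s| <= K * q k `^ (p - (size s)%:R) * PNn s.
Proof.
move=> sn; rewrite /piece normrM ger0_norm ?powR_ge0//.
have := Hol_bound HD0 (x := (q k)^-1 *: x) (s := map ( *:%R (q k)^-1) s) I (fun _ _ => I).
rewrite size_map => /(_ sn) h.
apply: le_trans (ler_wpM2l (powR_ge0 _ _) h) _.
by rewrite PN_scale// powqn powq le_eqVlt; apply/orP; left; apply/eqP; ring.
Qed.

Let piece_rem k x y s : (size s < n)%N ->
  `|piece k y s - piece k x s - piece k x (y - x :: s)| <=
     K * q k `^ (p - (size s).+1%:R - al) * (`|y - x| * `|y - x| `^ al) * PNn s.
Proof.
move=> sn; rewrite /piece -!mulrBr normrM ger0_norm ?powR_ge0//.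
have := Hol_rem HD0 (x := (q k)^-1 *: x) (y := (q k)^-1 *: y) (s := map ( *:%R (q k)^-1) s) I I (fun _ _ => I).
rewrite size_map -scalerBr => /(_ sn) h.
apply: le_trans (ler_wpM2l (powR_ge0 _ _) h) _.
rewrite PN_scale// powqn nq powRM// powqa.
have -> : p - (size s).+1%:R - al = p - (size s)%:R - 1 - al by rewrite -natr1; ring.
rewrite !powq -powq1 le_eqVlt; apply/orP; left; apply/eqP; ring.
Qed.

Let piece_hol k x y s : size s = n ->
  `|piece k y s - piece k x s| <= K * q k `^ (p - n%:R - al) * `|y - x| `^ al * PNn s.
Proof.
move=> sn; rewrite /piece -!mulrBr normrM ger0_norm ?powR_ge0//.
have := Hol_hol HD0 (x := (q k)^-1 *: x) (y := (q k)^-1 *: y) (s := map ( *:%R (q k)^-1) s) I I (fun _ _ => I).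
rewrite size_map -scalerBr => /(_ sn) h.
apply: le_trans (ler_wpM2l (powR_ge0 _ _) h) _.
rewrite PN_scale// powqn nq powRM// powqa sn.
rewrite !powq le_eqVlt; apply/orP; left; apply/eqP; ring.
Qed.

Let piece_supp k x s : piece k x s != 0 -> dl * q k <= `|x| <= R0 * q k.
Proof.
rewrite /piece mulf_eq0 negb_or => /andP[_ /supp].
by rewrite nq mulrC ler_pdivlMr// ler_pdivrMr.
Qed.

(** The lowest scale that can contribute near [x]: [|y| >= |x| / 2] and [|y| <= R0 * 2 ^ k] force
    [2 ^ k >= |x| / (2 * R0)]. The default 0 concerns only [x = 0], where all pieces vanish. *)
Definition kap (x : X) : int :=
  xget 0 [set k : int | q k <= `|x| / (2 * R0) < q (k + 1)].

Let kapP x : x != 0 -> q (kap x) <= `|x| / (2 * R0) < q (kap x + 1).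
Proof.
move=> x0; have : 0 < `|x| / (2 * R0) by rewrite divr_gt0 ?mulr_gt0// normr_gt0.
by move=> /dyadic_scale[k hk]; rewrite /kap; case: xgetP => [j -> //|/(_ k)].
Qed.

(** Bounds the number of scales: [dl * 2 ^ k <= |y| <= 3 / 2 * |x|] and [|x| < 4 * R0 * 2 ^ kap x]
    give [2 ^ (k - kap x) < 6 * R0 / dl]. *)
Definition wlen : nat := `|Num.ceil (6 * R0 / dl)|%N.

Let wlenP : 6 * R0 / dl <= 2 ^+ wlen.
Proof.
have a0 : 0 <= 6 * R0 / dl by rewrite divr_ge0 ?mulr_ge0// ltW.
apply: (@le_trans _ _ wlen%:R).
  apply: le_trans (Num.Theory.ceil_ge _) _; rewrite /wlen.
  by rewrite natr_absz ger0_norm// Num.Theory.ceil_ge0// (lt_le_trans _ a0)// ltrN10.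
by rewrite -natrX ler_nat ltnW// ltn_expl.
Qed.

Definition win (k : int) : seq int := [seq k + (j%:Z)%R | j <- iota 0 wlen].

Let uniq_win k : uniq (win k).
Proof. by rewrite map_inj_uniq ?iota_uniq// => i j /addrI []. Qed.

Let mem_win k i : k <= i -> i < k + wlen%:Z -> i \in win k.
Proof.
move=> ki ik; apply/mapP; exists `|i - k|%N; last by lia.
by rewrite mem_iota; lia.
Qed.

Let q_mono i j : (q i < q j) = (i < j).
Proof. by rewrite /q ltr_eXz2l ?ltr1n. Qed.

Let near_win x y k s : x != 0 -> `|y - x| <= `|x| / 2 -> piece k y s != 0 -> k \in win (kap x).
Proof.
move=> x0 xy /piece_supp /andP[h1 h2]; have /andP[k1 k2] := kapP x0.
have y1 : `|x| / 2 <= `|y|.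
  by have := ler_normB y (y - x); rewrite opprB addrCA subrr addr0; lra.
have y2 : `|y| <= 3 / 2 * `|x|.
  by have := ler_normD x (y - x); rewrite addrCA subrr addr0; lra.
have R2 : 0 < 2 * R0 by rewrite mulr_gt0.
rewrite ler_pdivlMr// in k1; rewrite ltr_pdivrMr// in k2.
have qS i : q (i + 1) = 2 * q i by rewrite /q exprzDr ?unitfE ?pnatr_eq0// expr1z mulrC.
apply: mem_win.
  rewrite -ltzD1 -q_mono qS -(ltr_pM2l R00).
  apply: (@lt_le_trans _ _ (2 * (R0 * q k))); last by lra.
  apply: (@le_lt_trans _ _ (R0 * q k)); last by have := mulr_gt0 R00 (q0 k); lra.
  lra.
rewrite -q_mono /q exprzDr ?unitfE ?pnatr_eq0// -/(q _) -exprnP.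
apply: (@lt_le_trans _ _ (q (kap x) * (6 * R0 / dl))); last by rewrite ler_wpM2l// ltW.
rewrite mulrA ltr_pdivlMr// mulrC.
rewrite qS in k2.
lra.
Qed.

(* [\sum_k 2 ^ (k p) f (2 ^ - k x)] over all integers [k], for an annular bump [f]: at [x] only the scales in [win (kap x)] contribute, and the same window serves all [y] with [|y - x| <= |x| / 2]. *)
Definition dsum (x : X) (s : seq X) : R := \sum_(k <- win (kap x)) piece k x s.

Let dsum_near x y s : x != 0 -> `|y - x| <= `|x| / 2 ->
  dsum y s = \sum_(k <- win (kap x)) piece k y s.
Proof.
move=> x0 xy; have y0 : y != 0.
  apply: contraTneq xy => ->; rewrite sub0r normrN -ltNge ltr_pdivrMr// ltr_pMr ?normr_gt0//.
  by rewrite ltr1n.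
apply: big_seq_support => // k ky; [apply: (near_win y0 _ ky)|exact: near_win ky].
by rewrite subrr normr0 divr_ge0.
Qed.

Let dsum0 s : dsum 0 s = 0.
Proof.
rewrite /dsum big1// => k _; apply/eqP; apply: contraT => /piece_supp /andP[].
by rewrite normr0 => h; have := mulr_gt0 dl0 (q0 k); lra.
Qed.

(** All scales of the window satisfy [2 ^ k <= A * |x|]; the base [1 + A] in [C1] lets the single
    exponent [p] dominate all exponents in [[0, p]]. *)
Let A : R := 2 ^+ wlen / (2 * R0).

Let A0 : 0 < A. Proof. by rewrite divr_gt0 ?mulr_gt0// exprn_gt0. Qed.

Let C1 : R := wlen%:R * K * (1 + A) `^ p.

Let C10 : 0 <= C1.
Proof. by rewrite !mulr_ge0 ?powR_ge0// (Hol_ge0 HD0). Qed.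

Let win_sum x (e Z : R) (F : int -> R) : x != 0 -> 0 <= Z -> 0 <= e <= p ->
  (forall k, `|F k| <= K * q k `^ e * Z) ->
  `|\sum_(k <- win (kap x)) F k| <= C1 * `|x| `^ e * Z.
Proof.
move=> x0 Z0 /andP[e0 ep] HF; have /andP[k1 _] := kapP x0; have K0 := Hol_ge0 HD0.
apply: le_trans (ler_norm_sum _ _ _) _.
have H k : k \in win (kap x) -> `|F k| <= K * ((1 + A) `^ p * `|x| `^ e) * Z.
  move=> /mapP[j]; rewrite mem_iota add0n /= => jw ->.
  apply: le_trans (HF _) _; rewrite ler_wpM2r// ler_wpM2l//.
  have qA : q (kap x + j%:Z) <= (1 + A) * `|x|.
    rewrite /q exprzDr ?unitfE ?pnatr_eq0// -/(q _) -exprnP.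
    apply: (@le_trans _ _ (`|x| / (2 * R0) * 2 ^+ wlen)).
      by rewrite ler_pM ?exprn_ge0 ?(ltW (q0 _))// ler_weXn2l ?ler1n// ltnW.
    rewrite (_ : `|x| / (2 * R0) * 2 ^+ wlen = A * `|x|); last first.
      by rewrite /A; set i := (_ * R0)^-1; ring.
    by rewrite ler_wpM2r// lerDr.
  apply: le_trans (powR_le_mono e0 (ltW (q0 _)) qA) _.
  rewrite powRM ?addr_ge0 ?(ltW A0)// ler_wpM2r ?powR_ge0// ler_powR// lerDl ltW//.
rewrite big_seq; apply: le_trans (ler_sum _ H) _.
rewrite -big_seq big_const_seq count_predT iter_addr_0 size_map size_iota.
by rewrite -mulr_natr /C1 le_eqVlt; apply/orP; left; apply/eqP; ring.
Qed.

Let al0 : 0 < al. Proof. by case/andP: al01. Qed.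
Let al1 : al <= 1. Proof. by case/andP: al01. Qed.

Let jp j : (j <= n)%N -> 0 < p - j%:R /\ p - j%:R <= p.
Proof.
move=> jn; have : (j%:R : R) <= n%:R by rewrite ler_nat.
by have := ler0n R j; move: np al0; lra.
Qed.

Let dsum_bound x s : (size s <= n)%N -> `|dsum x s| <= C1 * `|x| `^ (p - (size s)%:R) * PNn s.
Proof.
move=> sn; have [->|x0] := eqVneq x 0.
  rewrite dsum0 normr0; apply: mulr_ge0; last exact: PN_ge0.
  by apply: mulr_ge0 => //; exact: powR_ge0.
apply: win_sum => //; first exact: PN_ge0.
- by have [h1 h2] := jp sn; rewrite ltW.
- by move=> k; apply: piece_bound.
Qed.

(** For distant points [t] is comparable to [m = |x| + |y|], so part of the homogeneity can be
    traded for the Hoelder factor in [t]. *)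
Let far_pow (m t e : R) : 0 < t -> t <= m -> m <= 5 * t -> 0 <= e ->
  m `^ (e + al) <= 5 * (m `^ e * t `^ al).
Proof.
move=> t0 tm m5 e0; have m0 : 0 < m by apply: lt_le_trans tm.
rewrite powRD ?(gt_eqF m0) ?implybT// mulrCA ler_wpM2l ?powR_ge0//.
apply: le_trans (powR_le_mono (ltW al0) (ltW m0) m5) _.
rewrite powRM ?(ltW t0)// ler_wpM2r ?powR_ge0//.
by rewrite ler1_powR// ler1n.
Qed.

(** If [|y - x| <= |x| / 2], both points share a window and the estimates hold piece by piece.
    Otherwise [|y - x|] is comparable to [|x| + |y|], and bounding the three terms suffices:
    [55 = 25 + 25 + 5]. For the lower bound, some scale puts [x] into the annulus where [D0 >= c0],
    and the other pieces are nonnegative. *)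
Lemma dsum_growth : growth n al p (55 * C1) (c0 * (2 * rho) `^ (- p)) dsum.
Proof.
have P0 s : 0 <= PNn s by apply: PN_ge0.
have C155 : C1 <= 55 * C1 by move: C10; lra.
have C550 : 0 <= 55 * C1 by move: C10; lra.
split.
- move=> x s1 s2 a v w S1 S2 Sv Sw sn; rewrite /dsum mulr_sumr -big_split.
  by apply: eq_bigr => k _; rewrite piece_lin.
- move=> x s sn; apply: le_trans (dsum_bound x sn) _.
  by rewrite !ler_wpM2r ?powR_ge0.
- move=> x y s sn; set t := `|y - x|; set m := `|x| + `|y|.
  set e := p - (size s).+1%:R - al.
  have e0 : 0 <= e.
    have : ((size s).+1%:R : R) <= n%:R by rewrite ler_nat.
    by rewrite /e; move: np; lra.
  have ep : e <= p by have := ler0n R (size s).+1; rewrite /e; move: (ltW al0); lra.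
  have t0 : 0 <= t by exact: normr_ge0.
  have T0 : 0 <= t * t `^ al by rewrite mulr_ge0// powR_ge0.
  have xm : `|x| <= m by rewrite lerDl.
  have ym : `|y| <= m by rewrite lerDr.
  have [xy|xy] := leP t (`|x| / 2).
    have [x0|x0] := eqVneq x 0.
      have y0 : y = 0.
        by apply/eqP; move: xy; rewrite /t x0 normr0 mul0r subr0 normr_le0.
      have h := mulr_ge0 (mulr_ge0 (mulr_ge0 C550 (powR_ge0 m e)) T0) (P0 s).
      by rewrite x0 y0 !dsum0 !subr0 normr0; exact: h.
    rewrite !(dsum_near _ x0 xy) !(dsum_near (y := x) _ x0) ?subrr ?normr0 ?divr_ge0//.
    rewrite -!sumrB.
    apply: (@le_trans _ _ (C1 * `|x| `^ e * ((t * t `^ al) * PNn s))).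
      apply: win_sum => //; [by rewrite mulr_ge0|by rewrite e0|].
      by move=> k; apply: le_trans (piece_rem _ _ _ sn) _; rewrite [leRHS]mulrA.
    rewrite mulrA ler_wpM2r// ler_wpM2r// ler_pM ?powR_ge0// powR_le_mono//.
  have tp : 0 < t by apply: le_lt_trans xy; rewrite divr_ge0.
  have yt : `|y| <= 3 * t by have := ler_normD x (y - x); rewrite addrCA subrr addr0 -/t; lra.
  have m5 : m <= 5 * t by rewrite /m; lra.
  have tm : t <= m by rewrite /t /m (le_trans (ler_normB _ _))// addrC.
  have m0 : 0 < m by apply: lt_le_trans tm.
  have F := far_pow tp tm m5 e0.
  have pe1 : p - (size s).+1%:R = e + al by rewrite /e; ring.
  have pe2 : p - (size s)%:R = (e + al) + 1 by rewrite /e -natr1; ring.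
  have B1 z : `|z| <= m -> `|dsum z s| <= C1 * (25 * (m `^ e * (t * t `^ al))) * PNn s.
    move=> zm; apply: le_trans (dsum_bound z (ltnW sn)) _; rewrite ler_wpM2r// ler_wpM2l// pe2.
    apply: le_trans (powR_le_mono _ (normr_ge0 z) zm) _.
      by move: e0 al0; lra.
    rewrite powRD ?(gt_eqF m0) ?implybT// powRr1 ?(ltW m0)//.
    rewrite (_ : 25 * _ = 5 * (m `^ e * t `^ al) * (5 * t)); last by ring.
    by rewrite ler_pM ?powR_ge0 ?(ltW m0).
  have B2 : `|dsum x (y - x :: s)| <= C1 * (5 * (m `^ e * (t * t `^ al))) * PNn s.
    apply: le_trans (dsum_bound x (s := y - x :: s) sn) _.
    rewrite PN_cons /= -/t pe1.
    rewrite (_ : C1 * (5 * _) * _ = C1 * (5 * (m `^ e * t `^ al)) * (t * PNn s)); last by ring.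
    rewrite ler_wpM2r ?mulr_ge0// ler_wpM2l//; apply: le_trans F.
    by apply: powR_le_mono => //; rewrite addr_ge0// ltW.
  have := B1 x xm; have := B1 y ym; move: B2.
  have := ler_normB (dsum y s - dsum x s) (dsum x (y - x :: s)).
  have := ler_normB (dsum y s) (dsum x s).
  lra.
- move=> x y s sn; set t := `|y - x|; set m := `|x| + `|y|.
  set e := p - n%:R - al.
  have e0 : 0 <= e by rewrite /e; move: np; lra.
  have ep : e <= p by have := ler0n R n; rewrite /e; move: (ltW al0); lra.
  have t0 : 0 <= t by exact: normr_ge0.
  have T0 : 0 <= t `^ al by rewrite powR_ge0.
  have xm : `|x| <= m by rewrite lerDl.
  have ym : `|y| <= m by rewrite lerDr.
  have [xy|xy] := leP t (`|x| / 2).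
    have [x0|x0] := eqVneq x 0.
      have y0 : y = 0.
        by apply/eqP; move: xy; rewrite /t x0 normr0 mul0r subr0 normr_le0.
      have h := mulr_ge0 (mulr_ge0 (mulr_ge0 C550 (powR_ge0 m e)) T0) (P0 s).
      by rewrite x0 y0 !dsum0 !subr0 normr0; exact: h.
    rewrite !(dsum_near _ x0 xy) !(dsum_near (y := x) _ x0) ?subrr ?normr0 ?divr_ge0//.
    rewrite -!sumrB.
    apply: (@le_trans _ _ (C1 * `|x| `^ e * (t `^ al * PNn s))).
      apply: win_sum => //; [by rewrite mulr_ge0|by rewrite e0|].
      by move=> k; apply: le_trans (piece_hol _ _ _ sn) _; rewrite [leRHS]mulrA.
    rewrite mulrA ler_wpM2r// ler_wpM2r// ler_pM ?powR_ge0// powR_le_mono//.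
  have tp : 0 < t by apply: le_lt_trans xy; rewrite divr_ge0.
  have yt : `|y| <= 3 * t by have := ler_normD x (y - x); rewrite addrCA subrr addr0 -/t; lra.
  have m5 : m <= 5 * t by rewrite /m; lra.
  have tm : t <= m by rewrite /t /m (le_trans (ler_normB _ _))// addrC.
  have F := far_pow tp tm m5 e0.
  have B1 z : `|z| <= m -> `|dsum z s| <= C1 * (5 * (m `^ e * t `^ al)) * PNn s.
    move=> zm; apply: le_trans (dsum_bound z (eq_leq sn)) _; rewrite ler_wpM2r// ler_wpM2l//.
    apply: le_trans F; rewrite sn (_ : p - n%:R = e + al); last by rewrite /e; ring.
    by apply: powR_le_mono => //; rewrite addr_ge0// ltW.
  have W : 0 <= C1 * (m `^ e * t `^ al) * PNn s.
    by apply: mulr_ge0 => //; apply: mulr_ge0 => //; rewrite mulr_ge0// powR_ge0.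
  have := B1 x xm; have := B1 y ym; move: W.
  have := ler_normB (dsum y s) (dsum x s).
  lra.
- move=> x; have p0 : 0 < p by have := ler0n R n; move: np al0; lra.
  have [->|x0] := eqVneq x 0.
    by rewrite dsum0 normr0 powR0 ?mulr0// gt_eqF.
  have nx : 0 < `|x| by rewrite normr_gt0.
  have [k /andP[k1 k2]] := dyadic_scale (divr_gt0 nx rho0).
  rewrite -!/(q _) in k1 k2.
  rewrite ler_pdivlMr// in k1; rewrite ltr_pdivrMr// in k2.
  have qS : q (k + 1) = 2 * q k by rewrite /q exprzDr ?unitfE ?pnatr_eq0// expr1z mulrC.
  rewrite qS in k2.
  have g : c0 <= D0 ((q k)^-1 *: x) [::].
    apply: low; rewrite nq mulrC ler_pdivlMr// ler_pdivrMr//.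
    by apply/andP; split; lra.
  have pk : c0 * (2 * rho) `^ (- p) * `|x| `^ p <= piece k x [::].
    have xq : (2 * rho) `^ (- p) * `|x| `^ p <= q k `^ p.
      rewrite powRN ler_pdivrMl ?powR_gt0 ?mulr_gt0//.
      rewrite -powRM ?mulr_ge0 ?(ltW rho0) ?(ltW (q0 k))//.
      by apply: powR_le_mono; rewrite ?(ltW p0)//; lra.
    by rewrite -mulrA mulrC /piece /= ler_pM ?(ltW c00)// mulr_ge0// powR_ge0.
  have kw : k \in win (kap x).
    apply: (near_win (y := x) (s := [::]) x0); first by rewrite subrr normr0 divr_ge0.
    by rewrite gt_eqF// (lt_le_trans _ pk)// !mulr_gt0 ?powR_gt0 ?mulr_gt0.
  apply: le_trans pk _; rewrite /dsum (bigD1_seq k)//= lerDl.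
  by apply: sumr_ge0 => i _; rewrite mulr_ge0 ?powR_ge0.
Qed.

End Growth.

(** * Integration of almost everywhere measurable functions *)

Section SimpleMaps.
Variables (d : measure_display) (T : measurableType d).

Definition simple_map (Y : Type) (f : T -> Y) :=
  finite_set (range f) /\ forall y, measurable (f @^-1` [set y]).

Lemma simple_map2 (Y1 Y2 Y3 : Type) (F : Y1 -> Y2 -> Y3) (f : T -> Y1) (g : T -> Y2) :
  simple_map f -> simple_map g -> simple_map (fun t => F (f t) (g t)).
Proof.
move=> [ff mf] [fg mg].
have fin : finite_set (range f `*` range g) by exact: finite_setX.
split.
  apply: (@sub_finite_set _ _ ((fun z : Y1 * Y2 => F z.1 z.2) @` (range f `*` range g))).
    by move=> _ [t _ <-]; exists (f t, g t) => //; split; exists t.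
  exact: finite_image.
move=> y.
have -> : (fun t => F (f t) (g t)) @^-1` [set y] =
    \bigcup_(z in (range f `*` range g) `&` [set z | F z.1 z.2 = y])
      (f @^-1` [set z.1] `&` g @^-1` [set z.2]).
  apply/seteqP; split=> t /=.
    by move=> <-; exists (f t, g t) => //; split=> //; split; exists t.
  by move=> [[a b] [_ <-] [/= -> ->]].
apply: fin_bigcup_measurable; first exact: finite_setIl.
by move=> z _; exact: measurableI.
Qed.

Lemma simple_map_cst (Y : Type) (y : Y) : simple_map (fun _ : T => y).
Proof.
split; first by apply: (@sub_finite_set _ _ [set y]) => [_ [t _ <-]|]; rewrite //=.
move=> z; have [->|yz] := pselect (y = z).
  by rewrite (_ : _ @^-1` _ = setT)//; apply/seteqP; split.
by rewrite (_ : _ @^-1` _ = set0)//; apply/seteqP; split.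
Qed.

Lemma simple_map1 (Y1 Y2 : Type) (F : Y1 -> Y2) (f : T -> Y1) :
  simple_map f -> simple_map (fun t => F (f t)).
Proof. move=> sf; exact: (simple_map2 (fun a (_ : unit) => F a) sf (simple_map_cst tt)). Qed.

Lemma simple_map_measurable (R : realType) (f : T -> R) :
  simple_map f -> measurable_fun setT f.
Proof.
move=> [ff mf] _ B mB; rewrite setTI.
have -> : f @^-1` B = \bigcup_(z in range f `&` B) (f @^-1` [set z]).
  apply/seteqP; split=> t /=; first by move=> Bt; exists (f t) => //; split=> //; exists t.
  by move=> [z [_ Bz] /= ->].
by apply: fin_bigcup_measurable => //; exact: finite_setIl.
Qed.

End SimpleMaps.

Section AeIntegral.
Variables (R : realType) (d : measure_display) (T : measurableType d).
Variable mu : {measure set T -> \bar R}.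
Implicit Types f g h : T -> R.

Definition aemeas f := exists g, measurable_fun setT g /\ {ae mu, forall t, f t = g t}.

Lemma aemeas_cvg (fm : nat -> T -> R) f : (forall m, measurable_fun setT (fm m)) ->
  {ae mu, forall t, (fun m => fm m t) @ \oo --> f t} -> aemeas f.
Proof.
move=> mfm [A [mA A0 hA]].
exists (fun t => f t * \1_(~` A) t); split.
  apply: (@measurable_fun_cvg _ _ _ _ (fun m t => fm m t * \1_(~` A) t)).
    move=> m; apply: measurable_funM => //; apply: measurable_indic; exact: measurableC.
  move=> t _; rewrite indicE; case: (boolP (t \in ~` A)) => tA /=; last first.
    rewrite mulr0; under eq_fun do rewrite mulr0; exact: cvg_cst.
  rewrite mulr1; under eq_fun do rewrite mulr1.
  by move: tA; rewrite inE; apply: contra_notP => tA; apply: hA.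
exists A; split=> // t /= h; apply: contrapT => tA; apply: h.
by rewrite indicE mem_set// mulr1.
Qed.

Lemma ae_eqT (Y : Type) (f g : T -> Y) : {ae mu, forall t, f t = g t} -> ae_eq mu setT f g.
Proof. by rewrite /ae_eq => fg; near=> t => _; near: t; exact: fg. Unshelve. all: by end_near. Qed.

(** Measurability is not assumed: the integral is a supremum over simple functions below [f], and
    such a function, cut off to 0 on the null set, lies below [g] without changing its integral. *)
Lemma le_ge0_integral_ae (f g : T -> \bar R) : (forall t, 0 <= f t)%E -> (forall t, 0 <= g t)%E ->
  {ae mu, forall t, f t = g t} -> (\int[mu]_t f t <= \int[mu]_t g t)%E.
Proof.
move=> f0 g0 [A [mA A0 hA]].
rewrite (ge0_integralTE mu f0); apply: ge_ereal_sup => _ [h hf <-].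
have mCA : measurable (~` A) by exact: measurableC.
pose h' := mul_nnsfun h (indic_nnsfun R mCA).
have -> : sintegral mu h = sintegral mu h'.
  rewrite -!integralT_nnsfun (ge0_negligible_integral mA measurableT _ _ A0)//; last 2 first.
  - by apply/measurable_EFinP.
  - by move=> t _; rewrite lee_fin.
  rewrite integral_mkcond; apply: eq_integral => t _.
  have -> : h' t = h t * \1_(~` A) t by [].
  rewrite patchE setTD indicE.
  by case: ifPn => tA; rewrite /= ?mulr1 ?mulr0.
rewrite (ge0_integralTE mu g0); apply: ereal_sup_ubound; exists h' => // t.
have -> : h' t = h t * \1_(~` A) t by [].
rewrite indicE; case: (boolP (t \in ~` A)) => tA /=; last by rewrite mulr0.
rewrite mulr1; apply: le_trans (hf t) _.
suff -> : f t = g t by [].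
by move: tA; rewrite inE; apply: contra_notP => tA; apply: hA.
Qed.

Lemma ge0_integral_ae (f g : T -> \bar R) : (forall t, 0 <= f t)%E -> (forall t, 0 <= g t)%E ->
  {ae mu, forall t, f t = g t} -> (\int[mu]_t f t = \int[mu]_t g t)%E.
Proof.
move=> f0 g0 fg; apply/eqP; rewrite eq_le !le_ge0_integral_ae//.
by apply: filterS fg => t ->.
Qed.

(* The Bochner classes are not taken modulo a.e. equality and [mu] need not be complete, so integrals are computed on measurable versions. *)
Definition mversion f : T -> R :=
  xget (fun=> 0) [set g | measurable_fun setT g /\ {ae mu, forall t, f t = g t}].

Definition aeint f := exists g, mu.-integrable setT (EFin \o g) /\ {ae mu, forall t, f t = g t}.

Definition Int f : R := fine (\int[mu]_t (mversion f t)%:E).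

Lemma mversionP f : aemeas f ->
  measurable_fun setT (mversion f) /\ {ae mu, forall t, f t = mversion f t}.
Proof. by move=> [g gP]; rewrite /mversion; case: xgetP => [h -> //|/(_ g)]. Qed.

Lemma aeint_meas f : aeint f -> aemeas f.
Proof. by move=> [g [/integrableP[/measurable_EFinP mg _] fg]]; exists g. Qed.

Lemma Int_eq f g : measurable_fun setT g -> {ae mu, forall t, f t = g t} ->
  Int f = fine (\int[mu]_t (g t)%:E).
Proof.
move=> mg fg; have [|mv fv] := @mversionP f; first by exists g.
congr fine; apply: ae_eq_integral => //; try exact/measurable_EFinP.
by apply: ae_eqT; apply: filterS2 fg fv => t -> ->.
Qed.

Lemma Int_int f : aeint f -> exists g, [/\ mu.-integrable setT (EFin \o g),
  {ae mu, forall t, f t = g t} & (\int[mu]_t (g t)%:E = (Int f)%:E)%E].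
Proof.
move=> [g [ig fg]]; exists g; split=> //.
have mg : measurable_fun setT g by case/integrableP: (ig) => /measurable_EFinP.
rewrite (Int_eq mg fg) fineK//; exact: integrable_fin_num.
Qed.

Lemma aeint_lin f g a : aeint f -> aeint g -> aeint (fun t => a * f t + g t) /\
  Int (fun t => a * f t + g t) = a * Int f + Int g.
Proof.
move=> /Int_int[f' [if' ff' If]] /Int_int[g' [ig gg' Ig]].
have ih : mu.-integrable setT (EFin \o (fun t => a * f' t + g' t)).
  rewrite (_ : _ \o _ = (fun t => a%:E * (f' t)%:E + (g' t)%:E)%E)//.
  by apply: integrableD => //; apply: integrableZl.
have e : {ae mu, forall t, a * f t + g t = a * f' t + g' t}.
  by apply: filterS2 ff' gg' => t -> ->.
split; first by exists (fun t => a * f' t + g' t).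
rewrite (Int_eq _ e); last by case/integrableP: (ih) => /measurable_EFinP.
under eq_integral do rewrite EFinD EFinM.
rewrite integralD//; last by apply: integrableZl.
by rewrite integralZl// If Ig.
Qed.

Lemma aeint_dom f h : aemeas f -> aeint h -> {ae mu, forall t, `|f t| <= h t} ->
  aeint f /\ `|Int f| <= Int h.
Proof.
move=> mf /Int_int[h' [ih hh' Ih]] fh; have [mv fv] := mversionP mf.
set v := mversion f in mv fv.
have mh : measurable_fun setT h' by case/integrableP: (ih) => /measurable_EFinP.
have vh : {ae mu, forall t, `|v t| <= h' t}.
  by apply: filterS3 fh fv hh' => t + <- <-.
have le : (\int[mu]_t `|(v t)%:E| <= \int[mu]_t `|(h' t)%:E|)%E.
  (* The bound by [h'] holds only a.e.; the maximum makes it hold everywhere without changing the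
     integral. *)
  have -> : (\int[mu]_t `|(h' t)%:E| = \int[mu]_t (Num.max `|h' t| `|v t|)%:E)%E.
    apply: ge0_ae_eq_integral; first exact: measurableT.
    - by apply/measurable_EFinP; apply: measurableT_comp.
    - by apply/measurable_EFinP; apply: measurable_maxr; apply: measurableT_comp.
    - by move=> t _; rewrite lee_fin.
    - by move=> t _; rewrite lee_fin le_max normr_ge0.
    by apply: ae_eqT; apply: filterS vh => t vt /=; rewrite max_l// (le_trans vt)// ler_norm.
  apply: ge0_le_integral => //.
  - by apply/measurable_EFinP; apply: measurableT_comp.
  - by apply/measurable_EFinP; apply: measurable_maxr; apply: measurableT_comp.
  - by move=> t _; rewrite lee_fin le_max lexx orbT.
have iv : mu.-integrable setT (EFin \o v).
  apply/integrableP; split; first exact/measurable_EFinP.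
  by case/integrableP: ih => _; apply: le_lt_trans.
split; first by exists v.
have fE : (\int[mu]_t (v t)%:E = (Int f)%:E)%E.
  by rewrite (Int_eq mv fv) fineK//; exact: integrable_fin_num.
have hE : (\int[mu]_t `|(h' t)%:E| = (Int h)%:E)%E.
  rewrite -Ih; apply: ae_eq_integral => //.
  - by apply/measurable_EFinP; apply: measurableT_comp.
  - exact/measurable_EFinP.
  by apply: ae_eqT; apply: filterS vh => t vt; rewrite /= ger0_norm// (le_trans _ vt).
rewrite -lee_fin -hE; apply: le_trans le.
have -> : (`|Int f|%:E = `|\int[mu]_t (v t)%:E|)%E by rewrite fE.
exact: (le_abse_integral mu measurableT (proj2 (measurable_EFinP _ _) mv)).
Qed.

Lemma Int_ge0 f : aeint f -> {ae mu, forall t, 0 <= f t} -> 0 <= Int f.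
Proof.
move=> iF f0; have [_ h] := aeint_dom (aeint_meas iF) iF (filterS
  (fun t => fun h : 0 <= f t => eq_ind_r (fun z => z <= f t) (lexx (f t)) (ger0_norm h)) f0).
exact: le_trans h.
Qed.

Lemma Int_le f g : aeint f -> aeint g -> {ae mu, forall t, f t <= g t} -> Int f <= Int g.
Proof.
move=> iF iG fg; have [ih E] := aeint_lin (-1) iF iG.
have := Int_ge0 ih; rewrite E mulN1r addrC subr_ge0; apply.
by apply: filterS fg => t ft; rewrite mulN1r addrC subr_ge0.
Qed.

(** Connects [aeint], stable under linear combinations, with finiteness of the integral of the
    function itself, by which [Lp_set] is defined. *)
Lemma aeint_ge0P f : (forall t, 0 <= f t) -> aemeas f ->
  (aeint f <-> (\int[mu]_t (f t)%:E < +oo)%E) /\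
  (aeint f -> (\int[mu]_t (f t)%:E = (Int f)%:E)%E).
Proof.
move=> f0 mf; have [mv fv] := mversionP mf; set v := mversion f in mv fv.
have E : (\int[mu]_t (f t)%:E = \int[mu]_t `|(v t)%:E|)%E.
  apply: ge0_integral_ae => //.
  by apply: filterS fv => t <- /=; rewrite ger0_norm.
split; first split.
- move=> [g [ig fg]]; rewrite E; case/integrableP: ig => mg.
  congr (_ < _)%E; apply: ge0_ae_eq_integral => //.
  + by apply: measurableT_comp.
  + by apply/measurable_EFinP; apply: measurableT_comp.
  by apply: ae_eqT; apply: filterS2 fg fv => t /= <- <-.
- by rewrite E => h; exists v; split=> //; apply/integrableP; split=> //; exact/measurable_EFinP.
- move=> iF; have [g [ig fg <-]] := Int_int iF; rewrite E.
  have mg : measurable_fun setT (EFin \o g) by case/integrableP: ig.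
  apply: ae_eq_integral => //.
  + by apply/measurable_EFinP; apply: measurableT_comp.
  + by apply: ae_eqT; apply: filterS2 fg fv => t <- <-; rewrite /= ger0_norm.
Qed.

End AeIntegral.

(** * Continuity of derivatives and elementary power bounds *)

Section Sequences.
Variables (R : realType) (X : normedModType R).
Local Notation nrm := (fun x : X => `|x|).
Local Notation PNn := (PN nrm).

Lemma cvg0_dominated (Y : normedModType R) (f : nat -> R) (g : nat -> Y) (B : R) :
  (\forall m \near \oo, `|f m| <= B * `|g m|) -> g @ \oo --> (0 : Y) -> f @ \oo --> (0 : R).
Proof.
move=> fg g0; apply/cvgr0Pnorm_le => e e0.
have B0 : 0 < `|B| + 1 by rewrite ltr_wpDl.
have e1 : 0 < e / (`|B| + 1) by rewrite divr_gt0.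
near=> m.
have h1 : `|f m| <= B * `|g m| by near: m.
have h2 : `|g m| <= e / (`|B| + 1) by near: m; move/cvgr0Pnorm_le: g0; apply.
apply: le_trans h1 _; apply: (@le_trans _ _ ((`|B| + 1) * `|g m|)).
  by rewrite ler_wpM2r// (le_trans (ler_norm B))// lerDl.
by move: h2; rewrite ler_pdivlMr// mulrC.
Unshelve. all: by end_near. Qed.

(** Lists of constant length converging entrywise. Continuity of a derivative jointly in point and
    directions is stated along them, and yields measurability of its values along functions. *)
Definition cvl (a : nat -> seq X) (l : seq X) :=
  (forall m, size (a m) = size l) /\ forall i, (fun m => nth 0 (a m) i) @ \oo --> nth 0 l i.

Lemma cvl_head a v l : cvl a (v :: l) -> (fun m => head 0 (a m)) @ \oo --> v.
Proof. by move=> [_ /(_ 0%N)] /=; under eq_fun do rewrite nth0. Qed.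

Lemma cvl_behead a v l : cvl a (v :: l) -> cvl (fun m => behead (a m)) l.
Proof.
move=> [sz cv]; split=> [m|i]; first by rewrite size_behead sz.
by have := cv i.+1; under [in X in _ -> X]eq_fun do rewrite nth_behead.
Qed.

Lemma cvl_PN a l : cvl a l -> (fun m => PNn (a m)) @ \oo --> PNn l.
Proof.
elim: l a => [|v l IH] a al.
  have -> : (fun m => PNn (a m)) = fun=> PNn [::]; last exact: cvg_cst.
  by apply/funext => m; rewrite (size0nil (al.1 m)).
have -> : (fun m => PNn (a m)) = fun m => `|head 0 (a m)| * PNn (behead (a m)).
  by apply/funext => m; move: (al.1 m); case: (a m) => //= w s _; rewrite PN_cons.
rewrite PN_cons; apply: cvgM; last by apply: IH; apply: cvl_behead al.
by apply: cvg_norm; apply: cvl_head al.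
Qed.

Variables (n : nat) (al p C c : R) (D : X -> seq X -> R).
Hypothesis al01 : 0 < al <= 1.
Hypothesis np : n%:R + al <= p.
Hypothesis C0 : 0 <= C.
Hypothesis GD : growth n al p C c D.

Let al0 : 0 < al. Proof. by case/andP: al01. Qed.
Let al1 : al <= 1. Proof. by case/andP: al01. Qed.

Lemma growth_exp_ge0 k : (k <= n)%N -> 0 <= p - k%:R - al.
Proof.
move=> kn; have : (k%:R : R) <= n%:R by rewrite ler_nat.
by move: np; lra.
Qed.

Lemma growth_cvg_base (x : nat -> X) (x0 : X) s : (size s <= n)%N -> x @ \oo --> x0 ->
  (fun m => D (x m) s) @ \oo --> D x0 s.
Proof.
move=> sn xx.
pose B := (2 * `|x0| + 1); have B1 : 0 <= B by rewrite addr_ge0// mulr_ge0.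
have P0 : 0 <= PNn s by apply: PN_ge0.
pose e1 := p - (size s).+1%:R - al.
pose K := C * B `^ e1 * PNn s + C * `|x0| `^ (p - (size s).+1%:R) * PNn s +
  C * B `^ (p - n%:R - al) * PNn s.
have K10 : 0 <= C * B `^ e1 * PNn s by rewrite !mulr_ge0 ?powR_ge0.
have K20 : 0 <= C * `|x0| `^ (p - (size s).+1%:R) * PNn s by rewrite !mulr_ge0 ?powR_ge0.
have K30 : 0 <= C * B `^ (p - n%:R - al) * PNn s by rewrite !mulr_ge0 ?powR_ge0.
have main y : `|y - x0| <= 1 -> `|D y s - D x0 s| <= K * `|y - x0| `^ al.
  move=> y1; set t := `|y - x0|; have t0 : 0 <= t by exact: normr_ge0.
  have T0 : 0 <= t `^ al by exact: powR_ge0.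
  have tT : t <= t `^ al by apply: le_self_powR; rewrite ?t0 ?y1 ?(ltW al0) ?al1.
  have yB : `|x0| + `|y| <= B.
    by have := ler_normD x0 (y - x0); rewrite addrCA subrr addr0 /B; lra.
  move: (sn); rewrite leq_eqVlt => /orP[/eqP sE|sl].
    apply: le_trans (gr_hol GD x0 y sE) _.
    rewrite mulrAC -/t ler_wpM2r//.
    apply: (@le_trans _ _ (C * B `^ (p - n%:R - al) * PNn s)); last by rewrite /K; lra.
    by rewrite ler_wpM2r// ler_wpM2l// powR_le_mono// ?growth_exp_ge0// addr_ge0.
  have h1 := gr_rem GD x0 y sl.
  have h2 := gr_bound GD x0 (s := y - x0 :: s) sl.
  rewrite PN_cons /= -/t in h2; rewrite -/t -/e1 in h1.
  have h3 : C * (`|x0| + `|y|) `^ e1 * (t * t `^ al) * PNn s <= C * B `^ e1 * PNn s * t `^ al.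
    rewrite mulrAC ler_pM ?mulr_ge0 ?powR_ge0//.
      by rewrite ler_wpM2r// ler_wpM2l// powR_le_mono// ?growth_exp_ge0// addr_ge0.
    by rewrite ler_piMl.
  have h4 : C * `|x0| `^ (p - (size s).+1%:R) * (t * PNn s) <=
      C * `|x0| `^ (p - (size s).+1%:R) * PNn s * t `^ al.
    by rewrite mulrCA mulrC ler_wpM2l.
  have := ler_normD (D y s - D x0 s - D x0 (y - x0 :: s)) (D x0 (y - x0 :: s)).
  rewrite subrK /K !mulrDl.
  have : 0 <= C * B `^ (p - n%:R - al) * PNn s * t `^ al by rewrite mulr_ge0.
  lra.
have K0 : 0 <= K by rewrite !addr_ge0.
apply/cvgrPdist_le => e e0; have [del d0 Hd] := small_powR K0 al0 e0.
near=> m; rewrite distrC.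
have t1 : `|x m - x0| <= 1.
  by rewrite distrC; near: m; move/cvgrPdist_le: xx; apply.
have t2 : `|x m - x0| < del.
  by rewrite distrC; near: m; move/cvgrPdist_lt: xx; apply.
by apply: le_trans (main _ t1) _; apply: Hd.
Unshelve. all: by end_near. Qed.

Lemma growth_cvg (x : nat -> X) (x0 : X) (a : nat -> seq X) l : (size l <= n)%N ->
  x @ \oo --> x0 -> cvl a l -> (fun m => D (x m) (a m)) @ \oo --> D x0 l.
Proof.
move=> ln xx al'.
(* The directions are replaced by their limits one at a time: [pre] collects those already replaced,
   and multilinearity splits off the difference in the next one. *)
suff H suf pre b : (size pre + size suf <= n)%N -> cvl b suf ->
    (fun m => D (x m) (pre ++ b m)) @ \oo --> D x0 (pre ++ suf).
  exact: (H l [::] a).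
elim: suf pre b {ln al'} => [|v suf IH] pre b sn bs.
  have -> : (fun m => D (x m) (pre ++ b m)) = fun m => D (x m) pre.
    by apply/funext => m; rewrite (size0nil (bs.1 m)) cats0.
  by rewrite cats0; apply: growth_cvg_base => //; rewrite addn0 in sn.
rewrite /= addnS in sn.
have bE m : b m = head 0 (b m) :: behead (b m).
  by move: (bs.1 m); case: (b m).
have sb m : size (behead (b m)) = size suf by rewrite size_behead bs.1.
pose f m := D (x m) (pre ++ (head 0 (b m) - v) :: behead (b m)).
pose g m := D (x m) (rcons pre v ++ behead (b m)).
have -> : (fun m => D (x m) (pre ++ b m)) = f + g.
  apply/funext => m; rewrite /f /g /= fctE cat_rcons {1}bE.
  have lin : mlin setT n (D (x m)) := gr_lin GD (x m).
  have := lin pre (behead (b m)) 1 (head 0 (b m) - v) v.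
  by rewrite scale1r subrK mul1r; apply; rewrite ?sb.
have -> : D x0 (pre ++ v :: suf) = 0 + D x0 (rcons pre v ++ suf).
  by rewrite add0r cat_rcons.
apply: cvgD; last first.
  by apply: IH; [rewrite size_rcons addSn|exact: cvl_behead bs].
pose B := C * (`|x0| + 1) `^ (p - (size pre + (size suf).+1)%:R) * PNn pre * (PNn suf + 1).
apply: (@cvg0_dominated X _ (fun m => head 0 (b m) - v) B); last first.
  have h : (fun m => head 0 (b m) - v) @ \oo --> v - v.
    by apply: cvgB; [exact: cvl_head bs|exact: cvg_cst].
  by rewrite subrr in h.
have pe : 0 <= p - (size pre + (size suf).+1)%:R.
  have := @growth_exp_ge0 (size pre + (size suf).+1); rewrite addnS => /(_ sn).
  by move: (ltW al0); lra.
near=> m.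
have h1 : `|x m| <= `|x0| + 1.
  have : `|x0 - x m| <= 1 by near: m; move/cvgrPdist_le: xx; apply.
  by have := ler_normB x0 (x0 - x m); rewrite opprB addrCA subrr addr0; lra.
have h2 : PNn (behead (b m)) <= PNn suf + 1.
  have : `|PNn suf - PNn (behead (b m))| <= 1.
    by near: m; move/cvgrPdist_le: (cvl_PN (cvl_behead bs)); apply.
  by rewrite ler_norml; lra.
have := gr_bound GD (x m) (s := pre ++ (head 0 (b m) - v) :: behead (b m)).
rewrite size_cat /= sb addnS => /(_ sn) h3; apply: le_trans h3 _.
rewrite PN_cat PN_cons -addnS.
have P1 : 0 <= PNn pre by apply: PN_ge0.
have P2 : 0 <= PNn (behead (b m)) by apply: PN_ge0.
rewrite /B (_ : _ * (_ * (_ * _)) = C * `|x m| `^ (p - (size pre + (size suf).+1)%:R) *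
  PNn pre * PNn (behead (b m)) * `|head 0 (b m) - v|); last by ring.
rewrite ler_wpM2r// ler_pM ?mulr_ge0 ?powR_ge0//.
by rewrite ler_wpM2r// ler_wpM2l// powR_le_mono.
Unshelve. all: by end_near. Qed.

End Sequences.

Section PowerBounds.
Variable R : realType.

Lemma max_powR (p : R) (l : seq R) : 0 < p -> (forall x, x \in l -> 0 <= x) ->
  exists M, [/\ 0 <= M, (forall x, x \in l -> x <= M) & M `^ p <= \sum_(x <- l) x `^ p].
Proof.
move=> p0; elim: l => [_|x l IH l0].
  by exists 0; split=> //; rewrite powR0 ?gt_eqF// big_nil.
have [|M [M0 lM Mp]] := IH; first by move=> y yl; apply: l0; rewrite inE yl orbT.
have x0 : 0 <= x by apply: l0; rewrite inE eqxx.
have [xM|Mx] := leP x M.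
  exists M; split=> // [y|]; first by rewrite inE => /orP[/eqP ->//|/lM].
  by rewrite big_cons; apply: le_trans Mp _; rewrite lerDr powR_ge0.
exists x; split=> // [y|].
  by rewrite inE => /orP[/eqP ->//|/lM h]; apply: le_trans h (ltW Mx).
by rewrite big_cons lerDl; apply: sumr_ge0 => i _; exact: powR_ge0.
Qed.

(** With [M] the largest of all factors, the left side is at most [M ^ p], which the right side
    dominates. *)
Lemma prod_powR_le (p e b x y : R) (l : seq R) : 0 < p -> 0 <= e -> 0 <= b -> 0 <= x -> 0 <= y ->
  (forall z, z \in l -> 0 <= z) -> e + b + (size l)%:R = p ->
  x `^ e * y `^ b * \prod_(z <- l) z <= x `^ p + y `^ p + \sum_(z <- l) z `^ p.
Proof.
move=> p0 e0 b0 x0 y0 l0 E.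
have [||M [M0 lM Mp]] := @max_powR p [:: x, y & l] => //.
  by move=> z; rewrite !inE => /or3P[/eqP ->|/eqP ->|/l0].
rewrite !big_cons addrA in Mp; apply: le_trans Mp.
have xM : x <= M by apply: lM; rewrite !inE eqxx.
have yM : y <= M by apply: lM; rewrite !inE eqxx orbT.
have lp : \prod_(z <- l) z <= M ^+ size l.
  have {}lM z : z \in l -> z <= M by move=> zl; apply: lM; rewrite !inE zl !orbT.
  elim: l l0 lM {E} => [|z l IH] l0 lM; first by rewrite big_nil.
  rewrite big_cons exprS ler_pM//.
  - by apply: l0; rewrite inE eqxx.
  - rewrite big_seq; apply: prodr_ge0 => i il; apply: l0; by rewrite inE il orbT.
  - by apply: lM; rewrite inE eqxx.
  - by apply: IH => i il; [apply: l0|apply: lM]; rewrite inE il orbT.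
apply: (@le_trans _ _ (M `^ e * M `^ b * M ^+ size l)).
  rewrite ler_pM ?mulr_ge0 ?powR_ge0//.
    by rewrite big_seq; apply: prodr_ge0.
  by rewrite ler_pM ?powR_ge0// powR_le_mono.
(* At [M = 0] the convention [0 ^ 0 = 1] prevents adding exponents; but [p > 0] leaves at least one
   positive exponent. *)
have [M00|M00] := eqVneq M 0.
  rewrite M00; have [e00|e00] := eqVneq e 0; last by rewrite (powR0 e00) !mul0r powR_ge0.
  have [b00|b00] := eqVneq b 0; last by rewrite (powR0 b00) mulr0 mul0r powR_ge0.
  have : (size l)%:R != 0 :> R by move: E p0; rewrite e00 b00 !add0r => ->; move/gt_eqF ->.
  by rewrite pnatr_eq0 => sl; rewrite expr0n (negbTE sl) mulr0 powR_ge0.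
by rewrite -powR_mulrn// -!powRD ?M00 ?implybT// E.
Qed.

Lemma powRD_le (p x y : R) : 0 < p -> 0 <= x -> 0 <= y ->
  (x + y) `^ p <= 2 `^ p * (x `^ p + y `^ p).
Proof.
move=> p0 x0 y0.
have [|M [M0 lM Mp]] := @max_powR p [:: x; y] p0.
  by move=> z; rewrite !inE => /orP[/eqP ->|/eqP ->].
rewrite !big_cons big_nil addr0 in Mp.
have xM : x <= M by apply: lM; rewrite !inE eqxx.
have yM : y <= M by apply: lM; rewrite !inE eqxx orbT.
apply: (@le_trans _ _ ((2 * M) `^ p)).
  by apply: powR_le_mono; [exact: ltW|exact: addr_ge0|lra].
by rewrite powRM// ler_wpM2l// powR_ge0.
Qed.

End PowerBounds.

(** * The seminorm of L_p(X) *)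

Section Bochner.
Variables (R : realType) (d : measure_display) (T : measurableType d).
Variable mu : {measure set T -> \bar R}.
Variable X : normedModType R.
Variable p : R.
Hypothesis p1 : 1 <= p.
Let p0 : 0 < p. Proof. exact: lt_le_trans ltr01 p1. Qed.
Local Notation S := (@Lp_set R d T mu X p).
Local Notation N := (@Lp_norm R d T mu X p).
Local Notation smeas := (@strongly_measurable R d T mu X).
Local Notation at_ t := (map (fun h : T -> X => h t)).

Lemma approx_list (s : seq (T -> X)) : (forall u, u \in s -> smeas u) ->
  exists A : nat -> T -> seq X, (forall m, simple_map (A m)) /\
    {ae mu, forall t, cvl (fun m => A m t) (at_ t s)}.
Proof.
elim: s => [_|u s IH H].
  exists (fun _ _ => [::]); split; first by move=> m; exact: simple_map_cst.
  by apply: aeW => t; split=> // i; rewrite /= nth_nil; exact: cvg_cst.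
have [|A [sA cA]] := IH; first by move=> v vs; apply: H; rewrite inE vs orbT.
have [|f [sf cf]] := H u; first by rewrite inE eqxx.
exists (fun m t => f m t :: A m t); split.
  by move=> m; apply: simple_map2; [exact: sf|exact: sA].
apply: filterS2 cf cA => t ct [sz cA]; split; first by move=> m /=; rewrite sz.
by case.
Qed.

Lemma smeas_comp (k : nat) (F : seq X -> R) :
  (forall a l, size l = k -> cvl a l -> (fun m => F (a m)) @ \oo --> F l) ->
  forall s, size s = k -> (forall u, u \in s -> smeas u) ->
  aemeas mu (fun t => F (at_ t s)).
Proof.
move=> cF s sk /approx_list[A [sA cA]].
apply: (@aemeas_cvg _ _ _ _ (fun m t => F (A m t))).
  by move=> m; apply: simple_map_measurable; apply: simple_map1.
by apply: filterS cA => t ct; apply: cF => //; rewrite size_map.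
Qed.

Lemma smeas_lin u v a : smeas u -> smeas v -> smeas (a *: u + v).
Proof.
move=> [f [sf cf]] [g [sg cg]]; exists (fun m t => a *: f m t + g m t); split.
  by move=> m; apply: (simple_map2 (fun x y => a *: x + y)); [exact: sf|exact: sg].
apply: filterS2 cf cg => t ct dt; apply: cvgD => //; exact: cvgZr.
Qed.

Lemma aemeas_norm u : smeas u -> aemeas mu (fun t => `|u t|).
Proof.
move=> su; apply: (@smeas_comp 1 (fun l => `|head 0 l|) _ [:: u]) => //.
  by move=> a [|v [|? ?]]// _ /cvl_head h; apply: cvg_norm.
by move=> v; rewrite inE => /eqP ->.
Qed.

Lemma aemeas_powR (f : T -> R) (b : R) : aemeas mu f -> aemeas mu (fun t => f t `^ b).
Proof.
move=> [g [mg fg]]; exists (fun t => g t `^ b); split.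
  exact: (measurableT_comp (measurable_powR b) mg).
by apply: filterS fg => t ->.
Qed.

Lemma Lp_setE u : S u <-> smeas u /\ aeint mu (fun t => `|u t| `^ p).
Proof.
split=> [[su h]|[su h]]; split=> //.
  have [H _] := aeint_ge0P (fun t => powR_ge0 `|u t| p) (aemeas_powR p (aemeas_norm su)).
  by apply/H.
have [H _] := aeint_ge0P (fun t => powR_ge0 `|u t| p) (aemeas_powR p (aemeas_norm su)).
by apply/H.
Qed.

Lemma Lp_norm_powR u : S u -> N u `^ p = Int mu (fun t => `|u t| `^ p).
Proof.
move=> /Lp_setE[su iu]; rewrite /Lp_norm -powRrM mulVf ?gt_eqF// /Lp_integral.
have [_ ->//] := aeint_ge0P (fun t => powR_ge0 `|u t| p) (aemeas_powR p (aemeas_norm su)).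
rewrite powRr1//; apply: Int_ge0 => //; apply: aeW => t; exact: powR_ge0.
Qed.

Lemma Lp_norm_ge0 u : 0 <= N u.
Proof. exact: powR_ge0. Qed.

Lemma Lp_norm_le u c : S u -> 0 <= c -> Int mu (fun t => `|u t| `^ p) <= c `^ p -> N u <= c.
Proof.
move=> Su c0; rewrite -Lp_norm_powR// => h; rewrite leNgt; apply/negP => cN.
have : c `^ p < N u `^ p by apply: gt0_ltr_powR; rewrite // nnegrE ?Lp_norm_ge0.
by rewrite ltNge h.
Qed.

Lemma Lp_set_lin u v a : S u -> S v -> S (a *: u + v).
Proof.
move=> /Lp_setE[su iu] /Lp_setE[sv iv]; apply/Lp_setE.
have sw := smeas_lin a su sv; split=> //.
have [i1 _] := aeint_lin (2 `^ p * `|a| `^ p) iu iv.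
have [i2 _] := aeint_lin (2 `^ p) iv i1.
have [i3 _] := aeint_lin (2 `^ p * `|a| `^ p + 1) iu i2.
have [i4 _] := aeint_lin 1 iv i3.
have [] // := aeint_dom (aemeas_powR p (aemeas_norm sw)) i4.
apply: aeW => t; rewrite ger0_norm ?powR_ge0//.
apply: (@le_trans _ _ (2 `^ p * (`|a *: u t| `^ p + `|v t| `^ p))).
  apply: le_trans (powRD_le p0 (normr_ge0 _) (normr_ge0 _)).
  by apply: powR_le_mono; rewrite ?(ltW p0)// ler_normD.
rewrite normrZ powRM// mulrDr mulrA.
have := powR_ge0 `|v t| p; have := powR_ge0 `|u t| p.
have : 0 <= 2 `^ p * `|a| `^ p * `|u t| `^ p by rewrite !mulr_ge0 ?powR_ge0.
by move: (2 `^ p) (`|a| `^ p) (`|u t| `^ p) (`|v t| `^ p) => A B C D; lra.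
Qed.

Lemma smeas0 : smeas (0 : T -> X).
Proof.
have h : simple_map (fun _ : T => 0 : X) by exact: simple_map_cst.
exists (fun _ _ => 0); split; first by move=> m; exact: h.
by apply: aeW => t; exact: cvg_cst.
Qed.

Lemma Int_powR0 : aeint mu (fun t => `|(0 : T -> X) t| `^ p) /\
  Int mu (fun t => `|(0 : T -> X) t| `^ p) = 0.
Proof.
have -> : (fun t => `|(0 : T -> X) t| `^ p) = cst 0.
  by apply/funext => t; rewrite normr0 powR0// gt_eqF.
have Z : aeint mu (cst 0) by exists (cst 0); split; [exact: integrable0|exact: aeW].
split=> //; have [_] := aeint_lin (-1) Z Z.
have -> : (fun t : T => -1 * cst 0 t + cst 0 t) = cst 0 :> (T -> R).
  by apply/funext => t /=; rewrite mulr0 addr0.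
lra.
Qed.

Lemma Lp_set0 : S 0.
Proof. by apply/Lp_setE; split; [exact: smeas0|exact: Int_powR0.1]. Qed.

Lemma Lp_norm0 : N 0 = 0.
Proof.
apply/eqP; rewrite eq_le Lp_norm_ge0 andbT; apply: Lp_norm_le => //; first exact: Lp_set0.
by rewrite Int_powR0.2 powR_ge0.
Qed.

Lemma Lp_setB u v : S u -> S v -> S (u - v).
Proof. by move=> Su Sv; rewrite addrC -scaleN1r; apply: Lp_set_lin. Qed.

Lemma Lp_normN u : N (- u) = N u.
Proof.
rewrite /Lp_norm; suff -> : Lp_integral mu p (- u) = Lp_integral mu p u by [].
by apply: eq_integral => t _; rewrite fctE normrN.
Qed.

Lemma aemeasD (f g : T -> R) : aemeas mu f -> aemeas mu g -> aemeas mu (fun t => f t + g t).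
Proof.
move=> [f' [mf ff]] [g' [mg gg]]; exists (fun t => f' t + g' t); split.
  exact: measurable_funD.
by apply: filterS2 ff gg => t -> ->.
Qed.

Lemma Lp_add_powR u v c : S u -> S v -> N u <= c -> N v <= c ->
  aeint mu (fun t => (`|u t| + `|v t|) `^ p) /\
  Int mu (fun t => (`|u t| + `|v t|) `^ p) <= (4 * c) `^ p.
Proof.
move=> Su Sv uc vc; have c0 : 0 <= c by apply: le_trans uc; exact: Lp_norm_ge0.
have iu := ((Lp_setE u).1 Su).2; have iv := ((Lp_setE v).1 Sv).2.
have [i1 E1] := aeint_lin 1 iu iv.
(* The second summand of [aeint_lin] has no coefficient, so [2 ^ p] times a function is written as
   [2 ^ p - 1] times it plus itself. *)
have [i2 E2] := aeint_lin (2 `^ p - 1) i1 i1.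
have mw := aemeas_powR p (aemeasD (aemeas_norm ((Lp_setE u).1 Su).1) (aemeas_norm ((Lp_setE v).1 Sv).1)).
have le : {ae mu, forall t, (`|u t| + `|v t|) `^ p <=
    (2 `^ p - 1) * (1 * `|u t| `^ p + `|v t| `^ p) + (1 * `|u t| `^ p + `|v t| `^ p)}.
  apply: aeW => t; rewrite !mul1r mulrBl mul1r subrK.
  exact: powRD_le.
have iw : aeint mu (fun t => (`|u t| + `|v t|) `^ p).
  have [] // := aeint_dom mw i2.
  by apply: filterS le => t; rewrite [`|_ `^ _|]ger0_norm ?powR_ge0.
split=> //.
apply: (@le_trans _ _ (2 `^ p * (c `^ p + c `^ p))); last first.
  rewrite powRM// (_ : 4 = 2 * 2); last by ring.
  rewrite powRM// -mulrA ler_wpM2l ?powR_ge0//.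
  have h : (2 : R) <= 2 `^ p by apply: le1r_powR => //; rewrite ler1n.
  by rewrite -mulr2n -[leLHS]mulr_natl; apply: ler_wpM2r; rewrite ?powR_ge0.
apply: le_trans (Int_le iw i2 le) _.
rewrite E2 E1 mul1r -!Lp_norm_powR//.
have h1 : N u `^ p <= c `^ p by apply: powR_le_mono; rewrite ?Lp_norm_ge0// ltW.
have h2 : N v `^ p <= c `^ p by apply: powR_le_mono; rewrite ?Lp_norm_ge0// ltW.
rewrite mulrBl mul1r subrK.
have h3 := ler_wpM2l (powR_ge0 2 p) (lerD h1 h2).
exact: h3.
Qed.

(** Plays the part of the triangle inequality. The 4 comes from
    [(a + b) ^ p <= 2 ^ p * (a ^ p + b ^ p)] and [2 <= 2 ^ p]. *)
Lemma Lp_norm_quasi u v c : S u -> S v -> N u <= c -> N v <= c -> N (u + v) <= 4 * c.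
Proof.
move=> Su Sv uc vc; have c0 : 0 <= c by apply: le_trans uc; exact: Lp_norm_ge0.
have Sw : S (u + v) by rewrite -[u]scale1r; apply: Lp_set_lin.
have [iw hw] := Lp_add_powR Su Sv uc vc.
apply: (Lp_norm_le Sw (mulr_ge0 (ler0n R 4) c0)); apply: le_trans hw.
apply: (Int_le ((Lp_setE _).1 Sw).2 iw).
apply: aeW => t; apply: powR_le_mono; rewrite ?(ltW p0)//; exact: ler_normD.
Qed.

(** Positive strict bounds [w.2 > N w.1] stand in for the seminorms, which may vanish and cannot be
    divided by; they are lowered to the seminorms one direction at a time. *)
Lemma le_PN_limit (s : seq (T -> X)) (a K : R) : 0 <= K ->
  (forall z : seq ((T -> X) * R), map fst z = s -> (forall w, w \in z -> N w.1 < w.2) ->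
     a <= K * \prod_(w <- z) w.2) -> a <= K * PN N s.
Proof.
elim: s K => [|h s IH] K K0 H.
  by have := H [::] erefl; rewrite /PN !big_nil; apply.
rewrite PN_cons mulrCA mulrC -[N h]powRr1 ?Lp_norm_ge0//.
apply: le_powR_limit => // [||c hc].
- by rewrite mulr_ge0// PN_ge0// => ?; exact: Lp_norm_ge0.
- exact: Lp_norm_ge0.
have c0 : 0 <= c by apply: le_trans (ltW hc); exact: Lp_norm_ge0.
rewrite powRr1// mulrAC; apply: IH; first exact: mulr_ge0.
move=> z zs zN; have := H ((h, c) :: z); rewrite /= zs big_cons mulrA; apply=> //.
by move=> w; rewrite inE => /orP[/eqP ->|/zN].
Qed.

(* Hoelder's inequality in disguise: after normalisation, a product of total degree [p] is at most the sum of the [p]-th powers of its factors. *)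
Lemma Lp_product_bound (f m v : T -> R) (s : seq (T -> X)) (K e b : R) :
  (forall t, 0 <= m t) -> (forall t, 0 <= v t) -> inS S s ->
  aeint mu (fun t => m t `^ p) -> aeint mu (fun t => v t `^ p) -> aemeas mu f ->
  0 <= K -> 0 <= e -> 0 <= b -> e + b + (size s)%:R = p ->
  (forall t, `|f t| <= K * (m t `^ e * v t `^ b * PN (fun x : X => `|x|) (at_ t s))) ->
  aeint mu f /\ forall W c, 0 < W -> 0 < c ->
    Int mu (fun t => m t `^ p) <= W `^ p -> Int mu (fun t => v t `^ p) <= c `^ p ->
    `|Int mu f| <= (2 + (size s)%:R) * K * W `^ e * c `^ b * PN N s.
Proof.
move=> m0 v0 Ss im iv mf K0 e0 b0 E fb.
(* The sum of the normalised [p]-th powers. Each has integral at most 1 once [W], [c] and the [w.2]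
   bound the respective norms, whence the factor [2 + size s]. *)
pose G (W c : R) (z : seq ((T -> X) * R)) t := (W `^ p)^-1 * m t `^ p +
  ((c `^ p)^-1 * v t `^ p + \sum_(w <- z) (w.2 `^ p)^-1 * `|w.1 t| `^ p).
pose Kz (W c : R) (z : seq ((T -> X) * R)) := K * (W `^ e * c `^ b * \prod_(w <- z) w.2).
have iz (w : (T -> X) * R) : S w.1 -> aeint mu (fun t => (w.2 `^ p)^-1 * `|w.1 t| `^ p) /\
    Int mu (fun t => (w.2 `^ p)^-1 * `|w.1 t| `^ p) = (w.2 `^ p)^-1 * Int mu (fun t => `|w.1 t| `^ p).
  move=> /Lp_setE[_ iw]; have [Z1 Z2] := Int_powR0.
  have [] := aeint_lin (w.2 `^ p)^-1 iw Z1.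
  under eq_fun do rewrite normr0 powR0 ?(gt_eqF p0)// addr0.
  by rewrite Z2 addr0.
have isum z : inS S (map fst z) ->
    aeint mu (fun t => \sum_(w <- z) (w.2 `^ p)^-1 * `|w.1 t| `^ p) /\
    Int mu (fun t => \sum_(w <- z) (w.2 `^ p)^-1 * `|w.1 t| `^ p) =
    \sum_(w <- z) (w.2 `^ p)^-1 * Int mu (fun t => `|w.1 t| `^ p).
  elim: z => [_|w z IH /= /inS_cons[Sw Sz]].
    have [Z1 Z2] := Int_powR0; rewrite big_nil -[X in _ /\ _ = X]Z2.
    suff -> : (fun t => \sum_(w <- [::]) ((w : (T -> X) * R).2 `^ p)^-1 * `|w.1 t| `^ p) =
      (fun t => `|(0 : T -> X) t| `^ p) by [].
    by apply/funext => t; rewrite big_nil normr0 powR0// gt_eqF.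
  have [j1 j2] := IH Sz; have [k1 k2] := iz _ Sw.
  have [l1 l2] := aeint_lin 1 k1 j1.
  rewrite big_cons -j2 -k2 -[X in _ /\ _ = X + _]mul1r -l2.
  by split; [move: l1|congr Int]; [congr aeint|]; apply/funext => t; rewrite big_cons mul1r.
have iG W c z : inS S (map fst z) -> aeint mu (G W c z) /\
    Int mu (G W c z) = (W `^ p)^-1 * Int mu (fun t => m t `^ p) +
      ((c `^ p)^-1 * Int mu (fun t => v t `^ p) +
       \sum_(w <- z) (w.2 `^ p)^-1 * Int mu (fun t => `|w.1 t| `^ p)).
  move=> /isum[j1 j2]; have [k1 k2] := aeint_lin (c `^ p)^-1 iv j1.
  have [l1 l2] := aeint_lin (W `^ p)^-1 im k1.
  by split; [exact: l1|rewrite /G l2 k2 j2].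
(* The added zero function gives the bound the shape [a * f + g] handled by [aeint_lin]. *)
have dom W c z : 0 < W -> 0 < c -> map fst z = s -> (forall w, w \in z -> 0 < w.2) ->
    forall t, `|f t| <= Kz W c z * G W c z t + `|(0 : T -> X) t| `^ p.
  move=> W0 c0 zs zp t; rewrite normr0 powR0 ?gt_eqF// addr0.
  apply: le_trans (fb t) _; rewrite /Kz -[leRHS]mulrA ler_wpM2l//.
  have nW : forall (x y q : R), 0 <= x -> 0 < y -> x `^ q = y `^ q * (x / y) `^ q.
    by move=> x y q x0 y0; rewrite -powRM ?divr_ge0 ?(ltW y0)// mulrC divfK// gt_eqF.
  have nP : forall (x y : R), 0 <= x -> 0 < y -> (y `^ p)^-1 * x `^ p = (x / y) `^ p.
    by move=> x y x0 y0; rewrite (nW x y)// mulrA mulVf ?mul1r// gt_eqF// powR_gt0.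
  have PE : PN (fun x : X => `|x|) (at_ t s) =
      (\prod_(w <- z) w.2) * \prod_(q <- [seq `|w.1 t| / w.2 | w <- z]) q.
    rewrite -zs /PN -map_comp !big_map -big_split /=; apply: eq_big_seq => w wz.
    by rewrite mulrC divfK// gt_eqF// zp.
  rewrite PE (nW (m t) W e)// (nW (v t) c b)//.
  set A1 := (m t / W); set A2 := (v t / c); set L := [seq _ | w <- z].
  have Z0 : 0 <= \prod_(w <- z) w.2.
    by rewrite big_seq; apply: prodr_ge0 => w wz; rewrite ltW// zp.
  rewrite (_ : _ * _ * _ = W `^ e * c `^ b * (\prod_(w <- z) w.2) *
    (A1 `^ e * A2 `^ b * \prod_(q <- L) q)); last by ring.
  rewrite ler_wpM2l ?mulr_ge0 ?powR_ge0//.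
  rewrite /G !nP// -/A1 -/A2.
  have -> : \sum_(w <- z) (w.2 `^ p)^-1 * `|w.1 t| `^ p = \sum_(q <- L) q `^ p.
    by rewrite /L big_map; apply: eq_big_seq => w wz; rewrite nP// zp.
  rewrite addrA; apply: prod_powR_le => //.
  - by rewrite divr_ge0// ltW.
  - by rewrite divr_ge0// ltW.
  - by move=> q /mapP[w wz ->]; rewrite divr_ge0// ltW// zp.
  - by rewrite /L size_map -(size_map fst) zs.
have i0 := Int_powR0.
have fint W c z : 0 < W -> 0 < c -> map fst z = s -> (forall w, w \in z -> 0 < w.2) ->
    aeint mu f /\ `|Int mu f| <= Kz W c z * Int mu (G W c z).
  move=> W0 c0 zs zp; have [|h1 _] := iG W c z; first by rewrite zs.
  have [k1 k2] := aeint_lin (Kz W c z) h1 i0.1.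
  have dd : {ae mu, forall t, `|f t| <= Kz W c z * G W c z t + `|(0 : T -> X) t| `^ p}.
    by apply: aeW => t; exact: dom.
  have [] := aeint_dom mf k1 dd.
  by rewrite k2 i0.2 addr0.
split.
  have [] // := fint 1 1 [seq (h, 1) | h <- s] ltr01 ltr01.
    by rewrite -map_comp map_id_in.
  by move=> w /mapP[h _ ->].
move=> W c W0 c0 hW hc.
apply: le_PN_limit.
  by rewrite !mulr_ge0 ?powR_ge0// addr_ge0.
move=> z zs zN.
have zp w : w \in z -> 0 < w.2.
  by move=> /zN; apply: le_lt_trans; exact: Lp_norm_ge0.
have [_ h] := fint W c z W0 c0 zs zp; apply: le_trans h _.
have [|_ ->] := iG W c z; first by rewrite zs.
have Z0 : 0 <= \prod_(w <- z) w.2.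
  by rewrite big_seq; apply: prodr_ge0 => w wz; rewrite ltW// zp.
rewrite (_ : _ * _ * _ * _ * _ = Kz W c z * (2 + (size s)%:R)); last by rewrite /Kz; ring.
rewrite ler_wpM2l ?mulr_ge0 ?powR_ge0//.
have -> : 2 + (size s)%:R = 1 + (1 + (size s)%:R) :> R by ring.
apply: lerD.
  by rewrite mulrC ler_pdivrMr ?powR_gt0// mul1r.
apply: lerD; first by rewrite mulrC ler_pdivrMr ?powR_gt0// mul1r.
rewrite -zs size_map -sum1_size natr_sum !big_seq; apply: ler_sum => w wz.
rewrite mulrC ler_pdivrMr ?powR_gt0 ?zp// mul1r -Lp_norm_powR.
  by apply: powR_le_mono; rewrite ?Lp_norm_ge0 ?(ltW p0)// ltW// zN.
by apply: Ss; rewrite -zs; apply: map_f.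
Qed.

End Bochner.

(** * The integral functional on L_p(X) *)

Section IntegralFunctional.
Variables (R : realType) (d : measure_display) (T : measurableType d).
Variable mu : {measure set T -> \bar R}.
Variable X : normedModType R.
Variable p : R.
Hypothesis p1 : 1 <= p.
Let p0 : 0 < p. Proof. exact: lt_le_trans ltr01 p1. Qed.
Local Notation S := (@Lp_set R d T mu X p).
Local Notation N := (@Lp_norm R d T mu X p).
Local Notation nrm := (fun x : X => `|x|).
Local Notation at_ t := (map (fun h : T -> X => h t)).

Variables (n : nat) (al C c : R) (D : X -> seq X -> R).
Hypothesis al01 : 0 < al <= 1.
Hypothesis np : n%:R + al <= p.
Hypothesis C0 : 0 <= C.
Hypothesis c0 : 0 < c.
Hypothesis n0 : (0 < n)%N.
Hypothesis GD : growth n al p C c D.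

Let al0 : 0 < al. Proof. by case/andP: al01. Qed.

Definition DInt (u : T -> X) (s : seq (T -> X)) : R := Int mu (fun t => D (u t) (at_ t s)).

Let meas u s : S u -> inS S s -> (size s <= n)%N -> aemeas mu (fun t => D (u t) (at_ t s)).
Proof.
move=> Su Ss sn.
apply: (@smeas_comp _ _ _ mu X (size s).+1 (fun l => D (head 0 l) (behead l)) _ (u :: s)) => //.
  move=> a [|v l]//= [ls] al'; rewrite -ls in sn.
  by apply: (growth_cvg al01 np C0 GD sn); [exact: cvl_head al'|exact: cvl_behead al'].
by move=> v; rewrite inE => /orP[/eqP ->|/Ss []//]; case: Su.
Qed.

Let jp j : (j <= n)%N -> 0 <= p - j%:R <= p.
Proof.
move=> jn; have : (j%:R : R) <= n%:R by rewrite ler_nat.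
by have := ler0n R j; move: np al0; lra.
Qed.

Let ejp j : (j <= n)%N -> 0 <= p - j%:R - al <= p.
Proof.
move=> jn; rewrite (growth_exp_ge0 np jn) /=.
by have := ler0n R j; move: al0; lra.
Qed.

Let Nat u : S u -> aeint mu (fun t => `|u t| `^ p).
Proof. by case/(Lp_setE mu p). Qed.

Let bound u s : S u -> inS S s -> (size s <= n)%N ->
  aeint mu (fun t => D (u t) (at_ t s)) /\ forall W, 0 < W -> N u <= W ->
  `|DInt u s| <= (2 + (size s)%:R) * C * W `^ (p - (size s)%:R) * PN N s.
Proof.
move=> Su Ss sn; have /andP[e0 ep] := jp sn.
have [||i b] := @Lp_product_bound _ _ _ mu X p p1 (fun t => D (u t) (at_ t s))
  (fun t => `|u t|) (fun t => `|u t|) s C (p - (size s)%:R) 0 (fun t => normr_ge0 _)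
  (fun t => normr_ge0 _) Ss (Nat Su) (Nat Su) (meas Su Ss sn) C0 e0 (lexx 0).
- by rewrite addr0 subrK.
- move=> t; have := gr_bound GD (u t) (s := at_ t s); rewrite size_map => /(_ sn).
  by rewrite powRr0 mulr1 mulrA.
split=> // W W0 NW; have := b W W W0 W0; rewrite powRr0 mulr1 -Lp_norm_powR//.
have h : N u `^ p <= W `^ p by apply: powR_le_mono; rewrite ?Lp_norm_ge0// ltW.
by apply.
Qed.

Let Scons v s : S v -> inS S s -> inS S (v :: s).
Proof. by move=> Sv Ss; apply/inS_cons. Qed.

Let SB : forall x y, S x -> S y -> S (x - y).
Proof. by move=> x y; exact: Lp_setB. Qed.

(** With [k = size s], the total degree is [p]: [p - k - 1 - al] from [|x| + |y|], [1 + al] from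
    [y - x], and [k] from the directions. *)
Let rem_bound x y s W : S x -> S y -> inS S s -> (size s < n)%N -> 0 < W -> N x <= W -> N y <= W ->
  `|DInt y s - DInt x s - DInt x (y - x :: s)| <=
    (2 + (size s)%:R) * C * (4 * W) `^ (p - (size s).+1%:R - al) *
     (N (y - x) * N (y - x) `^ al) * PN N s.
Proof.
move=> Sx Sy Ss sn W0 xW yW; have Sd := SB Sy Sx.
have [iy _] := bound Sy Ss (ltnW sn); have [ix _] := bound Sx Ss (ltnW sn).
have [id _] := bound (s := y - x :: s) Sx (Scons Sd Ss) sn.
have [i1 E1] := aeint_lin (-1) ix iy; have [i2 E2] := aeint_lin (-1) id i1.
have E : DInt y s - DInt x s - DInt x (y - x :: s) =
    Int mu (fun t => -1 * D (x t) (at_ t (y - x :: s)) + (-1 * D (x t) (at_ t s) + D (y t) (at_ t s))).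
  by rewrite E2 E1 /DInt; ring.
have e0 := growth_exp_ge0 np sn.
have b0 : 0 <= 1 + al by rewrite addr_ge0// ltW.
have tt (t : R) : 0 <= t -> t * t `^ al = t `^ (1 + al).
  by move=> t0; rewrite powRD ?powRr1// gt_eqF//= ltr_pwDl// ltW.
have [iw hw] := Lp_add_powR p1 Sx Sy xW yW.
have [||_ b] := @Lp_product_bound _ _ _ mu X p p1 _
  (fun t => `|x t| + `|y t|) (fun t => `|(y - x) t|) s C (p - (size s).+1%:R - al) (1 + al)
  (fun t => addr_ge0 (normr_ge0 _) (normr_ge0 _))
  (fun t => normr_ge0 _) Ss iw (Nat Sd) (aeint_meas i2) C0 e0 b0.
- by rewrite -natr1; ring.
- move=> t; have := gr_rem GD (x t) (y t) (s := at_ t s); rewrite size_map => /(_ sn).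
  rewrite tt// -!mulrA => h; apply: le_trans h.
  by rewrite le_eqVlt; apply/orP; left; apply/eqP; congr `|_|; rewrite /=; ring.
rewrite E tt ?Lp_norm_ge0// -[leRHS]mulrA [X in _ <= _ * X]mulrC [leRHS]mulrA.
apply: le_powR_limit => //; [|exact: Lp_norm_ge0|].
  by rewrite !mulr_ge0 ?powR_ge0 ?PN_ge0 ?addr_ge0// => ?; exact: Lp_norm_ge0.
move=> c1 Nc; have c10 : 0 < c1 by apply: le_lt_trans Nc; exact: Lp_norm_ge0.
have h : Int mu (fun t => `|(y - x) t| `^ p) <= c1 `^ p.
  by rewrite -Lp_norm_powR//; apply: powR_le_mono; rewrite ?Lp_norm_ge0 ?(ltW p0)// ltW.
have W40 : 0 < 4 * W by rewrite mulr_gt0.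
have := b (4 * W) c1 W40 c10 hw h.
by rewrite mulrAC.
Qed.

Let hol_bound x y s W : S x -> S y -> inS S s -> size s = n -> 0 < W -> N x <= W -> N y <= W ->
  `|DInt y s - DInt x s| <=
    (2 + (size s)%:R) * C * (4 * W) `^ (p - n%:R - al) * N (y - x) `^ al * PN N s.
Proof.
move=> Sx Sy Ss sn W0 xW yW; have Sd := SB Sy Sx.
have [iy _] := bound Sy Ss (eq_leq sn); have [ix _] := bound Sx Ss (eq_leq sn).
have [i1 E1] := aeint_lin (-1) ix iy.
have E : DInt y s - DInt x s =
    Int mu (fun t => -1 * D (x t) (at_ t s) + D (y t) (at_ t s)).
  by rewrite E1 /DInt; ring.
have e0 := growth_exp_ge0 np (leqnn n).
have [iw hw] := Lp_add_powR p1 Sx Sy xW yW.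
have [||_ b] := @Lp_product_bound _ _ _ mu X p p1 _
  (fun t => `|x t| + `|y t|) (fun t => `|(y - x) t|) s C (p - n%:R - al) al
  (fun t => addr_ge0 (normr_ge0 _) (normr_ge0 _))
  (fun t => normr_ge0 _) Ss iw (Nat Sd) (aeint_meas i1) C0 e0 (ltW al0).
- by rewrite sn; ring.
- move=> t; have := gr_hol GD (x t) (y t) (s := at_ t s); rewrite size_map => /(_ sn).
  rewrite -!mulrA => h; apply: le_trans h.
  by rewrite le_eqVlt; apply/orP; left; apply/eqP; congr `|_|; rewrite /=; ring.
rewrite E mulrAC.
apply: le_powR_limit; rewrite ?(ltW al0) ?Lp_norm_ge0//.
  by rewrite !mulr_ge0 ?powR_ge0 ?PN_ge0 ?addr_ge0// => ?; exact: Lp_norm_ge0.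
move=> c1 Nc; have c10 : 0 < c1 by apply: le_lt_trans Nc; exact: Lp_norm_ge0.
have h : Int mu (fun t => `|(y - x) t| `^ p) <= c1 `^ p.
  by rewrite -Lp_norm_powR//; apply: powR_le_mono; rewrite ?Lp_norm_ge0 ?(ltW p0)// ltW.
have W40 : 0 < 4 * W by rewrite mulr_gt0.
have := b (4 * W) c1 W40 c10 hw h.
by rewrite mulrAC.
Qed.

Let DInt_lin u : S u -> mlin S n (DInt u).
Proof.
move=> Su s1 s2 a v w S1 S2 Sv Sw sn; rewrite /DInt.
have SS z : S z -> inS S (s1 ++ z :: s2).
  by move=> Sz; apply/inS_cat; split; [exact: S1|apply/inS_cons; split; [exact: Sz|exact: S2]].
have sz (z : T -> X) : (size (s1 ++ z :: s2) <= n)%N by rewrite size_cat /= addnS.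
have [iv _] := bound Su (SS _ Sv) (sz v); have [iw _] := bound Su (SS _ Sw) (sz w).
have [_ <-] := aeint_lin a iv iw.
congr Int; apply/funext => t; rewrite !map_cat /=.
have l : mlin setT n (D (u t)) := gr_lin GD (u t).
by apply: l; rewrite // !size_map.
Qed.

Lemma DInt_Hol (Rr : R) : 0 < Rr ->
  exists K, Hol S N n al [set x | S x /\ N x < Rr] K DInt.
Proof.
move=> R0.
(* A base of at least 1 makes this dominate every [W ^ e] with [W <= 4 * Rr] and [0 <= e <= p]. *)
pose Q := (1 + 4 * Rr) `^ p.
pose K := (2 + n%:R) * C * Q.
have Q0 : 0 <= Q by exact: powR_ge0.
have n20 : 0 <= 2 + n%:R :> R by rewrite addr_ge0.
have QW (W e : R) : 0 <= W -> W <= 4 * Rr -> 0 <= e <= p -> W `^ e <= Q.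
  move=> W0 WR /andP[e0 ep]; apply: (@le_trans _ _ ((1 + 4 * Rr) `^ e)).
    by apply: powR_le_mono => //; apply: (le_trans WR); rewrite lerDr.
  by apply: ler_powR; rewrite // lerDl mulr_ge0// ltW.
have KW (W e : R) k : (k <= n)%N -> 0 <= W -> W <= 4 * Rr -> 0 <= e <= p ->
    (2 + k%:R) * C * W `^ e <= K.
  move=> kn W0 WR ep; rewrite /K ler_pM ?mulr_ge0 ?addr_ge0 ?powR_ge0 ?QW//.
  by rewrite ler_wpM2r// lerD2l ler_nat.
have P0 s : 0 <= PN N s by apply: PN_ge0 => ?; exact: Lp_norm_ge0.
have R4 : Rr <= 4 * Rr by rewrite ler_peMl ?(ltW R0)// ler1n.
have R40 : 0 <= 4 * Rr by rewrite mulr_ge0// ltW.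
exists K; split.
- by rewrite !mulr_ge0.
- by move=> x [Sx _]; exact: DInt_lin.
- move=> x s [Sx xR] Ss sn; have [_ b] := bound Sx Ss sn.
  apply: le_trans (b _ R0 (ltW xR)) _; rewrite ler_wpM2r// KW ?(ltW R0)//.
  exact: jp.
- move=> x y s [Sx xR] [Sy yR] Ss sn.
  apply: le_trans (rem_bound Sx Sy Ss sn R0 (ltW xR) (ltW yR)) _.
  rewrite ler_wpM2r// ler_wpM2r ?mulr_ge0 ?Lp_norm_ge0 ?powR_ge0// KW ?(ltnW sn)//.
  exact: ejp.
- move=> x y s [Sx xR] [Sy yR] Ss sn.
  apply: le_trans (hol_bound Sx Sy Ss sn R0 (ltW xR) (ltW yR)) _.
  rewrite ler_wpM2r// ler_wpM2r ?powR_ge0// KW ?sn//.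
  exact: ejp.
Qed.

Lemma DInt_low u : S u -> c * N u `^ p <= DInt u [::].
Proof.
move=> Su; have [i _] := bound (s := [::]) Su (fun _ h => match notF h with end) (leq0n _).
have [i1 E1] := aeint_lin c (Nat Su) (Int_powR0 mu X p1).1.
rewrite Lp_norm_powR//; have := Int_le i1 i.
rewrite E1 (Int_powR0 mu X p1).2 addr0; apply.
apply: aeW => t /=; rewrite normr0 powR0 ?gt_eqF// addr0; exact: (gr_low GD).
Qed.

Lemma DInt0 : DInt 0 [::] = 0.
Proof.
rewrite /DInt -(Int_powR0 mu X p1).2; congr Int; apply/funext => t.
have := gr_bound GD 0 (s := [::]) (leq0n _).
rewrite normr0 subr0 powR0 ?gt_eqF// mulr0 mul0r normr_le0 => /eqP.
by move=> E; exact: E.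
Qed.

Lemma growth_bump (r : R) : r = n%:R + al -> exists g : (T -> X) -> R,
  is_bump S N g /\ uniformly_Hs_smooth S N r g.
Proof.
move=> rE.
(* [c * R1 ^ p = 1], so the integral functional is at least 1, and its cutoff 0, beyond radius
   [R1]. *)
have [R1 R10 R1p] : exists2 R1, 0 < R1 & R1 `^ p = c^-1.
  exists (c^-1 `^ p^-1); first by rewrite powR_gt0// invr_gt0.
  by rewrite -powRrM mulVf ?gt_eqF// powRr1// invr_ge0 ltW.
(* By the quasi-triangle inequality a point within distance 1 of the ball of radius [R1] has norm at
   most [4 * (R1 + 1) < R2]. *)
pose R2 := 4 * (R1 + 1) + 1; have R20 : 0 < R2 by rewrite /R2; lra.
have [K HK] := DInt_Hol R20.
have N0 : forall x, 0 <= N x by move=> x; exact: Lp_norm_ge0.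
have H1 := Hol_comb 1 (-1) (@Hol_const _ _ S N n al N0 [set x | S x /\ N x < R2] 1) HK.
set D1 := (X in Hol _ _ _ _ _ _ X) in H1.
have D1E x : D1 x [::] = 1 - DInt x [::] by rewrite /D1 /= mulr1 mulN1r.
have [K3 H3] := @Hol_comp _ _ S N n al N0 (Lp_norm0 mu X p1) (Lp_set0 mu X p1) SB al01 n0
  (@ptau R n.+2) (@ptau_smooth R n) _ _ D1 (fun x (h : S x /\ N x < R2) => h.1) H1.
have big x s : S x -> R1 <= N x -> Dcomp (@ptau R n.+2) D1 x s = 0.
  move=> Sx xR; rewrite Dcomp_ptau_le0// D1E subr_le0.
  apply: le_trans (DInt_low Sx); rewrite -ler_pdivrMl// mulr1.
  by rewrite -R1p; apply: (powR_le_mono (ltW p0) (ltW R10) xR).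
have [|||||K4 H4] := @Hol_glue _ _ S N n al N0 SB al01 K3 (Dcomp (@ptau R n.+2) D1) R1 R2 1 ltr01.
- by rewrite /R2; lra.
- move=> x y Sx Sy xy yR; rewrite leNgt; apply/negP => xR.
  have := @Lp_norm_quasi _ _ _ mu X p p1 x (y - x) (R1 + 1) Sx (SB Sy Sx).
  rewrite addrCA subrr addr0 => h.
  have h1 : N x <= R1 + 1 by apply: (le_trans (ltW xR)); rewrite lerDl.
  have h2 : N (y - x) <= R1 + 1 by apply: (le_trans (ltW xy)); rewrite lerDr ltW.
  by have := le_trans yR (h h1 h2); rewrite /R2 gerDl ler10.
- by move=> x; exact: Lp_normN.
- exact: H3.
- by move=> x s Sx /andP[xR _]; exact: big.
have al_r : r - n%:R = al by rewrite rE addrC addKr.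
exists (fun x => if N x < R1 then Dcomp (@ptau R n.+2) D1 x [::] else 0); split.
  split.
    exists 0; split; first exact: Lp_set0.
    rewrite (Lp_norm0 mu X p1) R10 Dcomp_ptau_nil D1E DInt0 subr0 /ppow ltr01.
    by rewrite expr1n oner_neq0.
  by exists R1 => x _; case: ifP => [/ltW//|_]; rewrite eqxx.
have nr : n%:R < r by rewrite rE ltrDl.
have rn : r <= n.+1%:R by rewrite rE -natr1 lerD2l; case/andP: al01.
rewrite -al_r in H4.
exact: (@Hol_uniformly_smooth _ _ S N N0 n r nr rn K4 _ H4).
Qed.

End IntegralFunctional.

Theorem X_bump_Lp (R : realType) (d : measure_display) (T : measurableType d)
  (mu : {measure set T -> \bar R}) (X : normedModType R) (r p : R) :
  1 < r -> r <= p ->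
  (exists g : X -> R, is_bump setT (fun x : X => `|x|) g /\ uniformly_Hs_smooth setT (fun x : X => `|x|) r g) ->
  exists g : (T -> X) -> R, is_bump (Lp_set mu p) (Lp_norm mu p) g /\
        uniformly_Hs_smooth (Lp_set mu p) (Lp_norm mu p) r g.
Proof.
move=> r1 rp /(annular_bump r1)[n [K [D [rho [dl [R0 [c0 [nr rn HD [[h1 h2 h3 h4] h5 h6 h7]]]]]]]]].
have al01 : 0 < r - n%:R <= 1.
  by rewrite subr_gt0 nr lerBlDl (le_trans rn)// -natr1.
(* Here [r <= p] enters: it makes the exponents of the base points in [growth] nonnegative. *)
have np : n%:R + (r - n%:R) <= p by rewrite addrC subrK.
have n0 : (0 < n)%N by rewrite lt0n; apply: contraTneq rn => ->; rewrite -ltNge.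
have G := dsum_growth al01 np HD h1 h2 h3 h4 h5 h6 h7.
have p1 : 1 <= p by apply: le_trans rp; exact: ltW.
apply: (growth_bump mu p1 al01 np _ _ n0 G).
- by rewrite !mulr_ge0 ?powR_ge0// (Hol_ge0 HD).
- by rewrite mulr_gt0// powR_gt0// mulr_gt0.
- by rewrite addrC subrK.
Qed.

(** * Disjoint sets of positive finite measure *)

Section DisjointSets.
Variables (R : realType) (d : measure_display) (T : measurableType d).
Variable mu : {measure set T -> \bar R}.

Definition posfin (A : set T) := [/\ measurable A, mu A != 0%E & mu A != +oo%E].

Definition disjoint_family (E : set T) (q : nat) (A : nat -> set T) :=
  (forall i, (i < q)%N -> posfin (A i) /\ A i `<=` E) /\
  forall i j t, (i < q)%N -> (j < q)%N -> A i t -> A j t -> i = j.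

Definition large (E : set T) := forall q, exists A, disjoint_family E q A.

Lemma pinfty_sub (A B : set T) : measurable A -> measurable B -> A `<=` B ->
  mu B != +oo%E -> mu A != +oo%E.
Proof.
move=> mA mB AB; apply: contra => /eqP Ao; rewrite -leye_eq -Ao.
by apply: le_measure; rewrite ?inE.
Qed.

Lemma posfin_sub (A B : set T) : measurable A -> A `<=` B -> posfin B -> mu A != 0%E -> posfin A.
Proof. by move=> mA AB [mB _ Boo] A0; split=> //; exact: pinfty_sub Boo. Qed.

Lemma large_sub (E F : set T) : E `<=` F -> large E -> large F.
Proof.
move=> EF lE q; have [A [h1 h2]] := lE q; exists A; split=> // i iq.
by have [? AE] := h1 i iq; split=> //; exact: subset_trans EF.
Qed.

(** Pigeonhole: each of [q1 + q2] disjoint sets of positive measure meets [F] or its complement in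
    positive measure, so one side receives [q1] or the other [q2] of them. *)
Lemma large_split (E F : set T) : measurable F -> large E -> large (E `&` F) \/ large (E `\` F).
Proof.
move=> mF lE; apply: contrapT => /not_orP[/existsNP[q1 n1] /existsNP[q2 n2]].
have [A [h1 h2]] := lE (q1 + q2)%N.
have part (G : set T) (q : nat) (P : pred nat) : measurable G ->
    (forall i, (i < q1 + q2)%N -> P i -> mu (A i `&` G) != 0%E) ->
    (q <= size (seq.filter P (iota 0 (q1 + q2))))%N ->
    exists B, disjoint_family (E `&` G) q B.
  move=> mG HP qs; set I := seq.filter P _ in qs.
  have Imem k : (k < q)%N -> (nth 0%N I k < q1 + q2)%N /\ P (nth 0%N I k).
    move=> kq; have : nth 0%N I k \in I by rewrite mem_nth// (leq_trans kq).
    by rewrite mem_filter mem_iota add0n /= => /andP[].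
  exists (fun k => A (nth 0%N I k) `&` G); split=> [k kq|i j t iq jq [Ai _] [Aj _]].
    have [k1 k2] := Imem k kq; have [pA AE] := h1 _ k1; have [mA _ _] := pA; split.
      by apply: (posfin_sub _ (@subIsetl _ _ _) pA); [exact: measurableI|exact: HP].
    by move=> t [At Gt]; split=> //; exact: AE.
  have := h2 _ _ t (Imem i iq).1 (Imem j jq).1 Ai Aj.
  move/eqP; rewrite nth_uniq; first by move/eqP.
  - exact: leq_trans qs.
  - exact: leq_trans qs.
  - by rewrite filter_uniq// iota_uniq.
pose P1 i := mu (A i `&` F) != 0%E.
have [s1|s1] := leqP q1 (size (seq.filter P1 (iota 0 (q1 + q2)))).
  by apply: n1; apply: (part F q1 P1).
apply: n2; rewrite setDE; apply: (part _ q2 (predC P1)); first exact: measurableC.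
- move=> i iq /=; rewrite negbK => /eqP A0; have [[mA A1 _] _] := h1 i iq.
  rewrite -setDE; apply: contra A1 => /eqP A2.
  rewrite (measureDI mu mA mF) [X in (X + _)%E](_ : _ = 0%E)//.
  by rewrite [X in (_ + X)%E](_ : _ = 0%E)// adde0.
- have := count_predC P1 (iota 0 (q1 + q2)); rewrite size_iota !size_filter in s1 *.
  by move: (count P1 _) (count (predC P1) _) s1 => a b; lia.
Qed.

(** Take two disjoint sets. If removing the first destroys largeness, the first is itself large
    within [E], and the second can be removed instead. *)
Lemma large_step (E : set T) : measurable E -> large E ->
  exists A, [/\ posfin A, A `<=` E & large (E `\` A)].
Proof.
move=> mE lE; have [A [h1 h2]] := lE 2%N.
have [p0 A0E] := h1 0%N isT; have [p1 A1E] := h1 1%N isT; have [m0 _ _] := p0.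
have [l|l] := large_split m0 lE; last by exists (A 0%N).
exists (A 1%N); split=> //; apply: large_sub l => t [Et A0t]; split=> // A1t.
by have := h2 0%N 1%N t isT isT A0t A1t.
Qed.

Lemma large_sequence : large setT -> exists A : nat -> set T, (forall i, posfin (A i)) /\
  forall i j t, A i t -> A j t -> i = j.
Proof.
move=> l0.
pose good (E : set T) := measurable E /\ large E.
have step (E : {E | good E}) : {A | [/\ posfin A, A `<=` sval E & large (sval E `\` A)]}.
  by apply: cid; case: E => E [mE lE] /=; exact: large_step.
have nextP (E : {E | good E}) : good (sval E `\` sval (step E)).
  case: (step E) => A [[mA _ _] _ lA] /=; split=> //; apply: measurableD => //.
  by case: E {step lA} => E [].
pose Es := fix Es k : {E | good E} := if k is k'.+1 then exist _ _ (nextP (Es k'))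
  else exist _ setT (conj measurableT l0).
pose A k := sval (step (Es k)).
have AE k : A k `<=` sval (Es k) by rewrite /A; case: (step (Es k)) => B [].
have decr i j t : (i < j)%N -> sval (Es j) t -> ~ A i t.
  elim: j => [//|j IH] /=; rewrite ltnS leq_eqVlt => /orP[/eqP ->|ij] [h1 h2] //.
  exact: IH.
exists A; split=> [i|i j t Ai Aj]; first by rewrite /A; case: (step (Es i)) => B [].
have [ij|ji|//] := ltngtP i j.
  by case: (decr i j t ij (AE j t Aj) Ai).
by case: (decr j i t ji (AE i t Ai) Aj).
Qed.

Lemma negligible_seq (Y : eqType) (s : seq Y) (F : Y -> set T) :
  (forall y, y \in s -> mu.-negligible (F y)) ->
  mu.-negligible (\bigcup_(y in [set` s]) F y).
Proof.
elim: s => [_|y s IH H].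
  by apply: (negligibleS _ (negligible_set0 mu)) => t [y].
have h1 : mu.-negligible (F y) by apply: H; rewrite inE eqxx.
have h2 := IH (fun z zs => H z (eq_ind_r is_true (introT orP (or_intror zs)) (in_cons y s z))).
apply: (negligibleS _ (negligibleU h1 h2)) => t [z /=]; rewrite inE => /orP[/eqP ->|zs] Ft.
  by left.
by right; exists z.
Qed.

Lemma ae_exists (A : set T) (P : T -> Prop) : measurable A -> mu A != 0%E ->
  {ae mu, forall t, P t} -> exists t, A t /\ P t.
Proof.
move=> mA A0 aP; apply: contrapT => /forallNP h; move/eqP: A0; apply.
apply: measure_negligible => //; apply: negligibleS aP => t At /= Pt.
by apply: (h t).
Qed.

(** A simple function has finitely many values and an atom is no finite union of null sets; so each
    approximation is a.e. constant on the atom, and so is the limit. *)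
Lemma atom_const (X : normedModType R) (A : set T) (f : T -> X) :
  measurable A -> mu A != 0%E ->
  (forall B, measurable B -> mu (A `&` B) = 0%E \/ mu (A `\` B) = 0%E) ->
  strongly_measurable mu f -> exists a, {ae mu, forall t, A t -> f t = a}.
Proof.
move=> mA A0 atom [F [sF cF]].
have val m : exists y, {ae mu, forall t, A t -> F m t = y}.
  apply: contrapT => /forallNP h; move/eqP: A0; apply.
  have [fin mF] := sF m.
  have [s sE] := (finite_seqP _).1 fin.
  apply: measure_negligible => //.
  have sub : A `<=` \bigcup_(y in [set` s]) (A `&` F m @^-1` [set y]).
    by move=> t At; exists (F m t) => //; rewrite -sE; exists t.
  apply: (negligibleS sub).
  apply: negligible_seq => y _.
  have mB := mF y; have mAB : measurable (A `&` F m @^-1` [set y]) by exact: measurableI.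
  apply/negligibleP => //; have [//|Ay] := atom _ mB.
  case: (h y); exists (A `\` F m @^-1` [set y]); split=> //; first exact: measurableD.
  move=> t /= ht; apply: contrapT => hn; apply: ht => At.
  by apply: contrapT => Fy; apply: hn.
have [y yP] := choice val.
have aP : {ae mu, forall t, (forall m, A t -> F m t = y m) /\ (fun m => F m t) @ \oo --> f t}.
  by apply: filterS2 (ae_foralln yP) cF => t.
have [t0 [At0 [c1 c2]]] := ae_exists mA A0 aP.
exists (f t0); apply: filterS aP => t [d1 d2] At.
have E : (fun m => F m t) = (fun m => F m t0).
  by apply/funext => m; rewrite d1// c1.
rewrite E in d2; exact: (cvg_unique _ d2 c2).
Qed.

(** Each level set of [|f| ^ p] above a positive threshold has measure 0 or infinity inside [B], and
    integrability excludes infinity. *)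
Lemma outside_zero (X : normedModType R) (p : R) (B : set T) (f : T -> X) : 0 < p ->
  measurable B -> (forall C, measurable C -> C `<=` B -> mu C = 0%E \/ mu C = +oo%E) ->
  Lp_set mu p f -> {ae mu, forall t, B t -> f t = 0}.
Proof.
move=> p0 mB HB /Lp_setE[sf /Int_int[g [ig fg _]]].
have /integrableP[mg gfin] := ig.
have mg' : measurable_fun setT g by exact/measurable_EFinP.
pose C k := B `&` [set t | k.+1%:R^-1 <= `|g t|].
have mC k : measurable (C k).
  apply: measurableI => //; rewrite -[X in measurable X]setTI.
  apply: (measurable_fun_le measurableT); first exact: measurable_cst.
  exact: measurableT_comp.
have C0 k : mu (C k) = 0%E.
  have [//|Coo] := HB (C k) (mC k) (@subIsetl _ _ _).
  have k0 : 0 < k.+1%:R^-1 :> R by rewrite invr_gt0.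
  suff : (+oo <= \int[mu]_t `|(g t)%:E|)%E by rewrite leye_eq => /eqP h; rewrite h in gfin.
  have mi : measurable_fun setT (fun t => (\1_(C k) t : R)%:E).
    by apply/measurable_EFinP; exact: measurable_indic.
  have <- : (\int[mu]_t ((k.+1%:R^-1)%:E * (\1_(C k) t)%:E))%E = +oo%E.
    rewrite ge0_integralZl//.
    by rewrite integral_indic// setIT Coo gt0_muley// lte_fin.
  apply: ge0_le_integral; first exact: measurableT.
  - by move=> t _; rewrite -EFinM lee_fin mulr_ge0.
  - by apply: emeasurable_funM; [exact: measurable_cst|exact: mi].
  - by apply/measurable_EFinP; apply: measurableT_comp.
  move=> t _; rewrite -EFinM lee_fin indicE.
  case: (boolP (t \in C k)) => /= h; last by rewrite mulr0.
  by rewrite mulr1; move: h; rewrite inE => -[].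
have aC : {ae mu, forall t, forall k, ~ C k t}.
  apply: ae_foralln => k; exists (C k); split=> // t /= h.
  by apply: contrapT.
apply: filterS2 fg aC => t ft Ct Bt.
apply: contrapT => /eqP f0.
have fp : 0 < `|g t| by rewrite -ft normr_gt0 gt_eqF// powR_gt0// normr_gt0.
have [k kP] := ltr_add_invr fp.
by apply: (Ct k); split=> //=; rewrite ltW//; move: kP; rewrite add0r.
Qed.

(** A disjoint family of maximal size [q] consists of atoms, outside of which all functions of [L_p]
    vanish; the dimension would then be at most [q]. *)
Lemma infinite_dim_large (p : R) : 1 <= p -> Lp_infinite_dim mu p -> large setT.
Proof.
move=> p1 idim; have p0 : 0 < p by apply: lt_le_trans p1.
apply: contrapT => nl.
have [q [[A [hA dA]] qmax]] : exists q, (exists A, disjoint_family setT q A) /\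
    ~ exists A, disjoint_family setT q.+1 A.
  apply: contrapT => h; apply: nl; elim=> [|q IH]; first by exists (fun=> set0).
  by apply: contrapT => hq; apply: h; exists q.
have atoms i B : (i < q)%N -> measurable B -> mu (A i `&` B) = 0%E \/ mu (A i `\` B) = 0%E.
  move=> iq mB; apply: contrapT => /not_orP[/eqP B1 /eqP B2]; apply: qmax.
  have [pA _] := hA i iq; have [mA _ _] := pA.
  (* If [A i] could be split, the new index [q] would receive one part and [i] keep the other. *)
  exists (fun k => if k == q then A i `&` B else if k == i then A i `\` B else A k); split.
    move=> k kq; split=> //; case: eqP => [_|/eqP kq'].
      by apply: (posfin_sub _ (@subIsetl _ _ _) pA) => //; exact: measurableI.
    case: eqP => [_|_]; first by apply: (posfin_sub _ (@subDsetl _ _ _) pA) => //; exact: measurableD.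
    by apply: (hA k _).1; rewrite ltn_neqAle kq' -ltnS.
  move=> k l t; rewrite !ltnS => kq lq.
  case: (k =P q) => [->|/eqP kq']; case: (l =P q) => [->|/eqP lq'] //.
  - case: (l =P i) => [->|/eqP li] [Ai Bt]; first by case.
    move=> Al; have lq2 : (l < q)%N by rewrite ltn_neqAle lq'.
    by rewrite (dA _ _ t iq lq2 Ai Al) eqxx in li.
  - case: (k =P i) => [->|/eqP ki] h [Ai Bt]; first by case: h => _ /(_ Bt).
    have kq2 : (k < q)%N by rewrite ltn_neqAle kq'.
    by rewrite (dA _ _ t kq2 iq h Ai) eqxx in ki.
  - have kq2 : (k < q)%N by rewrite ltn_neqAle kq'.
    have lq2 : (l < q)%N by rewrite ltn_neqAle lq'.
    have sub z : (if z == i then A i `\` B else A z) `<=` A z.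
      by case: eqP => [->|_]; [exact: subDsetl|].
    by move=> /sub h1 /sub h2; exact: dA h1 h2.
pose B := ~` \bigcup_(i in [set i | (i < q)%N]) A i.
have mB : measurable B.
  by apply: measurableC; apply: bigcup_measurable => i iq; case: (hA i iq) => -[].
have outside C : measurable C -> C `<=` B -> mu C = 0%E \/ mu C = +oo%E.
  move=> mC CB; apply: contrapT => /not_orP[/eqP C1 /eqP C2]; apply: qmax.
  exists (fun k => if k == q then C else A k); split.
    move=> k kq; split=> //; case: eqP => [_|/eqP kq']; first by [].
    by apply: (hA k _).1; rewrite ltn_neqAle kq' -ltnS.
  move=> k l t; rewrite !ltnS => kq lq.
  case: (k =P q) => [->|/eqP kq']; case: (l =P q) => [->|/eqP lq'] //.
  - by move=> /CB h Al; case: h; exists l => //=; rewrite ltn_neqAle lq'.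
  - by move=> Ak /CB h; case: h; exists k => //=; rewrite ltn_neqAle kq'.
  - by move=> h1 h2; apply: dA h1 h2; rewrite ltn_neqAle ?kq' ?lq'.
have [f [fS find]] := idim q.+1.
have vals (z : 'I_q.+1 * 'I_q) : exists a, {ae mu, forall t, A z.2 t -> f z.1 t = a}.
  have [[mA A0 _] _] := hA z.2 (ltn_ord _).
  apply: atom_const => //; first by move=> C; apply: atoms; exact: ltn_ord.
  by case: (fS z.1).
have [a aP] := choice vals.
have zeros (i : 'I_q.+1) : {ae mu, forall t, B t -> f i t = 0}.
  exact: outside_zero p0 mB outside (fS i).
(* Row [i] holds the values of [f i] on the atoms. With more rows than columns, a nonzero
   combination of the rows vanishes. *)
pose M : 'M[R]_(q.+1, q) := \matrix_(i, j) a (i, j).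
have [c c0 cM] : exists2 c : 'rV[R]_q.+1, c != 0 & c *m M = 0.
  have : kermx M != 0.
    by rewrite -mxrank_eq0 mxrank_ker subn_eq0 -ltnNge ltnS; exact: rank_leq_col.
  move=> /rowV0Pn[c ck c0]; exists c => //; exact/sub_kermxP.
have zero : {ae mu, forall t, \sum_(i < q.+1) c 0 i * f i t = 0}.
  have h1 : {ae mu, forall t, forall z : 'I_q.+1 * 'I_q, A z.2 t -> f z.1 t = a z}.
    exact: filter_forall.
  have h2 : {ae mu, forall t, forall i : 'I_q.+1, B t -> f i t = 0}.
    exact: filter_forall.
  apply: filterS2 h1 h2 => t k1 k2.
  have [[j [jq Aj]]|no] := pselect (exists j, (j < q)%N /\ A j t).
    transitivity ((c *m M) 0 (Ordinal jq)); last by rewrite cM mxE.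
    rewrite mxE; apply: eq_bigr => i _; rewrite mxE.
    by rewrite (k1 (i, Ordinal jq)).
  rewrite big1// => i _; rewrite k2 ?mulr0// => -[j /= jq Aj].
  by apply: no; exists j.
have : Lp_norm mu p (fun t => \sum_(i < q.+1) c 0 i * f i t) = 0.
  rewrite /Lp_norm /Lp_integral (@ge0_integral_ae _ _ _ mu _ (cst 0%E)).
  - by rewrite integral0 powR0// invr_neq0// gt_eqF.
  - by move=> t; rewrite lee_fin powR_ge0.
  - by [].
  by apply: filterS zero => t ->; rewrite normr0 powR0// gt_eqF.
move=> /find c00; move/eqP: c0; apply; apply/rowP => i; rewrite mxE; exact: c00.
Qed.

End DisjointSets.

(** * Embedding l_p(X) into L_p(X) *)

Section SequenceSpace.
Variables (R : realType) (d : measure_display) (T : measurableType d).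
Variable mu : {measure set T -> \bar R}.
Variable X : normedModType R.
Variable p : R.
Hypothesis p1 : 1 <= p.
Let p0 : 0 < p. Proof. exact: lt_le_trans ltr01 p1. Qed.
Local Notation S := (@Lp_set R d T mu X p).
Local Notation N := (@Lp_norm R d T mu X p).
Variable A : nat -> set T.
Hypothesis pA : forall i, posfin mu (A i).
Hypothesis dA : forall i j t, A i t -> A j t -> i = j.

Lemma Lp_integral_norm (u : T -> X) : S u -> Lp_integral mu p u = (N u `^ p)%:E.
Proof.
move=> Su; rewrite (Lp_norm_powR p1 Su) /Lp_integral.
have [_ ->//] := aeint_ge0P (fun t => powR_ge0 `|u t| p) (aemeas_powR p (aemeas_norm Su.1)).
by case/Lp_setE: Su.
Qed.

(** Normalises the indicator of [A j] to norm 1 in [L_p]. *)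
Definition weight (j : nat) : R := fine (mu (A j)) `^ (- p^-1).

(* The isometric embedding of [l_p(X)] into [L_p(X)] along the disjoint sets [A j]. *)
Definition embed (x : nat -> X) (t : T) : X :=
  if pselect (exists j, A j t) is left e then weight (sval (cid e)) *: x (sval (cid e)) else 0.

Lemma embed_in x j t : A j t -> embed x t = weight j *: x j.
Proof.
move=> Aj; rewrite /embed; case: pselect => [e|[]]; last by exists j.
by case: cid => i /= Ai; rewrite (dA Ai Aj).
Qed.

Lemma embed_out x t : ~ (exists j, A j t) -> embed x t = 0.
Proof. by move=> no; rewrite /embed; case: pselect. Qed.

Lemma embed_lin (a : R) (x y : nat -> X) : embed (a *: x + y) = a *: embed x + embed y.
Proof.
apply/funext => t; rewrite !fctE; have [[j Aj]|no] := pselect (exists j, A j t).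
  by rewrite !(embed_in _ Aj) scalerDr !scalerA mulrC.
by rewrite !embed_out// scaler0 addr0.
Qed.

Definition trunc (k : nat) (x : nat -> X) (j : nat) : X := if (j < k)%N then x j else 0.

Definition single (k : nat) (v : X) (j : nat) : X := if j == k then v else 0.

Lemma weight_powR j : weight j `^ p * fine (mu (A j)) = 1.
Proof.
have [mA A0 Aoo] := pA j; rewrite /weight -powRrM mulNr mulVf ?gt_eqF//.
have f0 : 0 < fine (mu (A j)).
  by rewrite fine_gt0// lt0e A0 measure_ge0/= ltey.
by rewrite powR_inv1 ?ltW// mulVf// gt_eqF.
Qed.

Lemma weight_ge0 j : 0 <= weight j.
Proof. exact: powR_ge0. Qed.

Lemma mu_fine j : mu (A j) = (fine (mu (A j)))%:E.
Proof.
have [mA A0 Aoo] := pA j.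
by rewrite fineK// ge0_fin_numE ?measure_ge0// ltey.
Qed.

(** At each point at most one summand is nonzero; exchanging sum and integral leaves
    [weight j ^ p * mu (A j) = 1]. *)
Lemma embed_integral x : Lp_integral mu p (embed x) = (\sum_(0 <= j <oo) (`|x j| `^ p)%:E)%E.
Proof.
pose F j t : \bar R := (((weight j * `|x j|) `^ p)%:E * (\1_(A j) t)%:E)%E.
have F0 j t : (0 <= F j t)%E by rewrite /F -EFinM lee_fin mulr_ge0// powR_ge0.
have mi j : measurable_fun setT (fun t => (\1_(A j) t : R)%:E).
  by apply/measurable_EFinP; apply: measurable_indic; case: (pA j).
have E t : (`|embed x t| `^ p)%:E = (\sum_(0 <= j <oo) F j t)%E.
  have [[j Aj]|no] := pselect (exists j, A j t); last first.
    rewrite embed_out// normr0 powR0 ?gt_eqF// eseries0// => i _ _.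
    by rewrite /F indicE memNset ?mule0// => Ai; apply: no; exists i.
  rewrite (embed_in _ Aj) normrZ ger0_norm ?weight_ge0//.
  rewrite (nneseries_split 0 j.+1)//= add0n [X in (_ + X)%E]eseries0 ?adde0; last first.
    move=> i ji _; rewrite /F indicE memNset ?mule0// => Ai.
    by move: ji; rewrite (dA Ai Aj) ltnn.
  rewrite big_nat_recr//= big1_seq ?add0e; last first.
    move=> i /andP[_]; rewrite mem_index_iota => /andP[_ ij].
    by rewrite /F indicE memNset ?mule0// => Ai; move: ij; rewrite (dA Ai Aj) ltnn.
  by rewrite /F indicE mem_set// mule1.
rewrite /Lp_integral; under eq_integral do rewrite E.
rewrite integral_nneseries//; last first.
  by move=> j; apply: emeasurable_funM; [exact: measurable_cst|exact: mi].
apply: eq_eseriesr => j _; have [mA _ _] := pA j.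
rewrite ge0_integralZl//; last by rewrite lee_fin powR_ge0.
rewrite integral_indic// setIT mu_fine -EFinM; congr EFin.
by rewrite powRM ?weight_ge0// mulrAC weight_powR mul1r.
Qed.

Lemma embed_trunc_simple k x : simple_map (embed (trunc k x)).
Proof.
elim: k => [|k IH].
  have -> : embed (trunc 0 x) = fun=> 0.
    apply/funext => t; have [[j Aj]|no] := pselect (exists j, A j t).
      by rewrite (embed_in _ Aj) /trunc scaler0.
    by rewrite embed_out.
  exact: simple_map_cst.
have -> : embed (trunc k.+1 x) = fun t => embed (trunc k x) t +
    (if `[< A k t >] then weight k *: x k else 0).
  apply/funext => t; have [[j Aj]|no] := pselect (exists j, A j t); last first.
    rewrite !embed_out// asboolF ?addr0// => Ak; apply: no; by exists k.
  rewrite !(embed_in _ Aj) /trunc ltnS leq_eqVlt.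
  have [jk|jk] := eqVneq j k.
    by rewrite jk ltnn scaler0 add0r asboolT// -jk.
  by rewrite /= asboolF ?addr0// => Ak; move/eqP: jk; apply; apply: dA Aj Ak.
apply: simple_map2; first exact: IH.
apply: (simple_map1 (fun b : bool => if b then weight k *: x k else 0)).
have [mA _ _] := pA k; split.
  by apply: (@sub_finite_set _ _ setT) => //; exact: finite_finset.
case.
  rewrite (_ : _ @^-1` _ = A k)//; apply/seteqP; split=> t /=; first by move/asboolP.
  by move=> ?; exact/asboolP.
rewrite (_ : _ @^-1` _ = ~` A k); first exact: measurableC.
apply/seteqP; split=> t /=; first by move=> h Ak; rewrite asboolT in h.
by move=> h; rewrite asboolF.
Qed.

Lemma embed_smeas x : strongly_measurable mu (embed x).
Proof.
exists (fun k => embed (trunc k x)); split; first by move=> k; exact: embed_trunc_simple.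
apply: aeW => t; have [[j Aj]|no] := pselect (exists j, A j t); last first.
  by rewrite embed_out//; under eq_fun do rewrite embed_out//; exact: cvg_cst.
apply: cvg_near_cst; exists j.+1 => // k /= jk.
by rewrite !(embed_in _ Aj) /trunc jk.
Qed.

Lemma embed_in_Lp x : (\sum_(0 <= j <oo) (`|x j| `^ p)%:E < +oo)%E -> S (embed x).
Proof. by move=> h; split; [exact: embed_smeas|rewrite embed_integral]. Qed.

Lemma embed_single_integral k v : Lp_integral mu p (embed (single k v)) = (`|v| `^ p)%:E.
Proof.
rewrite embed_integral (nneseries_split 0 k.+1)/= ?add0n; last by move=> *; rewrite lee_fin powR_ge0.
rewrite [X in (_ + X)%E]eseries0 ?adde0; last first.
  by move=> i ki _; rewrite /single gtn_eqF// normr0 powR0// gt_eqF.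
rewrite big_nat_recr//= big1_seq ?add0e; last first.
  move=> i /andP[_]; rewrite mem_index_iota => /andP[_ ik].
  by rewrite /single ltn_eqF// normr0 powR0// gt_eqF.
by rewrite /single eqxx.
Qed.

Lemma embed_single_in k v : S (embed (single k v)).
Proof. by split; [exact: embed_smeas|rewrite embed_single_integral ltry]. Qed.

Lemma embed_single_norm k v : N (embed (single k v)) = `|v|.
Proof. by rewrite /Lp_norm embed_single_integral /= -powRrM mulfV ?gt_eqF// powRr1. Qed.

Lemma single_lin k (a : R) v w : single k (a *: v + w) = a *: single k v + single k w.
Proof.
apply/funext => j; rewrite !fctE /single; case: eqP => //.
by rewrite scaler0 addr0.
Qed.

Lemma trunc_single k x : trunc k.+1 x = trunc k x + single k (x k).
Proof.
apply/funext => j; rewrite !fctE /trunc /single ltnS leq_eqVlt.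
by case: eqP => [->|_] /=; rewrite ?ltnn ?add0r ?addr0.
Qed.

Lemma embedD x y : embed (x + y) = embed x + embed y.
Proof. by rewrite -[x]scale1r embed_lin !scale1r. Qed.

Lemma embed0 : embed 0 = 0.
Proof. by rewrite -[0 in LHS](subrr (0 : nat -> X)) -scaleN1r addrC embed_lin scaleN1r addrC subrr. Qed.

Lemma embed_trunc_in k x : S (embed (trunc k x)).
Proof.
apply: embed_in_Lp.
rewrite (nneseries_split 0 k) ?add0n; last by move=> *; rewrite lee_fin powR_ge0.
rewrite [X in (_ + X)%E]eseries0 ?adde0; last first.
  by move=> i ki _; rewrite /trunc ltnNge ki normr0 powR0// gt_eqF.
by rewrite sumEFin ltry.
Qed.

(** The partial sums are the [p]-th powers of the norms of the truncations. *)
Lemma embed_bounded x B : 0 <= B -> (forall k, N (embed (trunc k x)) <= B) ->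
  (\sum_(0 <= j <oo) (`|x j| `^ p)%:E < +oo)%E.
Proof.
move=> B0 H; apply: (@le_lt_trans _ _ (B `^ p)%:E); last exact: ltry.
apply: lime_le; first by apply: is_cvg_nneseries => *; rewrite lee_fin powR_ge0.
apply: nearW => k.
apply: (@le_trans _ _ (\sum_(0 <= j < k) (`|trunc k x j| `^ p)%:E)%E).
  rewrite le_eqVlt; apply/orP; left; apply/eqP; apply: eq_big_nat => j /andP[_ jk].
  by rewrite /trunc jk.
apply: (@le_trans _ _ (\sum_(0 <= j <oo) (`|trunc k x j| `^ p)%:E)%E).
  by apply: nneseries_lim_ge => *; rewrite lee_fin powR_ge0.
rewrite -embed_integral Lp_integral_norm; last exact: embed_trunc_in.
by rewrite lee_fin; apply: (powR_le_mono (ltW p0) (Lp_norm_ge0 _ _ _) (H k)).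
Qed.

Lemma embed_tail x : (\sum_(0 <= j <oo) (`|x j| `^ p)%:E < +oo)%E ->
  forall eta, 0 < eta -> exists k0, forall k, (k0 <= k)%N -> N (embed x - embed (trunc k x)) <= eta.
Proof.
move=> fin eta eta0.
have pos k : true -> (0 <= (`|x k| `^ p)%:E)%E by move=> _; rewrite lee_fin powR_ge0.
have /fine_cvgP[fn fc] := nneseries_tail_cvg fin pos.
have e0 : 0 < eta `^ p by rewrite powR_gt0.
have [k0 _ H] : \forall k \near \oo, (\sum_(k <= j <oo) (`|x j| `^ p)%:E <= (eta `^ p)%:E)%E.
  near=> k.
  have h1 : (\sum_(k <= j <oo) (`|x j| `^ p)%:E)%E \is a fin_num by near: k.
  have : `|0 - (fine \o (fun k => \sum_(k <= j <oo) (`|x j| `^ p)%:E)%E) k| <= eta `^ p.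
    by near: k; move/cvgrPdist_le: fc; apply.
  rewrite /= sub0r normrN => h2; rewrite -(fineK h1) lee_fin.
  exact: le_trans (ler_norm _) h2.
exists k0 => k k0k.
have E : embed x - embed (trunc k x) = embed (-1 *: trunc k x + x).
  by rewrite embed_lin scaleN1r addrC.
have Sw : S (embed x - embed (trunc k x)).
  by apply: Lp_setB => //; [exact: embed_in_Lp|exact: embed_trunc_in].
apply: (Lp_norm_le p1 Sw (ltW eta0)).
rewrite -(Lp_norm_powR p1 Sw) -lee_fin -Lp_integral_norm// E embed_integral.
apply: le_trans (H k k0k).
rewrite (nneseries_split 0 k) ?add0n; last by move=> *; rewrite lee_fin powR_ge0.
rewrite big1_seq ?add0e; last first.
  move=> j /andP[_]; rewrite mem_index_iota => /andP[_ jk].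
  by rewrite !fctE /trunc jk scaleN1r addNr normr0 powR0// gt_eqF.
apply: lee_nneseries => [j *|j _]; first by rewrite lee_fin powR_ge0.
rewrite !fctE /trunc lee_fin; case: ifP => _.
  by rewrite scaleN1r addNr normr0 powR0 ?powR_ge0// gt_eqF.
by rewrite scaler0 add0r.
Unshelve. all: by end_near. Qed.

End SequenceSpace.

(** * From a bump on L_p(X) to a bump on X *)

Section Pullback.
Variables (R : realType) (V : lmodType R) (S : set V) (N : V -> R) (X : normedModType R).
Local Notation nrm := (fun x : X => `|x|).
Variables (iota_ : X -> V) (u : V).
Hypothesis iota_lin : forall a v w, iota_ (a *: v + w) = a *: iota_ v + iota_ w.
Hypothesis iotaS : forall x, S (u + iota_ x).
Hypothesis iotaS0 : forall x, S (iota_ x).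
Hypothesis iotaN : forall x, N (iota_ x) = `|x|.

Let iotaB x y : u + iota_ y - (u + iota_ x) = iota_ (y - x).
Proof.
have -> : y - x = -1 *: x + y by rewrite scaleN1r addrC.
by rewrite opprD addrACA subrr add0r iota_lin scaleN1r addrC.
Qed.

Let iota_consI k v (h : 'I_k -> X) : iota_ \o consI v h = consI (iota_ v) (iota_ \o h).
Proof. by apply/funext => j; rewrite /consI /=; case: unliftP. Qed.

Let iota_prodN k (h : 'I_k -> X) : prodN N (iota_ \o h) = prodN nrm h.
Proof. by apply: eq_bigr => i _ /=. Qed.

Definition pullback (D : forall k : nat, V -> ('I_k -> V) -> R) :
  forall k : nat, X -> ('I_k -> X) -> R := fun k x h => D k (u + iota_ x) (iota_ \o h).

Lemma pullback_Cn n g D : Cn_derivs S N n g D ->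
  Cn_derivs setT nrm n (fun x => g (u + iota_ x)) (pullback D).
Proof.
move=> [D0 ml df ct]; have inS k (h : 'I_k -> X) : in_S S (iota_ \o h).
  by move=> i; exact: iotaS0.
split.
- by move=> x h _; exact: D0.
- move=> k x kn _; have [l [M HM]] := ml k (u + iota_ x) kn (iotaS x); split.
    move=> h i a v w _ _ _; rewrite /pullback.
    have E (z : X) : iota_ \o (fun j => if j == i then z else h j) =
        (fun j => if j == i then iota_ z else (iota_ \o h) j).
      by apply/funext => j /=; case: eqP.
    by rewrite !E iota_lin; apply: l.
  by exists M => h _; rewrite -iota_prodN; exact: HM.
- move=> k x kn _ e e0; have [del d0 H] := df k _ kn (iotaS x) e e0.
  exists del => // y _ yx h _; rewrite -iota_prodN.
  have := H (u + iota_ y) (iotaS y); rewrite iotaB iotaN => /(_ yx (iota_ \o h) (inS _ _)).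
  by rewrite /pullback iota_consI.
- move=> x _ e e0; have [del d0 H] := ct _ (iotaS x) e e0.
  exists del => // y _ yx h _; rewrite -iota_prodN.
  by apply: H; rewrite // iotaB iotaN.
Qed.

(** The radius is a parameter and the constant existential: only radii are compared between
    points. *)
Definition locally_Hoelder (D : forall k : nat, V -> ('I_k -> V) -> R) (n : nat) (al : R)
  (v : V) (del : R) := exists M : R, forall y z, S y -> S z -> N (y - v) < del -> N (z - v) < del ->
    forall h : 'I_n -> V, in_S S h -> `|D n y h - D n z h| <= M * N (y - z) `^ al * prodN N h.

(* If [g] dropped by [eps] on the whole annulus, the positive part of [g (u + iota_ x) - g u + eps], cut off inside it, would be a uniformly smooth bump on [X]. *)
Lemma bumpless_step (r : R) (n : nat) g D (del eps sg : R) : 1 < r -> n%:R < r -> r <= n.+1%:R ->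
  Cn_derivs S N n g D -> 0 < del -> 0 < eps -> locally_Hoelder D n (r - n%:R) u del ->
  iota_ 0 = 0 ->
  ~ (exists g : X -> R, is_bump setT nrm g /\ uniformly_Hs_smooth setT nrm r g) ->
  exists x, [/\ del / 4 <= `|x|, `|x| <= del / 2 & sg * g u - eps < sg * g (u + iota_ x)].
Proof.
move=> r1 nr rn HD d0 eps0 [M HM] i0 nob.
have al01 : 0 < r - n%:R <= 1.
  by rewrite subr_gt0 nr lerBlDl (le_trans rn)// -natr1.
have n0 : (0 < n)%N by rewrite lt0n; apply: contraTneq rn => ->; rewrite -ltNge.
apply: contrapT => no; apply: nob.
have HX := pullback_Cn HD.
pose U := [set x : X | `|x| < del].
have [C0 HC0] := lD_bound_at HX 0.
have ux x : u + iota_ x - u = iota_ x by rewrite addrC addKr.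
have [|||K HK] := @Cn_derivs_Hol R X n _ _ HX U (r - n%:R) M del C0 al01.
- move=> x y c xU yU /andP[c0 c1]; rewrite /U /= in xU yU *.
  have -> : x + c *: (y - x) = (1 - c) *: x + c *: y.
    by rewrite scalerBr scalerBl scale1r addrA addrAC.
  apply: le_lt_trans (ler_normD _ _) _; rewrite !normrZ !ger0_norm ?subr_ge0//.
  have [c00|c00] := eqVneq c 0; first by rewrite c00 subr0 mul1r mul0r addr0.
  have cp : 0 < c by rewrite lt_neqAle eq_sym c00.
  have h1 : (1 - c) * `|x| <= (1 - c) * del by rewrite ler_wpM2l ?subr_ge0// ltW.
  have h2 : c * `|y| < c * del by rewrite ltr_pM2l.
  by move: h1 h2; lra.
- move=> x y s xU yU sn; rewrite !(lDE _ _ sn) -(prodN_nth sn) -iota_prodN /pullback.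
  have := HM (u + iota_ y) (u + iota_ x) (iotaS _) (iotaS _).
  rewrite !ux !iotaN iotaB iotaN => /(_ yU xU); apply=> i; exact: iotaS0.
- move=> x xU; exists 0; first by rewrite /U /= normr0.
  by rewrite subr0; split=> //; exact: ltW.
pose D' := lD (pullback D).
have D'E x : D' x [::] = g (u + iota_ x).
  by rewrite /D' /lD /pullback /=; have [-> //] := HD; exact: iotaS.
have H1 := Hol_comb sg 1 HK (@Hol_const _ _ setT nrm n (r - n%:R) (fun x => normr_ge0 x) U (eps - sg * g u)).
set D1 := (X in Hol _ _ _ _ _ _ X) in H1.
have D1E x : D1 x [::] = sg * g (u + iota_ x) + (eps - sg * g u).
  by rewrite /D1 -/D' D'E mul1r.
have [K3 H3] := @Hol_comp _ _ setT nrm n (r - n%:R) (fun x => normr_ge0 x) (normr0 _) I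
  (fun _ _ _ _ => I) al01 n0 (@ptau R n.+2) (@ptau_smooth R n) _ _ D1 (fun _ _ => I) H1.
have d4 : 0 < del / 4 by rewrite divr_gt0.
have d42 : del / 4 <= del / 2 by lra.
have d2 : del / 2 < del by lra.
have [||||K4 H4] := @Hol_glue _ _ setT nrm n (r - n%:R) (fun x => normr_ge0 x) (fun _ _ _ _ => I) al01
  K3 (Dcomp (@ptau R n.+2) D1) (del / 4) (del / 2) (del / 4) d4 d42.
- move=> x y _ _ xy y2; have := ler_normD x (y - x); rewrite addrCA subrr addr0.
  by move: xy y2; lra.
- exact: normrN.
- by apply: Hol_le H3 => // x [_ x2]; rewrite /U /=; apply: lt_trans d2.
- move=> x s _ /andP[x1 x2]; rewrite Dcomp_ptau_le0// D1E.
  rewrite leNgt; apply/negP => h; apply: no; exists x; split; [exact: x1|exact: ltW|].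
  by move: h; lra.
exists (fun x => if `|x| < del / 4 then Dcomp (@ptau R n.+2) D1 x [::] else 0); split.
  split.
    exists 0; split=> //; rewrite normr0 d4 Dcomp_ptau_nil D1E i0 addr0 addrC subrK /ppow eps0.
    by rewrite expf_neq0// gt_eqF.
  by exists (del / 4) => x _; case: ifP => [/ltW//|_]; rewrite eqxx.
exact: (@Hol_uniformly_smooth _ _ setT nrm (fun x => normr_ge0 x) n r nr rn K4 _ H4).
Qed.

End Pullback.

Theorem Lp_bump_X (R : realType) (d : measure_display) (T : measurableType d)
  (mu : {measure set T -> \bar R}) (X : normedModType R) (r p : R) :
  Lp_infinite_dim mu p -> 1 < r -> r <= p ->
  (exists g : (T -> X) -> R, is_bump (Lp_set mu p) (Lp_norm mu p) g /\
        Hs_smooth (Lp_set mu p) (Lp_norm mu p) r g) ->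
  exists g : X -> R, is_bump setT (fun x : X => `|x|) g /\ uniformly_Hs_smooth setT (fun x : X => `|x|) r g.
Proof.
move=> idim r1 rp [g [[[v0 [Sv0 gv0]] [B0 gB]] [n [nr rn [D [HD loc]]]]]].
apply: contrapT => nob.
have p1 : 1 <= p by apply: le_trans rp; exact: ltW.
have [A [pA dA]] := large_sequence (infinite_dim_large p1 idim).
set S := Lp_set mu p in Sv0 gB HD loc *; set N := Lp_norm mu p in gB HD loc *.
pose em := embed mu p A (X := X).
pose H := locally_Hoelder S N D n (r - n%:R).
have SD u v : S u -> S v -> S (u + v).
  by move=> Su Sv; rewrite -[u]scale1r; apply: Lp_set_lin.
have Hmono u d1 d2 : d1 <= d2 -> H u d2 -> H u d1.
  move=> d12 [M HM]; exists M => y z Sy Sz yd zd; apply: HM => //; exact: lt_le_trans d12.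
(* The supremum of the admissible radii need not be admissible, so [del] is only more than half of
   it; the cap at 1 keeps the set bounded. *)
have rad u : S u -> exists del, [/\ 0 < del, H u del &
    forall d', 0 < d' -> d' <= 1 -> H u d' -> d' <= 2 * del].
  move=> Su; have [d0 [M [d00 HM]]] := loc u Su.
  pose E := [set x : R | [/\ 0 < x, x <= 1 & H u x]].
  have E0 : E (Num.min d0 1).
    split; first by rewrite lt_min d00 ltr01.
      by rewrite ge_min lexx orbT.
    apply: (@Hmono _ _ d0); first by rewrite ge_min lexx.
    by exists M.
  have hs : has_sup E by split; [exists (Num.min d0 1)|exists 1 => x []].
  have sup0 : 0 < sup E.
    have [h _ _] := E0; apply: (lt_le_trans h); exact: (sup_upper_bound hs).
  have [e [e0 e1 He] es] := sup_adherent (divr_gt0 sup0 (ltr0n R 2)) hs.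
  exists e; split=> // d' d'0 d'1 Hd'.
  have : d' <= sup E by apply: sup_upper_bound.
  by move: es; lra.
(* Covers bumps that are negative at [v0]. *)
pose sg : R := if 0 < g v0 then 1 else -1.
have g00 : 0 < sg * g v0.
  rewrite /sg; case: (ltP 0 (g v0)) => h; first by rewrite mul1r.
  by rewrite mulN1r oppr_gt0 lt_neqAle gv0.
pose g0 := sg * g v0.
(* The permitted losses [g0 / 2 ^ (k + 2)] add up to [g0 / 2], so [sg * g] stays above [g0 / 2]
   along the sequence. *)
pose P (z : (T -> X) * nat) (x : X) := exists del, [/\ 0 < del,
   (forall d', 0 < d' -> d' <= 1 -> H z.1 d' -> d' <= 2 * del), del / 4 <= `|x| &
   sg * g z.1 - g0 * (1 / 2) ^+ z.2.+2 < sg * g (z.1 + em (single z.2 x))].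
have stepP z : exists x, S z.1 -> P z x.
  have [Sz|] := pselect (S z.1); last by exists 0.
  have [del [d0 Hd dmax]] := rad _ Sz.
  have eps0 : 0 < g0 * (1 / 2) ^+ z.2.+2 by rewrite mulr_gt0// exprn_gt0.
  have [|||||x [x1 _ x3]] := @bumpless_step R (T -> X) S N X (fun x => em (single z.2 x)) z.1
    _ _ _ _ r n g D del (g0 * (1 / 2) ^+ z.2.+2) sg r1 nr rn HD d0 eps0 Hd _ nob.
  - by move=> a v w; rewrite single_lin /em embed_lin.
  - by move=> x; exact: (SD _ _ Sz (embed_single_in p1 pA dA z.2 x)).
  - by move=> x; exact: embed_single_in.
  - by move=> x; exact: embed_single_norm.
  - rewrite (_ : single z.2 0 = 0); first exact: embed0.
    by apply/funext => j; rewrite /single; case: eqP.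
  by exists x => _; exists del.
have [nx nxP] := choice stepP.
pose us := fix us k : T -> X := if k is k'.+1 then us k' + em (single k' (nx (us k', k'))) else v0.
pose xs k := nx (us k, k).
have usE k : us k = v0 + em (trunc k xs).
  elim: k => [|k IH] /=.
    rewrite (_ : trunc 0 xs = 0); first by rewrite /em embed0// addr0.
    by apply/funext.
  by rewrite -/(xs k) {1}IH trunc_single /em embedD// addrA.
have usS k : S (us k) by rewrite usE; exact: (SD _ _ Sv0 (embed_trunc_in p1 pA dA k xs)).
have usP k : P (us k, k) (xs k) by apply: nxP; exact: usS.
have usg k : g0 * (1 / 2 + (1 / 2) ^+ k.+1) <= sg * g (us k).
  elim: k => [|k IH]; first by rewrite expr1 /g0 /=; lra.
  have [del [_ _ _ /= h]] := usP k; apply: le_trans (ltW h).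
  rewrite -lerBlDr opprK; apply: le_trans IH.
  rewrite -mulrDr ler_wpM2l ?(ltW g00)// -addrA lerD2l.
  by rewrite [_ ^+ k.+2]exprS; lra.
have gne k : g (us k) != 0.
  apply: contraTneq (usg k) => ->; rewrite mulr0 -ltNge mulr_gt0// addr_gt0// exprn_gt0//.
pose B1 := `|B0| + N v0.
have B10 : 0 <= B1 by rewrite addr_ge0// Lp_norm_ge0.
have SNv0 : S (- v0).
  by rewrite -[- v0]add0r; exact: (Lp_setB p1 (Lp_set0 mu X p1) Sv0).
(* The steps add up to [us k - v0], a difference of two points of the support of [g], which is
   bounded. *)
have bd k : N (em (trunc k xs)) <= 4 * B1.
  have -> : em (trunc k xs) = us k + (- v0) by rewrite usE addrC addKr.
  apply: (Lp_norm_quasi p1 (usS k) SNv0).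
  - apply: le_trans (gB _ (usS k) (gne k)) _.
    by apply: (le_trans (ler_norm B0)); rewrite lerDl Lp_norm_ge0.
  - by rewrite Lp_normN lerDr.
have fin := embed_bounded p1 pA dA (mulr_ge0 (ler0n R 4) B10) bd.
pose w := v0 + em xs.
have Sem : S (em xs) := embed_in_Lp p1 pA dA fin.
have Sw : S w := SD _ _ Sv0 Sem.
have [d0 [M [d00 HM]]] := loc w Sw.
pose del := Num.min d0 1.
have del0 : 0 < del by rewrite lt_min d00 ltr01.
have Hw : H w del.
  apply: (@Hmono _ _ d0); first by rewrite /del ge_min lexx.
  by exists M.
(* The step at [k0] will be at most [4 * del / 512 = del / 128] by convergence, but at least
   [del / 64] by the choice of the steps. *)
have eta0 : 0 < del / 8 / 8 / 8.
  have p8 : (0 : R) < 8 by exact: ltr0n.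
  exact: (divr_gt0 (divr_gt0 (divr_gt0 del0 p8) p8) p8).
have [k0 tail] := embed_tail p1 pA dA fin eta0.
have wu k : w - us k = em xs - em (trunc k xs).
  by rewrite usE /w opprD addrACA subrr add0r.
have near_ k : (k0 <= k)%N -> N (w - us k) <= del / 8 / 8 / 8.
  by move=> kk; rewrite wu; exact: tail.
(* The ball of radius [del / 8] around [us k0] lies in that of radius [del] around [w], as
   [4 * (del / 8) < del]. *)
have Hk : H (us k0) (del / 8).
  suff hb v : S v -> N (v - us k0) < del / 8 -> N (v - w) < del.
    by case: Hw => M' HM'; exists M' => y z Sy Sz yd zd; apply: (HM' _ _ Sy Sz (hb _ Sy yd) (hb _ Sz zd)).
  move=> Sv vd; have -> : v - w = (v - us k0) + (us k0 - w) by rewrite addrA subrK.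
  apply: (@le_lt_trans _ _ (4 * (del / 8))); last by lra.
  apply: (Lp_norm_quasi p1 (Lp_setB p1 Sv (usS k0)) (Lp_setB p1 (usS k0) Sw) (ltW vd)).
  rewrite -opprB Lp_normN; apply: le_trans (near_ _ (leqnn _)) _.
  by move: del0; move: (del) => q; lra.
have [dk [dk0 dmax xk _]] := usP k0.
have d8 : del / 8 <= 2 * dk.
  apply: dmax => //; first by rewrite divr_gt0.
  rewrite ler_pdivrMr// mul1r; apply: (@le_trans _ _ 1); last by rewrite ler1n.
  by rewrite /del ge_min lexx orbT.
have : `|xs k0| <= 4 * (del / 8 / 8 / 8).
  have <- : N (em (single k0 (xs k0))) = `|xs k0| by exact: embed_single_norm.
  have -> : em (single k0 (xs k0)) = (us k0.+1 - w) + (w - us k0).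
    by rewrite addrA subrK /= addrC addKr.
  apply: (Lp_norm_quasi p1 (Lp_setB p1 (usS k0.+1) Sw) (Lp_setB p1 Sw (usS k0))).
  - by rewrite -opprB Lp_normN; apply: near_.
  - exact: near_.
move: xk d8 del0 => /=; move: (`|_|) => q; lra.
Qed.

Theorem theorem2p5 (R : realType) (d : measure_display) (T : measurableType d)
  (mu : {measure set T -> \bar R}) (X : completeNormedModType R) (r p : R) :
  Lp_infinite_dim mu p -> 1 < r -> r <= p ->
  ((exists g : X -> R, is_bump setT (fun x : X => `|x|) g /\ uniformly_Hs_smooth setT (fun x : X => `|x|) r g) <->
   (exists g : (T -> X) -> R, is_bump (Lp_set mu p) (Lp_norm mu p) g /\
        uniformly_Hs_smooth (Lp_set mu p) (Lp_norm mu p) r g)) /\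
  ((exists g : (T -> X) -> R, is_bump (Lp_set mu p) (Lp_norm mu p) g /\
        uniformly_Hs_smooth (Lp_set mu p) (Lp_norm mu p) r g) <->
   (exists g : (T -> X) -> R, is_bump (Lp_set mu p) (Lp_norm mu p) g /\
        Hs_smooth (Lp_set mu p) (Lp_norm mu p) r g)).
Proof.
move=> idim r1 rp.
have loc (g : (T -> X) -> R) : uniformly_Hs_smooth (Lp_set mu p) (Lp_norm mu p) r g ->
    Hs_smooth (Lp_set mu p) (Lp_norm mu p) r g.
  move=> [n [nr rn [D [HD [M HM]]]]]; exists n; split=> //; exists D; split=> // x _.
  by exists 1, M; split=> // y z Sy Sz _ _; exact: HM.
have up := @X_bump_Lp R d T mu X r p r1 rp.
have down := @Lp_bump_X R d T mu X r p idim r1 rp.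
split; split.
- exact: up.
- by move=> [g [bg /loc sg]]; apply: down; exists g.
- by move=> [g [bg /loc sg]]; exists g.
- by move=> h; apply: up; apply: down.
Qed.
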